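(* Let $0<\underline{b}<\overline{b}<\infty$, $0<\underline{\alpha}<\overline{\alpha}<\infty$, $\overline{\theta}>0$, $L>0$ and $\lambda\in(0,1]$ be known constants. Let the true parameters $\alpha_0\in[\underline{\alpha},\overline{\alpha}]$ and $\theta_0\colon[0,\infty)\to\mathbb{R}$ satisfy: $\theta_0$ is supported in $[\underline{b},\overline{b}]$, $\|\theta_0\|_\infty<\overline{\theta}$, and $|\theta_0(x)-\theta_0(y)|\le L|x-y|^\lambda$ for all $x,y$. Let $v_0=v_{\alpha_0,\theta_0}$ and let $Z_1,\dots,Z_n$ be i.i.d. with law $\mathbb{Q}_{v_0}$. Let the number of bins $N_n$ satisfy $N_n\to\infty$ and $N_n/n\to 0$ as $n\to\infty$, and let $\Pi_n$ be the prior described in the context. Then for any fixed $\epsilon>0$ and $\varepsilon>0$, \[ \mathbb{Q}_{v_0}^n\Big(\Pi_n\big(v\colon d_{\mathcal H}(\mathbb{Q}_{v_0},\mathbb{Q}_v)>\epsilon \,\big|\, Z_1,\dots,Z_n\big)>\varepsilon\Big)\to 0\quad (n\to\infty). \]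
   Context: For $\alpha>0$ and a bounded measurable $\theta\colon[0,\infty)\to\mathbb{R}$ define the Lévy density $v_{\alpha,\theta}(x)=x^{-1}e^{-\alpha x-\theta(x)}$, $x>0$. For such a density $v$, let $X$ be the Lévy process with Lévy triplet $(\gamma,0,\nu)$, where $\nu(\mathrm{d}x)=v(x)\,\mathrm{d}x$ on $(0,\infty)$ and $\gamma=\int_0^1 x\,\nu(\mathrm{d}x)$ (a pure-jump subordinator with zero drift). $\mathbb{Q}_v$ denotes the law of $X_1$ (equivalently of an increment $X_i-X_{i-1}$); $\mathbb{Q}^n_{v_0}$ denotes the law of $(Z_1,\dots,Z_n)$ under i.i.d. sampling from $\mathbb{Q}_{v_0}$. Prior $\Pi_n$: with $N=N_n$, let $\underline{b}=b_1<b_2<\dots<b_N=\overline{b}$ be an equally spaced grid; a draw is $v=v_{\alpha,\theta}$ where $\theta(x)=\rho_k+\theta_k x$ for $x\in(b_k,b_{k+1}]$, $k=1,\dots,N-1$, and $\theta(x)=0$ for $x\notin(\underline{b},\overline{b}]$; here $\theta_k,\rho_k$ ($k=1,\dots,N-1$) are i.i.d. uniform on $[-\overline{\theta},\overline{\theta}]$, $\alpha$ is uniform on $[\underline{\alpha},\overline{\alpha}]$, and all these are independent. The posterior is $\Pi_n(A\mid Z_1,\dots,Z_n)=\int_A\prod_{i=1}^n\frac{\mathrm{d}\mathbb{Q}_v}{\mathrm{d}\mathbb{Q}_{v_0}}(Z_i)\,\Pi_n(\mathrm{d}v)\big/\int\prod_{i=1}^n\frac{\mathrm{d}\mathbb{Q}_v}{\mathrm{d}\mathbb{Q}_{v_0}}(Z_i)\,\Pi_n(\mathrm{d}v)$.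 $d_{\mathcal H}$ is the Hellinger distance between probability measures, $d^2_{\mathcal H}(P,Q)=\frac12\int(\sqrt{\mathrm{d}P}-\sqrt{\mathrm{d}Q})^2$. *)

(* Defs.v *)
From HB Require Import structures.
From mathcomp Require Import all_boot all_order all_algebra.
From mathcomp Require Import all_classical all_reals all_analysis.
Set Implicit Arguments. Unset Strict Implicit. Unset Printing Implicit Defensive.
Import Order.TTheory GRing.Theory Num.Theory.
Import numFieldNormedType.Exports.
Local Open Scope classical_set_scope.
Local Open Scope ring_scope.

Section Defs.
Variable R : realType.

Definition vfun (a : R) (th : R -> R) (x : R) : R :=
  x^-1 * expR (- (a * x) - th x).

Definition int_pos (f : R -> R) : R :=
  Rintegral lebesgue_measure `]0, +oo[ f.

(* P is the law of X_1 of the Lévy process with Lévy triplet (gamma, 0, nu),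
   nu(dx) = v(x) dx on (0,oo), gamma = int_0^1 x nu(dx); i.e. the infinitely
   divisible law whose characteristic function is (Lévy--Khintchine)
   phi(u) = exp( i u gamma + int (e^{iux} - 1 - i u x 1_{x<1}) nu(dx) ),
   written out in real and imaginary parts. *)
Definition levy_gamma (v : R -> R) : R :=
  Rintegral lebesgue_measure `]0, 1[ (fun x => x * v x).
Definition lk_re (v : R -> R) (u : R) : R :=
  int_pos (fun x => (cos (u * x) - 1) * v x).
Definition lk_im (v : R -> R) (u : R) : R :=
  u * levy_gamma v +
  int_pos (fun x => (sin (u * x) - (if x < 1 then u * x else 0)) * v x).
Definition is_levy_law (v : R -> R) (P : probability R R) : Prop :=
  forall u : R,
    Rintegral P setT (fun x => cos (u * x)) = expR (lk_re v u) * cos (lk_im v u) /\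
    Rintegral P setT (fun x => sin (u * x)) = expR (lk_re v u) * sin (lk_im v u).

(* Canonical version of the Lebesgue density dP/dx:
   x |-> limsup_m P([x - 1/(m+1), x + 1/(m+1)]) / (2/(m+1)). *)
Definition dens (P : probability R R) (x : R) : R :=
  fine (limn_esup (fun m : nat =>
    (((m.+1)%:R / 2 : R)%:E * P [set` `[(x - (m.+1)%:R^-1)%R, (x + (m.+1)%:R^-1)%R]%R])%E)).

Definition hellinger (P Q : probability R R) : R :=
  Num.sqrt (fine (((2^-1 : R)%:E *
    \int[lebesgue_measure]_x ((Num.sqrt (dens P x) - Num.sqrt (dens Q x)) ^+ 2)%:E)%E)).

Fixpoint iter_int (I : nat -> (R -> \bar R) -> \bar R) (k : nat)
    (F : (nat -> R) -> \bar R) : \bar R :=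
  match k with
  | 0 => F (fun _ => 0)
  | k'.+1 => I k' (fun x => iter_int I k' (fun s => F (fun i => if i == k' then x else s i)))
  end.

Definition unif_int (a b : R) (g : R -> \bar R) : \bar R :=
  (((b - a)^-1)%:E * \int[lebesgue_measure]_(x in `[a, b]) g x)%E.

(* prior: coordinate 0 = alpha ~ U[al,ah], other coordinates ~ U[-thb,thb] *)
Definition prior_int (al ah thb : R) (i : nat) : (R -> \bar R) -> \bar R :=
  if i == 0%N then unif_int al ah else unif_int (- thb) thb.

(* number of coordinates of the prior: alpha, theta_1..theta_{N-1}, rho_1..rho_{N-1} *)
Definition prior_dim (N : nat) : nat := (1 + 2 * (N - 1))%N.

Definition grid (bl bh : R) (N k : nat) : R :=
  bl + (k - 1)%:R * (bh - bl) / (N - 1)%:R.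

(* theta(x) = rho_k + theta_k x on (b_k, b_{k+1}], 0 outside (bl, bh];
   theta_k = s k, rho_k = s (N - 1 + k) *)
Definition theta_of (bl bh : R) (N : nat) (s : nat -> R) (x : R) : R :=
  \sum_(1 <= k < N)
    (if (grid bl bh N k < x) && (x <= grid bl bh N k.+1)
     then s (N - 1 + k)%N + s k * x else 0).

Definition posterior (Q : R -> (R -> R) -> probability R R)
    (a0 : R) (th0 : R -> R) (al ah thb bl bh : R) (N n : nat) (eps : R)
    (z : nat -> R) : R :=
  let Q0 := Q a0 th0 in
  let Qs := fun s : nat -> R => Q (s 0%N) (theta_of bl bh N s) in
  let lik := fun s : nat -> R =>
    \prod_(i < n) (dens (Qs s) (z i) / dens Q0 (z i)) in
  let num := iter_int (prior_int al ah thb) (prior_dim N)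
      (fun s => ((if eps < hellinger Q0 (Qs s) then 1 else 0) * lik s)%:E) in
  let den := iter_int (prior_int al ah thb) (prior_dim N)
      (fun s => (lik s)%:E) in
  fine num / fine den.

Definition sample_prob (P : probability R R) (n : nat) (E : (nat -> R) -> Prop) : \bar R :=
  iter_int (fun _ g => (\int[P]_x g x)%E) n (fun z => (if `[< E z >] then 1 else 0 : R)%:E).

End Defs.

(* Main.v *)
(* Since [theta] vanishes below [bl], the law with Lévy density [v_{alpha,theta}]
   is absolutely continuous with density [expR (- alpha x) g_theta x / G alpha],
   where [g_theta] equals [1] on [(0, bl)] and solves
   [x g x = \int_(0 < y < x) g y * expR (- theta (x - y))], and [G] is the
   Laplace transform of [g_theta].  If [|theta - theta'| <= d x], iterating the
   equation gives [g_theta' <= expR (d x) g_theta]; together with a Lipschitz bound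
   on [ln G], this makes two of the densities comparable up to a factor
   [rho * expR (2 d (x + 1))] as soon as their parameters are [d]-close.
   Two consequences:
   - a shifted exponential tilt [alpha - 2 d] absorbs the factor [expR (d x)], so
     a uniform mesh of the parameter box, with a number [m] of points per coordinate
     independent of [N], yields upper brackets [(1 + t^2) P1] of all the laws of
     the model.  The Hellinger affinity of such a bracket with the truth is at most
     [1 - eps^2 + t], so that the likelihood ratios of all [m^k] brackets, with
     [k = prior_dim N <= 2 N], are simultaneously small except with probability
     [m^k expR (- n eps^2 / 2)], up to the normalisation below;
   - the posterior denominator is at least [V * eta^k] for a fixed [eta], with
     [V >= expR (- n eps^2 / 2)], when the mean of the sample is at most [B]; this
     fails with exponentially small probability by the exponential Markov inequality.
   As [N / n --> 0], the terms [m^k] and [eta^k] are subexponential in [n]. *)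

Require Import Defs.
From HB Require Import structures.
From mathcomp Require Import all_boot all_order all_algebra.
From mathcomp Require Import all_classical all_reals all_analysis.
From mathcomp Require Import measurable_realfun zify ring lra.
Import Order.TTheory GRing.Theory Num.Theory.
Import numFieldNormedType.Exports.
Local Open Scope classical_set_scope.
Local Open Scope ring_scope.

(** * Uniqueness of characteristic functions *)

(** Two features of the statement shape the proof. The law [Q a th] is known only through its
    characteristic function, so it must be identified with the explicit density: the Fourier
    transform of a solution of the renewal equation satisfies the differential equation of the
    Lévy--Khintchine exponential, and uniqueness of characteristic functions concludes. Moreover the
    likelihood uses [dens], a version of the density fixed at every point, under iterated integrals
    whose integrands are not shown to be measurable. Hence densities are compared through the
    measures of all small intervals, which yields inequalities valid everywhere, and the integrals
    over the prior and the sample are only bounded by simple majorants and minorants; a finite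
    family of brackets makes such a majorant possible. The closeness condition is
    [|theta - theta'| <= d x] rather than a uniform bound because exp(d x) factorises along a
    convolution; nothing is lost, as the functions vanish on (0, bl). *)

Lemma integral_indicE {d} {T : measurableType d} {R : realType}
    (mu : {measure set T -> \bar R}) (D : set T) (f : T -> R) :
  (\int[mu]_(x in D) (f x)%:E = \int[mu]_x (f x * \1_D x)%:E)%E.
Proof.
rewrite integral_mkcond; apply: eq_integral => x _.
by rewrite epatch_indic/= EFinM.
Qed.

Lemma ge0_measurable_funV {d} {T : measurableType d} {R : realType} (f : T -> R) :
  (forall x, 0 <= f x) -> measurable_fun setT f ->
  measurable_fun setT (fun x => (f x)^-1).
Proof.
move=> f0 mf; have -> : (fun x => (f x)^-1) = (fun x => (f x) `^ (-1)).
  by apply/funext => x; rewrite powR_inv1.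
exact: (measurableT_comp (measurable_powR (-1)) mf).
Qed.

Lemma expR_cos_integral {R : realType} (s x : R) : 0 < s ->
  (\int[lebesgue_measure]_(u in `[0%R, +oo[) (expR (- s * u) * (1 + cos (u * x)))%:E
    = (s^-1 + s / (s ^+ 2 + x ^+ 2))%:E)%E.
Proof.
move=> s0.
have D0 : s ^+ 2 + x ^+ 2 != 0 by rewrite gt_eqF// ltr_wpDr ?sqr_ge0// exprn_gt0.
(* The antiderivative comes from integrating exp(- s u) cos(u x) twice by parts; it vanishes at
   infinity, so the integral is - F 0. *)
pose F (u : R) := expR (- s * u) *
  (- s^-1 + (s ^+ 2 + x ^+ 2)^-1 * (x * sin (u * x) - s * cos (u * x))).
have dF (u : R) : is_derive u 1 F (expR (- s * u) * (1 + cos (u * x))).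
  rewrite /F; apply: is_derive_eq.
  rewrite /GRing.scale/=; field.
  by rewrite D0 gt_eqF.
have cF : continuous F.
  by move=> u; apply: differentiable_continuous; apply/derivable1_diffP; case: (dF u).
rewrite (@ge0_continuous_FTC2y _ _ F 0 0).
- rewrite -EFinB /F mulr0 expR0 mul0r sin0 cos0; congr EFin.
  by field; rewrite D0 gt_eqF.
- by move=> u _; rewrite mulr_ge0 ?expR_ge0// -lerBlDl sub0r cos_geN1.
- apply: continuous_subspaceT => u.
  apply: cvgM; last first.
    apply: cvgD; first exact: cvg_cst.
    apply: (cvg_comp (fun u => u * x) cos); last exact: continuous_cos.
    by apply: cvgM; [exact: cvg_id|exact: cvg_cst].
  apply: (cvg_comp (fun u => - s * u) expR); last exact: continuous_expR.
  by apply: cvgM; [exact: cvg_cst|exact: cvg_id].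
- pose M := s^-1 + (s ^+ 2 + x ^+ 2)^-1 * (`|x| + s).
  have FM u : `|F u| <= expR (- s * u) * M.
    rewrite /F normrM (ger0_norm (expR_ge0 _)) ler_wpM2l ?expR_ge0//.
    rewrite (le_trans (ler_normD _ _))// lerD//.
      by rewrite normrN ger0_norm// invr_ge0 ltW.
    rewrite normrM ger0_norm ?invr_ge0 ?addr_ge0 ?sqr_ge0//.
    rewrite ler_wpM2l ?invr_ge0 ?addr_ge0 ?sqr_ge0//.
    rewrite (le_trans (ler_normB _ _))// !normrM lerD//.
      by rewrite ler_piMr// ler_norml sin_geN1 sin_le1.
    by rewrite (gtr0_norm s0) ler_piMr ?(ltW s0)// ler_norml cos_geN1 cos_le1.
  have eN : expR (- s * u) * M @[u --> +oo%R] --> (0:R).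
    rewrite -[X in _ --> X](mul0r M); apply: cvgM; last exact: cvg_cst.
    under eq_fun do rewrite mulNr.
    apply: (cvg_comp (fun u => s * u) (fun u => expR (- u)) _ (@cvgr_expR R)).
    exact: (gt0_cvgMry s0 cvg_id).
  apply/cvgr0Pnorm_le => e e0.
  move/cvgr0Pnorm_le : eN => /(_ _ e0).
  apply: filterS => u; apply: le_trans; rewrite (le_trans (FM u))//.
  exact: ler_norm.
- by move=> u _; case: (dF u).
- by apply: cvg_at_right_filter; exact: cF.
- by move=> u _; rewrite derive1E; case: (dF u).
Qed.

Lemma measurable_cosM {R : realType} (u : R) : measurable_fun setT (fun x => cos (u * x)).
Proof.
apply: (measurableT_comp (f := cos)); last exact: measurable_funM.
by apply: continuous_measurable_fun; exact: continuous_cos.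
Qed.

Lemma measurable_sinM {R : realType} (u : R) : measurable_fun setT (fun x => sin (u * x)).
Proof.
apply: (measurableT_comp (f := sin)); last exact: measurable_funM.
by apply: continuous_measurable_fun; exact: continuous_sin.
Qed.

Lemma bounded_integrable {d} {T : measurableType d} {R : realType}
    (P : {finite_measure set T -> \bar R}) (f : T -> R) (M : R) :
  measurable_fun setT f -> (forall x, `|f x| <= M) ->
  P.-integrable setT (EFin \o f).
Proof.
move=> mf fM; apply: measurable_bounded_integrable => //.
  by rewrite -ge0_fin_numE// fin_num_measure.
exists M; split; first exact: num_real.
by move=> r Mr x _; exact: le_trans (fM x) (ltW Mr).
Qed.

Lemma EFin_Rintegral {d} {T : measurableType d} {R : realType}
    (mu : {measure set T -> \bar R}) (D : set T) (f : T -> R) :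
  measurable D -> mu.-integrable D (EFin \o f) ->
  (\int[mu]_(x in D) (f x)%:E = (Rintegral mu D f)%:E)%E.
Proof.
by move=> mD fi; rewrite /Rintegral fineK//; exact: integrable_fin_num fi.
Qed.

(* Integrating the characteristic function against [expR (- s u)] and using Fubini
   yields the Poisson kernel [s / (s^2 + (x - y)^2)]; the summand [s^-1], from
   [1 + cos] in place of [cos], keeps the integrand nonnegative. *)
Lemma cf_poisson_eq {R : realType} (P1 P2 : probability R R) :
  (forall u, Rintegral P1 setT (fun x => cos (u * x)) =
             Rintegral P2 setT (fun x => cos (u * x))) ->
  (forall u, Rintegral P1 setT (fun x => sin (u * x)) =
             Rintegral P2 setT (fun x => sin (u * x))) ->
  forall s y, 0 < s ->
  (\int[P1]_x (s^-1 + s / (s ^+ 2 + (x - y) ^+ 2))%:E =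
   \int[P2]_x (s^-1 + s / (s ^+ 2 + (x - y) ^+ 2))%:E)%E.
Proof.
move=> hc hs s y s0.
pose h (x u : R) := expR (- s * u) * (1 + cos (u * (x - y))) * \1_(`[0, +oo[) u.
have key (P : probability R R) :
  (\int[P]_x (s^-1 + s / (s ^+ 2 + (x - y) ^+ 2))%:E =
   \int[lebesgue_measure]_u (expR (- s * u) *
      (1 + cos (u * y) * Rintegral P setT (fun x => cos (u * x))
         + sin (u * y) * Rintegral P setT (fun x => sin (u * x))) * \1_(`[0, +oo[) u)%:E)%E.
  under eq_integral => x _ do rewrite -(expR_cos_integral s _ s0) integral_indicE.
  rewrite (@fubini_tonelli _ _ _ _ _ P lebesgue_measure (fun z => (h z.1 z.2)%:E)); last 2 first.
  { apply/measurable_EFinP; rewrite /h.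
    apply: measurable_funM; last exact: measurableT_comp.
    apply: measurable_funM.
      by apply: measurableT_comp => //; exact: measurable_funM.
    apply: measurable_funD => //.
    apply: (measurableT_comp (f := cos)).
      by apply: continuous_measurable_fun; exact: continuous_cos.
    by apply: measurable_funM => //; exact: measurable_funB. }
  { move=> z; rewrite lee_fin /h mulr_ge0 ?indicE// mulr_ge0 ?expR_ge0//. }
  apply: eq_integral => u _.
  have cosi : P.-integrable setT (EFin \o (fun x => cos (u * x))).
    by apply: (@bounded_integrable _ _ _ P _ 1);
      [exact: measurable_cosM|move=> x; rewrite ler_norml cos_geN1 cos_le1].
  have sini : P.-integrable setT (EFin \o (fun x => sin (u * x))).
    by apply: (@bounded_integrable _ _ _ P _ 1);
      [exact: measurable_sinM|move=> x; rewrite ler_norml sin_geN1 sin_le1].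
  have cosi' : P.-integrable setT (EFin \o (fun x => cos (u * y) * cos (u * x))).
    exact: (integrableZl measurableT _ cosi).
  have sini' : P.-integrable setT (EFin \o (fun x => sin (u * y) * sin (u * x))).
    exact: (integrableZl measurableT _ sini).
  have onei : P.-integrable setT (EFin \o (fun=> 1)).
    exact: finite_measure_integrable_cst.
  have si : P.-integrable setT (EFin \o (fun x => 1 + cos (u * y) * cos (u * x))).
    exact: (integrableD measurableT onei cosi').
  have ti : P.-integrable setT (EFin \o
      (fun x => 1 + cos (u * y) * cos (u * x) + sin (u * y) * sin (u * x))).
    exact: (integrableD measurableT si sini').
  pose k := expR (- s * u) * \1_(`[0, +oo[) u.
  transitivity (\int[P]_x (k * (1 + cos (u * y) * cos (u * x) + sin (u * y) * sin (u * x)))%:E)%E.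
    apply: eq_integral => x _; congr EFin; rewrite /h /k mulrBr cosB; ring.
  rewrite EFin_Rintegral//; last exact: (integrableZl measurableT k ti).
  rewrite RintegralZl// RintegralD// RintegralD// !RintegralZl//.
  rewrite Rintegral_cst//= probability_setT /=; congr EFin; rewrite /k; ring.
by rewrite !key; apply: eq_integral => u _; rewrite hc hs.
Qed.

Lemma poisson_integral {R : realType} (s x a b : R) : 0 < s -> a < b ->
  (\int[lebesgue_measure]_(y in `[a, b]) (s^-1 + s / (s ^+ 2 + (x - y) ^+ 2))%:E
    = ((b - a) / s + (atan ((b - x) / s) - atan ((a - x) / s)))%:E)%E.
Proof.
move=> s0 ab.
have D0 y : s ^+ 2 + (x - y) ^+ 2 != 0.
  by rewrite gt_eqF// ltr_wpDr ?sqr_ge0// exprn_gt0.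
pose F (y : R) := y / s + atan ((y - x) / s).
have dF (y : R) : is_derive y 1 F (s^-1 + s / (s ^+ 2 + (x - y) ^+ 2)).
  have dg : is_derive y (1:R) (fun y => (y - x) / s) s^-1.
    by apply: is_derive_eq; rewrite /GRing.scale/= subr0 mulr1 mulr0 add0r.
  have := @is_derive1_comp _ _ (fun y => (y - x) / s) y _ _ (is_derive1_atan _) dg.
  move=> da; rewrite /F; apply: is_derive_eq.
  rewrite /GRing.scale/= mulr1 mulr0 add0r; congr (_ + _); field.
  by rewrite D0 gt_eqF.
have cF : continuous F.
  by move=> u; apply: differentiable_continuous; apply/derivable1_diffP; case: (dF u).
rewrite (@continuous_FTC2 _ _ F)//.
- by rewrite -EFinB /F; congr EFin; ring.
- apply: continuous_subspaceT => y.
  apply: cvgD; first exact: cvg_cst.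
  apply: cvgM; first exact: cvg_cst.
  apply: cvgV; first exact: D0.
  apply: cvgD; first exact: cvg_cst.
  apply: (@cvg_comp _ _ _ (fun y => x - y) (fun y => y ^+ 2)); last exact: exprn_continuous.
  by apply: cvgB; [exact: cvg_cst|exact: cvg_id].
- split; first by move=> u _; case: (dF u).
  + by apply: cvg_at_right_filter; exact: cF.
  + by apply: cvg_at_left_filter; exact: cF.
- by move=> u _; rewrite derive1E; case: (dF u).
Qed.

Lemma measurable_atan {R : realType} : measurable_fun setT (@atan R).
Proof. by apply: continuous_measurable_fun; exact: continuous_atan. Qed.

(** Integrating the Poisson kernels over y in [a, b], by Tonelli, leaves the constant (b - a) / s,
    which is the same for both laws and cancels, and the mean of a difference of arctangents: a
    smoothed multiple of the indicator of [a, b]. *)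
Lemma cf_atan_eq {R : realType} (P1 P2 : probability R R) :
  (forall u, Rintegral P1 setT (fun x => cos (u * x)) =
             Rintegral P2 setT (fun x => cos (u * x))) ->
  (forall u, Rintegral P1 setT (fun x => sin (u * x)) =
             Rintegral P2 setT (fun x => sin (u * x))) ->
  forall s a b, 0 < s -> a < b ->
  Rintegral P1 setT (fun x => atan ((b - x) / s) - atan ((a - x) / s)) =
  Rintegral P2 setT (fun x => atan ((b - x) / s) - atan ((a - x) / s)).
Proof.
move=> hc hs s a b s0 ab.
pose A (x : R) := atan ((b - x) / s) - atan ((a - x) / s).
have mA : measurable_fun setT A.
  apply: measurable_funB; apply: (measurableT_comp measurable_atan);
    apply: measurable_funM => //; exact: measurable_funB.
have iA (P : probability R R) : P.-integrable setT (EFin \o A).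
  apply: (@bounded_integrable _ _ _ P _ pi) => // x.
  rewrite (le_trans (ler_normB _ _))//.
  have h (z : R) : `|atan z| <= pi / 2.
    by rewrite ler_norml ltW ?atan_gtNpi2// ltW// atan_ltpi2.
  by have := h ((b - x) / s); have := h ((a - x) / s); lra.
have key (P : probability R R) :
   (((b - a) / s + Rintegral P setT A)%:E =
    \int[lebesgue_measure]_(y in `[a, b])
       \int[P]_x (s^-1 + s / (s ^+ 2 + (x - y) ^+ 2))%:E)%E.
  pose h (y x : R) := (s^-1 + s / (s ^+ 2 + (x - y) ^+ 2)) * \1_(`[a, b]) y.
  have h0 y x : 0 <= s^-1 + s / (s ^+ 2 + (x - y) ^+ 2).
    by rewrite addr_ge0 ?divr_ge0 ?addr_ge0 ?sqr_ge0// ?invr_ge0 ltW.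
  have mh d (T : measurableType d) (f g : T -> R) : measurable_fun setT f ->
      measurable_fun setT g ->
      measurable_fun setT (fun z => s^-1 + s / (s ^+ 2 + (f z - g z) ^+ 2)).
    move=> mf mg; apply: measurable_funD => //; apply: measurable_funM => //.
    apply: ge0_measurable_funV => [z|]; first by rewrite addr_ge0 ?sqr_ge0.
    apply: measurable_funD => //; apply: measurable_funX.
    exact: measurable_funB.
  transitivity (\int[lebesgue_measure]_y \int[P]_x (h y x)%:E)%E; last first.
  { rewrite [RHS]integral_mkcond; apply: eq_integral => y _.
    rewrite epatch_indic/= muleC -ge0_integralZl//=.
    - by apply: eq_integral => x _; rewrite /h mulrC EFinM.
    - apply/measurable_EFinP.
      exact: mh.
    - by move=> x _; exact: h0. }
  rewrite -(@fubini_tonelli _ _ _ _ _ P lebesgue_measure (fun z => (h z.2 z.1)%:E)); last 2 first.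
  { apply/measurable_EFinP; apply: measurable_funM.
      exact: mh.
    exact: measurableT_comp. }
  { by move=> z; rewrite lee_fin /h mulr_ge0//= indicE. }
  have onei : P.-integrable setT (EFin \o (fun=> (b - a) / s)).
    exact: finite_measure_integrable_cst.
  transitivity (\int[P]_x ((b - a) / s + A x)%:E)%E; last first.
    apply: eq_integral => x _.
    by rewrite -(poisson_integral s x a b s0 ab) integral_indicE.
  rewrite EFin_Rintegral//; last exact: (integrableD measurableT onei (iA P)).
  congr EFin; rewrite (@RintegralD _ _ _ P setT (fun=> (b - a) / s) A) ?iA//.
  by rewrite Rintegral_cst//= probability_setT /= mulr1.
have : (((b - a) / s + Rintegral P1 setT A)%:E = ((b - a) / s + Rintegral P2 setT A)%:E)%E.
  rewrite !key; apply: eq_integral => y _.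
  exact: cf_poisson_eq.
by move=> [/addrI].
Qed.

Lemma cvg_atan_pinfty {R : realType} (u : R^nat) :
  (\forall m \near \oo, m.+1%:R <= u m) -> atan (u m) @[m --> \oo] --> pi / 2.
Proof.
move=> h; apply: (cvg_comp u atan _ (@cvgy_atan R)).
apply/cvgryPge => A; near=> m.
apply: (@le_trans _ _ m.+1%:R); last by near: m.
rewrite (@le_trans _ _ m%:R) ?ler_nat//.
by near: m; exact: nbhs_infty_ger.
Unshelve. all: by end_near. Qed.

Lemma cvg_atan_ninfty {R : realType} (u : R^nat) :
  (\forall m \near \oo, m.+1%:R <= - u m) -> atan (u m) @[m --> \oo] --> - (pi / 2).
Proof.
move=> /cvg_atan_pinfty/cvgN.
by have -> : - (fun m => atan (- u m)) = (fun m => atan (u m))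
  by apply/funext => m; rewrite -[LHS]/(- atan (- u m)) atanN opprK.
Qed.

(* If [b_m] decreases to [b], [a_m] to [-oo] and [s_m] vanishes faster than [b_m - b],
   then [atan ((b_m - x) / s_m) - atan ((a_m - x) / s_m)] tends to [pi * \1_(x <= b)]. *)
Lemma cf_unique {R : realType} (P1 P2 : probability R R) :
  (forall u, Rintegral P1 setT (fun x => cos (u * x)) =
             Rintegral P2 setT (fun x => cos (u * x))) ->
  (forall u, Rintegral P1 setT (fun x => sin (u * x)) =
             Rintegral P2 setT (fun x => sin (u * x))) ->
  forall A, measurable A -> P1 A = P2 A.
Proof.
move=> hc hs.
have cdfE b : P1 `]-oo, b]%classic = P2 `]-oo, b]%classic.
  pose s (m : nat) : R := m.+1%:R^-1 ^+ 2.
  pose bm (m : nat) : R := b + m.+1%:R^-1.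
  pose am (m : nat) : R := b - m.+1%:R.
  pose f m x := atan ((bm m - x) / s m) - atan ((am m - x) / s m).
  have s0 m : 0 < s m by rewrite exprn_gt0// invr_gt0.
  have invs m : (s m)^-1 = m.+1%:R ^+ 2 by rewrite /s exprVn invrK.
  have N1 m : 1 <= m.+1%:R :> R by rewrite ler1n.
  have mf m : measurable_fun setT (f m).
    apply: measurable_funB; apply: (measurableT_comp measurable_atan);
      apply: measurable_funM => //; exact: measurable_funB.
  have at_le (z : R) : `|atan z| <= pi / 2.
    by rewrite ler_norml ltW ?atan_gtNpi2// ltW// atan_ltpi2.
  have fle m x : `|f m x| <= pi.
    rewrite (le_trans (ler_normB _ _))//.
    by have := at_le ((bm m - x) / s m); have := at_le ((am m - x) / s m); lra.
  have fcvg x : f m x @[m --> \oo] --> pi * \1_(`]-oo, b]) x.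
    have am_cvg : atan ((am m - x) / s m) @[m --> \oo] --> - (pi / 2).
      apply: cvg_atan_ninfty; near=> m.
      rewrite /am invs.
      have : b - x + 1 <= m.+1%:R.
        rewrite (@le_trans _ _ m%:R) ?ler_nat//.
        by near: m; exact: nbhs_infty_ger.
      move: (N1 m); set n := m.+1%:R; nra.
    rewrite indicE; have [xb|xb] := leP x b.
      rewrite mem_set ?mulr1 /=; last by rewrite in_itv.
      rewrite [X in _ --> X](_ : _ = pi / 2 - - (pi / 2)); last lra.
      apply: cvgB => //; apply: cvg_atan_pinfty; near=> m.
      rewrite /bm invs mulrDl mulrDl -mulrDl.
      rewrite [X in _ <= X](_ : _ = (b - x) * m.+1%:R ^+ 2 + m.+1%:R); last by field.
      by rewrite lerDr mulr_ge0 ?subr_ge0// sqr_ge0.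
    rewrite memNset ?mulr0 /=; last by rewrite in_itv/=; apply/negP; rewrite -ltNge.
    rewrite [X in _ --> X](_ : _ = - (pi / 2) - - (pi / 2)); last lra.
    apply: cvgB => //; apply: cvg_atan_ninfty; near=> m.
    rewrite /bm invs.
    rewrite [X in _ <= X](_ : _ = m.+1%:R * ((x - b) * m.+1%:R - 1)); last by field.
    rewrite ler_peMr// lerBrDr -ler_pdivrMl ?subr_gt0//.
    rewrite (@le_trans _ _ m%:R) ?ler_nat//.
    by near: m; exact: nbhs_infty_ger.
  have key (P : probability R R) :
     (\int[P]_x (f m x)%:E @[m --> \oo] --> (pi : R)%:E * P `]-oo, b]%classic)%E.
    rewrite (_ : (pi%:E * P `]-oo, b]%classic)%E = (\int[P]_x (pi * \1_(`]-oo, b]) x)%:E)%E); last first.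
    { under eq_integral do rewrite EFinM.
      rewrite ge0_integralZl//=; first by rewrite integral_indic ?setIT.
      - by apply/measurable_EFinP.
      - by rewrite lee_fin pi_ge0. }
  { apply: (@dominated_cvg _ _ _ P setT _ (fun m x => (f m x)%:E) _ (EFin \o cst pi)); [by []| | | | |].
    - by move=> m; apply/measurable_EFinP.
    - by move=> x _; apply: cvg_EFin; [exact: nearW|exact: fcvg].
    - by [].
    - exact: finite_measure_integrable_cst.
    - by move=> m x _; rewrite /= lee_fin. }
  have e m : (\int[P1]_x (f m x)%:E = \int[P2]_x (f m x)%:E)%E.
    rewrite (EFin_Rintegral P1)//; last exact: (@bounded_integrable _ _ _ P1 _ pi).
    rewrite (EFin_Rintegral P2)//; last exact: (@bounded_integrable _ _ _ P2 _ pi).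
    congr EFin; apply: cf_atan_eq => //.
    by rewrite /am /bm ltrD2l (@lt_trans _ _ 0) ?invr_gt0// oppr_lt0.
  have := key P1; under eq_fun do rewrite e.
  move=> k1.
  have h : ((pi : R)%:E * P1 `]-oo, b]%classic = (pi : R)%:E * P2 `]-oo, b]%classic)%E.
    exact: cvg_unique k1 (key P2).
  have pi0 : pi != 0 :> R by rewrite gt_eqF// pi_gt0.
  have f1 : P1 `]-oo, b]%classic \is a fin_num by exact: fin_num_measure.
  have f2 : P2 `]-oo, b]%classic \is a fin_num by exact: fin_num_measure.
  move: h; rewrite -(fineK f1) -(fineK f2) -!EFinM => -[/(mulfI pi0) ->] //.
have pieq (I : set R) : ocitv I -> P1 I = P2 I.
  move=> [[a b] _ <-] /=.
  have [ab|ba] := ltP a b; last by rewrite set_itv_ge ?measure0// bnd_simp -leNgt.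
  have -> : `]a, b]%classic = `]-oo, b] `\` `]-oo, a].
    by rewrite -[RHS]setCK setCD setCitvl setUC -[LHS]setCK setCitv.
  have sub : `]-oo, a]%classic `<=` `]-oo, b]%classic by apply: subset_itvl; rewrite bnd_simp ltW.
  have fin (P : probability R R) (A : set R) : measurable A -> (P A < +oo)%E.
    by move=> mA; rewrite -ge0_fin_numE// fin_num_measure.
  by rewrite !measureD//= ?fin// !setIidr// !cdfE.
move=> A mA.
apply: (@measure_unique _ R _ (@ocitv R) (fun n => `](- n%:R), n%:R]%classic) _ (@ocitvI R) _ _ P1 P2) => //.
- by move=> i; exact: is_ocitv.
- exact: bigcup_itvT.
- by move=> k; rewrite -ge0_fin_numE// fin_num_measure.
Unshelve. all: by end_near. Qed.

(** * The renewal equation x g = g * k *)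

(** The function [f] takes extended values because the finiteness of the approximations
    [renewal_seq] is only proved afterwards, by a polynomial bound. *)
Definition conv {R : realType} (f : R -> \bar R) (k : R -> R) (x : R) : \bar R :=
  (\int[lebesgue_measure]_y (f y * (k (x - y))%:E))%E.

(* Increasing approximations of the solution of [x g x = conv g k x] for [x >= b], with
   [g = 1] on [(0, b)]. *)
Fixpoint renewal_seq {R : realType} (b : R) (k : R -> R) (n : nat) (x : R) : \bar R :=
  if x <= 0 then 0%E else if x < b then 1%E else
  if n is n'.+1 then ((x^-1)%:E * conv (renewal_seq b k n') k x)%E else 0%E.

Definition renewal {R : realType} (b : R) (k : R -> R) (x : R) : R :=
  fine (limn (fun n => renewal_seq b k n x)).

(** As k = 1 on (0, b), the constant 1 solves x g = g * k there; the values of g can thus be frozen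
    on (0, b), and the division by x takes place only for x >= b. The bound K controls the growth of
    g. *)
Definition renewal_kernel {R : realType} (b K : R) (k : R -> R) : Prop :=
  [/\ measurable_fun setT k, forall z, 0 <= k z <= K,
      forall z, z <= 0 -> k z = 0 & forall z, 0 < z < b -> k z = 1].

Lemma measurable_inv {R : realType} : measurable_fun setT (fun x : R => x^-1).
Proof.
have -> : (fun x : R => x^-1) = (fun x => x * (x ^+ 2)^-1).
  apply/funext => x; have [->|x0] := eqVneq x 0; first by rewrite invr0 mul0r.
  by field.
apply: measurable_funM => //; apply: ge0_measurable_funV => [x|]; first exact: sqr_ge0.
exact: measurable_funX.
Qed.

Lemma integral_poly1 {R : realType} (K x : R) (p : nat) : 0 < x ->
  (\int[lebesgue_measure]_(y in `[0%R, x]) (K * (1 + y) ^+ p)%:E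
    = (K * ((1 + x) ^+ p.+1 - 1) / p.+1%:R)%:E)%E.
Proof.
move=> x0; pose F (y : R) := K * (1 + y) ^+ p.+1 / p.+1%:R.
have dF (y : R) : is_derive y 1 F (K * (1 + y) ^+ p).
  have d1 : is_derive y (1:R) (fun z : R => 1 + z) 1.
    have := is_deriveD (is_derive_cst (1 : R) y 1) (is_derive_id y (1 : R)).
    by rewrite add0r.
  have dX : is_derive y (1:R) (fun z : R => (1 + z) ^+ p.+1) (p.+1%:R * (1 + y) ^+ p).
    have := @is_deriveX _ _ (fun z : R => 1 + z) p.+1 y 1 1 d1.
    have -> : (fun z : R => 1 + z) ^+ p.+1 = (fun z => (1 + z) ^+ p.+1).
      by apply/funext => z; rewrite exprfctE.
    by rewrite /GRing.scale/= mulr1.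
  rewrite /F; apply: is_derive_eq.
  have N0 : p.+1%:R != 0 :> R by rewrite pnatr_eq0.
  by move: N0; rewrite /GRing.scale/=; set N := p.+1%:R => N0; field.
have cF : continuous F.
  by move=> u; apply: differentiable_continuous; apply/derivable1_diffP; case: (dF u).
rewrite (@continuous_FTC2 _ _ F)//.
- rewrite -EFinB /F addr0 expr1n; congr EFin.
  by rewrite -mulrBl -mulrBr.
- apply: continuous_subspaceT => y.
  apply: cvgM; first exact: cvg_cst.
  apply: (@cvg_comp _ _ _ (fun y => 1 + y) (fun y => y ^+ p)); last exact: exprn_continuous.
  by apply: cvgD; [exact: cvg_cst|exact: cvg_id].
- split; first by move=> u _; case: (dF u).
  + by apply: cvg_at_right_filter; exact: cF.
  + by apply: cvg_at_left_filter; exact: cF.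
- by move=> u _; rewrite derive1E; case: (dF u).
Qed.

Section renewal.
Context {R : realType} (b K : R) (b0 : 0 < b).
Implicit Types (k : R -> R) (f : R -> \bar R).

Lemma measurable_conv f k : measurable_fun setT f -> (forall x, 0 <= f x)%E ->
  measurable_fun setT k -> (forall x, 0 <= k x) ->
  measurable_fun setT (conv f k).
Proof.
move=> mf f0 mk k0.
apply: (@measurable_fun_fubini_tonelli_F _ _ R _ R lebesgue_measure
  (fun z => (f z.2 * (k (z.1 - z.2))%:E)%E)); last first.
  by move=> z; rewrite mule_ge0// lee_fin.
apply: emeasurable_funM; first exact: measurableT_comp.
apply/measurable_EFinP; apply: measurableT_comp => //.
exact: measurable_funB.
Qed.

Lemma measurable_conv_integrand f k x : measurable_fun setT f ->
  measurable_fun setT k -> measurable_fun setT (fun y => f y * (k (x - y))%:E)%E.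
Proof.
move=> mf mk; apply: emeasurable_funM => //.
apply/measurable_EFinP; apply: measurableT_comp => //.
exact: measurable_funB.
Qed.

Lemma conv_ge0 f k x : (forall x, 0 <= f x)%E -> (forall x, 0 <= k x) ->
  (0 <= conv f k x)%E.
Proof. by move=> f0 k0; apply: integral_ge0 => y _; rewrite mule_ge0// lee_fin. Qed.

Lemma renewal_seqS k n x : renewal_seq b k n.+1 x =
  if x <= 0 then 0%E else if x < b then 1%E else
  ((x^-1)%:E * conv (renewal_seq b k n) k x)%E.
Proof. by []. Qed.

Lemma renewal_seq_ge0 k n x : (forall z, 0 <= k z) -> (0 <= renewal_seq b k n x)%E.
Proof.
move=> k0; elim: n x => [|n IH] x /=; case: ifPn => // x0; case: ifPn => // _.
rewrite mule_ge0//; last exact: conv_ge0.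
by rewrite lee_fin invr_ge0 ltW// ltNge.
Qed.

Lemma renewal_seq_le0 k n x : x <= 0 -> renewal_seq b k n x = 0%E.
Proof. by case: n => [|n] /= ->. Qed.

Lemma renewal_seq_gap k n x : 0 < x < b -> renewal_seq b k n x = 1%E.
Proof. by case: n => [|n] /= /andP[/lt_geF-> ->]. Qed.

Lemma measurable_renewal_seq k n : renewal_kernel b K k ->
  measurable_fun setT (renewal_seq b k n).
Proof.
move=> [mk kK _ _]; have k0 z : 0 <= k z by have /andP[] := kK z.
elim: n => [|n IH].
  apply: measurable_fun_ifT => //; first exact: measurable_fun_ler.
  by apply: measurable_fun_ifT => //; exact: measurable_fun_ltr.
apply: measurable_fun_ifT => //; first exact: measurable_fun_ler.
apply: measurable_fun_ifT => //; first exact: measurable_fun_ltr.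
apply: emeasurable_funM; last first.
  by apply: measurable_conv => // x; exact: renewal_seq_ge0.
by apply/measurable_EFinP; apply: measurable_inv.
Qed.

Lemma renewal_seq_le k n x : renewal_kernel b K k ->
  (renewal_seq b k n x <= renewal_seq b k n.+1 x)%E.
Proof.
move=> hk; have [mk kK _ _] := hk; have k0 z : 0 <= k z by have /andP[] := kK z.
elim: n x => [|n IH] x.
  rewrite /=; case: ifPn => // x0; case: ifPn => // _.
  apply: mule_ge0; first by rewrite lee_fin invr_ge0 ltW// ltNge.
  by apply: conv_ge0 => // y; exact: (renewal_seq_ge0 k 0).
rewrite [leRHS]renewal_seqS [leLHS]renewal_seqS; case: ifPn => // x0; case: ifPn => // _.
apply: lee_wpmul2l; first by rewrite lee_fin invr_ge0 ltW// ltNge.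
apply: ge0_le_integral => //.
- by move=> y _; rewrite mule_ge0 ?lee_fin ?renewal_seq_ge0.
- by apply: measurable_conv_integrand => //; exact: measurable_renewal_seq.
- by apply: measurable_conv_integrand => //; exact: (measurable_renewal_seq k n.+1).
- by move=> y _; apply: lee_wpmul2r; rewrite ?lee_fin.
Qed.

(** Since exp(c x) = exp(c y) exp(c (x - y)), an exponential factor on the kernel passes through the
    convolution and reappears unchanged on the solution. *)
Lemma renewal_seq_tilt k k' c n x : renewal_kernel b K k -> renewal_kernel b K k' ->
  0 <= c -> (forall z, 0 < z -> k' z <= expR (c * z) * k z) ->
  (renewal_seq b k' n x <= (expR (c * x))%:E * renewal_seq b k n x)%E.
Proof.
move=> hk hk' c0 kk'.
have [mk kK kn _] := hk; have k0 z : 0 <= k z by have /andP[] := kK z.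
have [mk' kK' kn' _] := hk'; have k0' z : 0 <= k' z by have /andP[] := kK' z.
elim: n x => [|n IH] x.
  rewrite /=; case: ifPn => x0; first by rewrite mule0.
  case: ifPn => _; last by rewrite mule0.
  by rewrite mule1 lee_fin -[leLHS]expR0 ler_expR mulr_ge0// ltW// ltNge.
rewrite /=; case: ifPn => x0; first by rewrite mule0.
case: ifPn => _.
  by rewrite mule1 lee_fin -[leLHS]expR0 ler_expR mulr_ge0// ltW// ltNge.
rewrite muleCA; apply: lee_wpmul2l; first by rewrite lee_fin invr_ge0 ltW// ltNge.
rewrite -ge0_integralZl//; last 2 first.
{ by apply: measurable_conv_integrand => //; exact: measurable_renewal_seq. }
{ by move=> y _; rewrite mule_ge0 ?lee_fin ?renewal_seq_ge0. }
apply: ge0_le_integral => //.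
- by move=> y _; rewrite mule_ge0 ?lee_fin ?renewal_seq_ge0.
- by apply: measurable_conv_integrand => //; exact: measurable_renewal_seq.
- apply: emeasurable_funM => //; apply: measurable_conv_integrand => //.
  exact: measurable_renewal_seq.
- move=> y _.
  apply: (@le_trans _ _ (((expR (c * y))%:E * renewal_seq b k n y) *
     (expR (c * (x - y)) * k (x - y))%:E)%E).
    apply: lee_pmul; rewrite ?lee_fin ?renewal_seq_ge0//.
    have [z0|z0] := leP (x - y) 0; last exact: kk'.
    by rewrite kn'// mulr_ge0 ?expR_ge0.
  rewrite EFinM !muleA [X in (X * _)%E]muleAC -EFinM -expRD.
  by rewrite -mulrDr subrKC.
Qed.

(** The function (1 + x)^p is a supersolution: the integral of K (1 + y)^p over [0, x] is at most K
    (1 + x)^(p+1) / (p + 1), and (1 + x) / x <= 1 + 1 / b for x >= b. *)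
Lemma renewal_seq_poly k p n x : renewal_kernel b K k ->
  K * (1 + b^-1) <= p.+1%:R -> 0 <= x ->
  (renewal_seq b k n x <= ((1 + x) ^+ p)%:E)%E.
Proof.
move=> hk hp; have [mk kK kn _] := hk.
have k0 z : 0 <= k z by have /andP[] := kK z.
have pow1 (z : R) : 0 <= z -> 1 <= (1 + z) ^+ p by move=> z0; rewrite exprn_ege1// lerDl.
have pow0 (z : R) : 0 <= z -> 0 <= (1 + z) ^+ p by move=> /pow1; exact: le_trans.
elim: n x => [|n IH] x x0 /=; (case: ifPn => xneg; first by rewrite lee_fin pow0);
  (case: ifPn => xb; first by rewrite lee_fin pow1); first by rewrite lee_fin pow0.
have xgt0 : 0 < x by rewrite ltNge.
rewrite muleC lee_pdivrMr//.
apply: (@le_trans _ _ (\int[lebesgue_measure]_(y in `[0%R, x]) (K * (1 + y) ^+ p)%:E)%E).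
{ rewrite [leRHS]integral_mkcond.
  apply: ge0_le_integral => //.
  - by move=> y _; rewrite mule_ge0 ?lee_fin ?renewal_seq_ge0.
  - by apply: measurable_conv_integrand => //; exact: measurable_renewal_seq.
  - apply: (iffLR (measurable_restrictT _ (measurable_itv _))); apply: measurable_funTS.
    apply/measurable_EFinP; apply: measurable_funM => //.
    by apply: measurable_funX; exact: measurable_funD.
  - have K0 : 0 <= K by have /andP[k00 k01] := kK 0; exact: le_trans k00 k01.
    move=> y _; rewrite epatch_indic /= indicE.
    have rhs0 : (0 <= (K * (1 + y) ^+ p)%:E * ((y \in `[0, x]%classic)%:R)%:E)%E.
      have [|_] := boolP (y \in `[0, x]%classic); last by rewrite mule0.
      by rewrite inE/= in_itv/= => /andP[y0 _]; rewrite mule1 lee_fin mulr_ge0// pow0.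
    have [y0|y0] := leP y 0; first by rewrite renewal_seq_le0// mul0e.
    have [xy|yx] := leP x y; first by rewrite kn ?subr_le0// mule0.
    rewrite mem_set; last by rewrite /= in_itv/= !ltW.
    rewrite mule1 muleC EFinM; apply: lee_pmul; rewrite ?lee_fin ?renewal_seq_ge0//.
      by have /andP[] := kK (x - y).
    by rewrite IH// ltW. }
rewrite integral_poly1// -EFinM lee_fin.
have bx : b <= x by rewrite leNgt.
have p0 : 0 < p.+1%:R :> R by rewrite ltr0n.
rewrite ler_pdivrMr//.
have K0 : 0 <= K by have /andP[k00 k01] := kK 0; exact: le_trans k00 k01.
have h : K * (1 + x) <= p.+1%:R * x.
  apply: (@le_trans _ _ (K * (1 + b^-1) * x)); last by rewrite ler_wpM2r.
  rewrite -mulrA ler_wpM2l// mulrDl mul1r addrC lerD2l.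
  by rewrite ler_pdivlMl// mulr1.
apply: (@le_trans _ _ (K * (1 + x) * (1 + x) ^+ p)).
  by rewrite -mulrA -exprS ler_wpM2l// gerBl.
rewrite [leRHS](_ : _ = p.+1%:R * x * (1 + x) ^+ p); last by rewrite mulrC mulrCA mulrC.
by rewrite ler_wpM2r// pow0.
Qed.

Lemma renewal_degree : exists p, K * (1 + b^-1) <= p.+1%:R.
Proof.
exists (Num.bound `|K * (1 + b^-1)|); apply: (le_trans (ler_norm _)).
by rewrite (le_trans (ltW (archi_boundP (normr_ge0 _))))// ler_nat.
Qed.

Lemma renewal_seq_nd k x : renewal_kernel b K k ->
  {homo (fun n => renewal_seq b k n x) : m n / (m <= n)%N >-> (m <= n)%E}.
Proof. by move=> hk; apply/nondecreasing_seqP => n; exact: renewal_seq_le. Qed.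

Lemma renewal_seq_cvg k x : renewal_kernel b K k ->
  (renewal_seq b k n x @[n --> \oo] --> (renewal b k x)%:E)%E.
Proof.
move=> hk; have [mk kK kn _] := hk; have [p hp] := renewal_degree.
have k0 z : 0 <= k z by have /andP[] := kK z.
have nd := renewal_seq_nd k x hk.
have cv := ereal_nondecreasing_is_cvgn nd.
rewrite /renewal fineK; first exact: cv.
rewrite fin_numElt (@lt_le_trans _ _ 0%E)//=; last first.
  by apply: lime_ge => //; apply: nearW => n; exact: renewal_seq_ge0.
apply: (@le_lt_trans _ _ ((1 + Num.max x 0) ^+ p)%:E); last exact: ltry.
apply: lime_le => //; apply: nearW => n.
have [x0|x0] := leP x 0.
  by rewrite renewal_seq_le0// lee_fin exprn_ge0// addr_ge0.
by rewrite (renewal_seq_poly k p n x hk hp)// ltW.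
Qed.


Lemma renewal_seq_le_lim k n x : renewal_kernel b K k ->
  (renewal_seq b k n x <= (renewal b k x)%:E)%E.
Proof.
move=> hk; rewrite -(cvg_lim _ (renewal_seq_cvg k x hk))//.
apply: lime_ge; first by apply/cvg_ex; eexists; exact: renewal_seq_cvg hk.
by exists n => //= m nm; exact: renewal_seq_nd.
Qed.

Lemma renewal_le k x (M : R) : renewal_kernel b K k ->
  (forall n, renewal_seq b k n x <= M%:E)%E -> renewal b k x <= M.
Proof.
move=> hk hM; rewrite -lee_fin -(cvg_lim _ (renewal_seq_cvg k x hk))//.
by apply: lime_le; [apply/cvg_ex; eexists; exact: renewal_seq_cvg hk|exact: nearW].
Qed.

Lemma renewal_ge0 k x : renewal_kernel b K k -> 0 <= renewal b k x.
Proof.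
move=> hk; rewrite -lee_fin (le_trans _ (renewal_seq_le_lim k 0 x hk))//.
by apply: renewal_seq_ge0 => z; have [_ /(_ z)/andP[]] := hk.
Qed.

Lemma renewal_le0 k x : renewal_kernel b K k -> x <= 0 -> renewal b k x = 0.
Proof.
move=> hk x0; apply/eqP; rewrite eq_le renewal_ge0// andbT.
by apply: renewal_le => // n; rewrite renewal_seq_le0.
Qed.

Lemma renewal_gap k x : renewal_kernel b K k -> 0 < x < b -> renewal b k x = 1.
Proof.
move=> hk xb; apply/eqP; rewrite eq_le -[X in _ && X]lee_fin.
rewrite (le_trans _ (renewal_seq_le_lim k 0 x hk)) ?renewal_seq_gap// andbT.
by apply: renewal_le => // n; rewrite renewal_seq_gap.
Qed.

Lemma renewal_poly k : renewal_kernel b K k ->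
  exists p, forall x, 0 <= x -> renewal b k x <= (1 + x) ^+ p.
Proof.
move=> hk; have [p hp] := renewal_degree; exists p => x x0.
by apply: renewal_le => // n; exact: renewal_seq_poly.
Qed.

Lemma renewal_tilt k k' c x : renewal_kernel b K k -> renewal_kernel b K k' ->
  0 <= c -> (forall z, 0 < z -> k' z <= expR (c * z) * k z) ->
  renewal b k' x <= expR (c * x) * renewal b k x.
Proof.
move=> hk hk' c0 kk'; apply: renewal_le => // n.
rewrite (le_trans (renewal_seq_tilt k k' c n x hk hk' c0 kk'))// EFinM.
by apply: lee_wpmul2l; [rewrite lee_fin expR_ge0|exact: renewal_seq_le_lim].
Qed.

Lemma measurable_renewal k : renewal_kernel b K k -> measurable_fun setT (renewal b k).
Proof.
move=> hk; apply/measurable_EFinP.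
apply: (emeasurable_fun_cvg (renewal_seq b k)).
  by move=> n; exact: measurable_renewal_seq.
by move=> x _; exact: renewal_seq_cvg.
Qed.

(** For x <= 0 both sides vanish; on (0, b) the right side is the length of (0, x); beyond b,
    monotone convergence passes to the limit in the recursion. *)
Lemma renewal_eq k x : renewal_kernel b K k ->
  ((x * renewal b k x)%:E = conv (EFin \o renewal b k) k x)%E.
Proof.
move=> hk; have [mk kK kn k1] := hk.
have k0 z : 0 <= k z by have /andP[] := kK z.
have [x0|x0] := leP x 0.
  rewrite renewal_le0// mulr0; symmetry; apply: integral0_eq => y _ /=.
  have [y0|y0] := leP y 0; first by rewrite renewal_le0// mul0e.
  by rewrite kn ?mule0// subr_le0 (le_trans x0)// ltW.
have [xb|bx] := ltP x b.
  rewrite renewal_gap ?x0//.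
  transitivity (\int[lebesgue_measure]_(y in `]0%R, x[) cst 1%E y)%E.
    by rewrite integral_cst//= mul1e lebesgue_measure_itv/= lte_fin x0 mulr1 oppr0 adde0.
  rewrite integral_mkcond; apply: eq_integral => y _.
  rewrite patchE; case: ifPn => [|]; rewrite ?inE ?notin_setE/= in_itv/=.
    move=> /andP[y0 yx]; rewrite renewal_gap ?y0 ?(lt_trans yx)// k1 ?mule1//.
    by rewrite subr_gt0 yx/= (le_lt_trans _ xb)// gerBl ltW.
  have [y0|y0] := leP y 0; first by rewrite renewal_le0// mul0e.
  move=> /= /negP; rewrite -leNgt => xy.
  by rewrite kn ?mule0// subr_le0.
have cv : (conv (renewal_seq b k n) k x @[n --> \oo] -->
    conv (EFin \o renewal b k) k x)%E.
  have -> : conv (EFin \o renewal b k) k x =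
      (\int[lebesgue_measure]_y limn (fun n => renewal_seq b k n y * (k (x - y))%:E))%E.
    apply: eq_integral => y _; apply/esym/cvg_lim => //.
    by apply: cvgeZr => //; exact: renewal_seq_cvg hk.
  apply: cvg_monotone_convergence => //.
  { by move=> n; apply: measurable_conv_integrand => //; exact: measurable_renewal_seq. }
  { by move=> n y _; rewrite mule_ge0 ?lee_fin// renewal_seq_ge0. }
  { by move=> y _ m n mn; apply: lee_wpmul2r; rewrite ?lee_fin//; exact: renewal_seq_nd. }
have cv1 : (renewal_seq b k n.+1 x @[n --> \oo] -->
    (x^-1)%:E * conv (EFin \o renewal b k) k x)%E.
  under eq_fun do rewrite renewal_seqS lt_geF// ltNge bx/=.
  exact: cvgeZl.
have cv2 : (renewal_seq b k n.+1 x @[n --> \oo] --> (renewal b k x)%:E)%E.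
  by rewrite (cvg_shiftS (fun n => renewal_seq b k n x)); exact: renewal_seq_cvg hk.
have e : ((renewal b k x)%:E = (x^-1)%:E * conv (EFin \o renewal b k) k x)%E.
  exact: cvg_unique cv2 cv1.
by rewrite EFinM e muleA -EFinM divff ?mul1e// gt_eqF.
Qed.

End renewal.

(** * Integral identities for the equation x f = f * k *)

Lemma ge0_integral_translate {R : realType} (F : R -> \bar R) (y : R) :
  measurable_fun setT F -> (forall x, 0 <= F x)%E ->
  (\int[lebesgue_measure]_x F x = \int[lebesgue_measure]_x F (x + y)%R)%E.
Proof.
move=> mF F0.
have mphi : measurable_fun setT (fun x : measurableTypeR R => (x + y : measurableTypeR R)).
  exact: measurable_funD.
pose phi : {mfun measurableTypeR R >-> measurableTypeR R} :=
  HB.pack (fun x : measurableTypeR R => (x + y : measurableTypeR R))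
          (isMeasurableFun.Build _ _ _ _ _ mphi).
rewrite -[RHS](@ge0_integral_pushforward _ _ _ _ R _ mphi lebesgue_measure setT F)//.
apply: eq_measure_integral => A mA _.
apply: (@lebesgue_measure_unique R (pushforward lebesgue_measure phi)) => // _ [[a b]] _ <-.
transitivity (lebesgue_measure (`]a - y, b - y]%classic : set (measurableTypeR R))); last first.
  congr (lebesgue_measure _); apply/seteqP; split => x; rewrite /= !in_itv/=;
    by rewrite ltrBlDr lerBrDr.
by rewrite !lebesgue_measure_itv/= !lte_fin ltrD2r; case: ifP => // _; rewrite -!EFinB; congr EFin; ring.
Qed.

(** Tonelli followed by the translation x = z + y; in this form the equation is tested against a
    function [h]. *)
Lemma integral_conv {R : realType} (f k h : R -> R) :
  measurable_fun setT f -> (forall x, 0 <= f x) ->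
  measurable_fun setT k -> (forall x, 0 <= k x) ->
  measurable_fun setT h -> (forall x, 0 <= h x) ->
  (\int[lebesgue_measure]_x ((h x)%:E * conv (EFin \o f) k x) =
   \int[lebesgue_measure]_y ((f y)%:E *
       \int[lebesgue_measure]_z (h (z + y) * k z)%:E))%E.
Proof.
move=> mf f0 mk k0 mh h0.
pose F (z : R * R) := ((h z.1 * f z.2 * k (z.1 - z.2))%:E : \bar R).
have mF : measurable_fun setT (fun z : measurableTypeR R * measurableTypeR R => F z).
  apply/measurable_EFinP; apply: measurable_funM; last first.
    by apply: (measurableT_comp mk); exact: measurable_funB.
  by apply: measurable_funM; [exact: (measurableT_comp mh)|exact: (measurableT_comp mf)].
have F0 z : (0 <= F z)%E by rewrite lee_fin !mulr_ge0.
transitivity (\int[lebesgue_measure]_x \int[lebesgue_measure]_y F (x, y))%E.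
{ apply: eq_integral => x _; rewrite -ge0_integralZl//.
  - by apply: eq_integral => y _; rewrite /F/= -EFinM mulrA.
  - by apply: measurable_conv_integrand => //; exact/measurable_EFinP.
  - by move=> y _; rewrite mule_ge0// lee_fin.
  - by rewrite lee_fin. }
rewrite (@fubini_tonelli _ _ _ _ _ lebesgue_measure lebesgue_measure F mF F0).
apply: eq_integral => y _.
rewrite (ge0_integral_translate (fun x => F (x, y)) y)//; last first.
  exact: (measurableT_comp mF (measurable_pair2 y)).
rewrite -ge0_integralZl//.
- by apply: eq_integral => z _; rewrite /F/= addrK -EFinM mulrCA mulrA.
- apply/measurable_EFinP; apply: measurable_funM => //.
  by apply: (measurableT_comp mh); exact: measurable_funD.
- by move=> z _; rewrite lee_fin mulr_ge0.
- by rewrite lee_fin.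
Qed.

(* [x f = f * k] is the density form of the equation satisfied by an infinitely
   divisible law without drift whose Lévy density is [k x / x]. *)
Record steutel {R : realType} (f k : R -> R) : Prop := Steutel {
  steutel_mf : measurable_fun setT f;
  steutel_f0 : forall x, 0 <= f x;
  steutel_fi : lebesgue_measure.-integrable setT (EFin \o f);
  steutel_fneg : forall x, x <= 0 -> f x = 0;
  steutel_mk : measurable_fun setT k;
  steutel_k0 : forall x, 0 <= k x;
  steutel_ki : lebesgue_measure.-integrable setT (EFin \o k);
  steutel_kneg : forall x, x <= 0 -> k x = 0;
  steutel_eq : forall x, ((x * f x)%:E = conv (EFin \o f) k x)%E }.

Lemma integrable_lin3 {R : realType} {d} {T : measurableType d}
    (mu : {measure set T -> \bar R}) (a b c : R) (f g h : T -> R) :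
  mu.-integrable setT (EFin \o f) -> mu.-integrable setT (EFin \o g) ->
  mu.-integrable setT (EFin \o h) ->
  mu.-integrable setT (EFin \o (fun x => a * f x + b * g x + c * h x)).
Proof.
move=> fi gi hi.
exact: (integrableD measurableT (integrableD measurableT (integrableZl measurableT a fi)
  (integrableZl measurableT b gi)) (integrableZl measurableT c hi)).
Qed.

Lemma Rintegral_lin3 {R : realType} {d} {T : measurableType d}
    (mu : {measure set T -> \bar R}) (a b c : R) (f g h : T -> R) :
  mu.-integrable setT (EFin \o f) -> mu.-integrable setT (EFin \o g) ->
  mu.-integrable setT (EFin \o h) ->
  Rintegral mu setT (fun x => a * f x + b * g x + c * h x) =
  a * Rintegral mu setT f + b * Rintegral mu setT g + c * Rintegral mu setT h.
Proof.
move=> fi gi hi.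
have afi : mu.-integrable setT (EFin \o (fun x => a * f x)) := integrableZl measurableT a fi.
have bgi : mu.-integrable setT (EFin \o (fun x => b * g x)) := integrableZl measurableT b gi.
have chi : mu.-integrable setT (EFin \o (fun x => c * h x)) := integrableZl measurableT c hi.
have abi : mu.-integrable setT (EFin \o (fun x => a * f x + b * g x)) :=
  integrableD measurableT afi bgi.
rewrite (@RintegralD _ _ _ mu setT (fun x => a * f x + b * g x))//.
by rewrite RintegralD// !RintegralZl.
Qed.

Section steutel.
Context {R : realType} {f k : R -> R} (fk : steutel f k).
Local Notation mu := lebesgue_measure.
Local Notation I g := (Rintegral lebesgue_measure setT g).

Lemma integrable_boundedM (g w : R -> R) (M : R) :
  lebesgue_measure.-integrable setT (EFin \o g) -> measurable_fun setT w ->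
  (forall x, `|w x| <= M) ->
  lebesgue_measure.-integrable setT (EFin \o (fun x => w x * g x)).
Proof.
move=> ig mw wM; have mg : measurable_fun setT g by apply/measurable_EFinP; exact: measurable_int ig.
apply: (le_integrable measurableT _ _ (integrableZl measurableT M (integrable_norm ig))).
  by apply/measurable_EFinP; exact: measurable_funM.
move=> x _ /=; have M0 : 0 <= M := le_trans (normr_ge0 _) (wM x).
by rewrite lee_fin !normrM (ger0_norm M0) normr_id ler_wpM2r.
Qed.

(** Nonnegativity of [h] is what Tonelli requires, and its boundedness makes the inner integral
    finite. Trigonometric test functions therefore enter below with a summand 1. *)
Lemma steutel_integral (h : R -> R) (M : R) : measurable_fun setT h ->
  (forall x, 0 <= h x <= M) ->
  (\int[mu]_x (h x * (x * f x))%:E =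
   \int[mu]_y (f y * I (fun z => h (z + y) * k z))%:E)%E.
Proof.
move=> mh hM; have h0 x : 0 <= h x by have /andP[] := hM x.
transitivity (\int[mu]_x ((h x)%:E * conv (EFin \o f) k x))%E.
  by apply: eq_integral => x _; rewrite EFinM (steutel_eq _ _ fk).
rewrite integral_conv//; [|exact: steutel_mf fk|exact: steutel_f0 fk|exact: steutel_mk fk|exact: steutel_k0 fk].
apply: eq_integral => y _; rewrite EFin_Rintegral//.
apply: (@integrable_boundedM _ _ M); first exact: steutel_ki fk.
  by apply: (measurableT_comp mh); exact: measurable_funD.
by move=> z; have /andP[a b] := hM (z + y); rewrite ger0_norm.
Qed.

Lemma steutel_moment_integrable : mu.-integrable setT (EFin \o (fun x => x * f x)).
Proof.
have mf := steutel_mf _ _ fk; have f0 := steutel_f0 _ _ fk.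
apply/integrableP; split; first by apply/measurable_EFinP; exact: measurable_funM.
have := @steutel_integral (cst 1) 1; rewrite /cst/=.
under eq_integral do rewrite mul1r.
rewrite (_ : (\int[mu]_x `|(x * f x)%:E| = \int[mu]_x (x * f x)%:E)%E); last first.
  apply: eq_integral => x _; rewrite gee0_abs// lee_fin.
  have [x0|x0] := leP x 0; first by rewrite (steutel_fneg _ _ fk)// mulr0.
  by rewrite mulr_ge0// ltW.
move=> ->//; last by move=> x; rewrite ler01 lexx.
under eq_integral do rewrite EFinM.
rewrite ge0_integralZr//=; last 3 first.
{ exact/measurable_EFinP. }
{ by move=> x _; rewrite lee_fin. }
{ by rewrite lee_fin Rintegral_ge0// => z _; rewrite mul1r (steutel_k0 _ _ fk). }
by rewrite (EFin_Rintegral _ _ _ _ (steutel_fi _ _ fk))// -EFinM ltry.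
Qed.

Lemma cosM_norm u (x : R) : `|cos (u * x)| <= 1.
Proof. by rewrite ler_norml cos_geN1 cos_le1. Qed.

Lemma sinM_norm u (x : R) : `|sin (u * x)| <= 1.
Proof. by rewrite ler_norml sin_geN1 sin_le1. Qed.

Lemma integrable_cosM u (g : R -> R) : mu.-integrable setT (EFin \o g) ->
  mu.-integrable setT (EFin \o (fun x => cos (u * x) * g x)).
Proof. by move=> gi; apply: (integrable_boundedM g _ 1 gi (measurable_cosM u)) => x; exact: cosM_norm. Qed.

Lemma integrable_sinM u (g : R -> R) : mu.-integrable setT (EFin \o g) ->
  mu.-integrable setT (EFin \o (fun x => sin (u * x) * g x)).
Proof. by move=> gi; apply: (integrable_boundedM g _ 1 gi (measurable_sinM u)) => x; exact: sinM_norm. Qed.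

Lemma steutel_moment : I (fun x => x * f x) = I f * I k.
Proof.
have h1 (x : R) : 0 <= (1 : R) <= 1 by rewrite ler01 lexx.
have m1 : measurable_fun setT (fun _ : R => 1 : R) by [].
have := steutel_integral _ _ m1 h1.
under eq_integral do rewrite mul1r.
under [in X in _ = X -> _]eq_integral => y _.
  rewrite (_ : I (fun z => 1 * k z) = I k); last by apply: eq_Rintegral => z _; rewrite mul1r.
  over.
have fi := steutel_fi _ _ fk.
rewrite (EFin_Rintegral _ _ _ _ steutel_moment_integrable)// EFin_Rintegral//; last first.
  exact: (integrableZr measurableT (I k) fi).
by rewrite RintegralZr// => -[].
Qed.

(** Real part of the product formula for the Fourier transforms of x f, f and k. The test function
    is 1 + cos, and the contribution of 1 is removed by [steutel_moment]. *)
Lemma steutel_cos u :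
  I (fun x => cos (u * x) * (x * f x)) =
  I (fun x => cos (u * x) * f x) * I (fun x => cos (u * x) * k x) -
  I (fun x => sin (u * x) * f x) * I (fun x => sin (u * x) * k x).
Proof.
have fi := steutel_fi _ _ fk; have ki := steutel_ki _ _ fk; have xfi := steutel_moment_integrable.
have cfi := integrable_cosM u f fi; have sfi := integrable_sinM u f fi.
have cki := integrable_cosM u k ki; have ski := integrable_sinM u k ki.
have cxfi := integrable_cosM u _ xfi.
set Ck := I (fun x => cos (u * x) * k x); set Sk := I (fun x => sin (u * x) * k x).
have inner y : I (fun z => (1 + cos (u * (z + y))) * k z) =
    1 * I k + cos (u * y) * Ck + - sin (u * y) * Sk.
  rewrite -Rintegral_lin3//; apply: eq_Rintegral => z _.
  by rewrite mulrDr cosD; ring.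
have := @steutel_integral (fun x => 1 + cos (u * x)) 2.
have mc : measurable_fun setT (fun x : R => 1 + cos (u * x)).
  by apply: measurable_funD => //; exact: measurable_cosM.
move=> /(_ mc); have h2 x : 0 <= 1 + cos (u * x) <= 2.
  by have := cos_geN1 (u * x); have := cos_le1 (u * x); lra.
move=> /(_ h2); under [in X in _ = X -> _]eq_integral => y _ do rewrite inner.
(* The zero third term only gives the sum the shape expected by [integrable_lin3] and
   [Rintegral_lin3]. *)
have -> : (\int[mu]_x ((1 + cos (u * x)) * (x * f x))%:E)%E =
   (\int[mu]_x (1 * (x * f x) + 1 * (cos (u * x) * (x * f x)) + 0 * f x)%:E)%E.
  by apply: eq_integral => x _; congr EFin; ring.
have -> : (\int[mu]_y (f y * (1 * I k + cos (u * y) * Ck + - sin (u * y) * Sk))%:E)%E =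
   (\int[mu]_y (I k * f y + Ck * (cos (u * y) * f y) + (- Sk) * (sin (u * y) * f y))%:E)%E.
  by apply: eq_integral => x _; congr EFin; ring.
rewrite !EFin_Rintegral//; [|exact: integrable_lin3|exact: integrable_lin3].
rewrite !Rintegral_lin3// steutel_moment => -[]; lra.
Qed.

Lemma steutel_sin u :
  I (fun x => sin (u * x) * (x * f x)) =
  I (fun x => sin (u * x) * f x) * I (fun x => cos (u * x) * k x) +
  I (fun x => cos (u * x) * f x) * I (fun x => sin (u * x) * k x).
Proof.
have fi := steutel_fi _ _ fk; have ki := steutel_ki _ _ fk; have xfi := steutel_moment_integrable.
have cfi := integrable_cosM u f fi; have sfi := integrable_sinM u f fi.
have cki := integrable_cosM u k ki; have ski := integrable_sinM u k ki.
have sxfi := integrable_sinM u _ xfi.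
set Ck := I (fun x => cos (u * x) * k x); set Sk := I (fun x => sin (u * x) * k x).
have inner y : I (fun z => (1 + sin (u * (z + y))) * k z) =
    1 * I k + sin (u * y) * Ck + cos (u * y) * Sk.
  rewrite -Rintegral_lin3//; apply: eq_Rintegral => z _.
  by rewrite mulrDr sinD; ring.
have := @steutel_integral (fun x => 1 + sin (u * x)) 2.
have mc : measurable_fun setT (fun x : R => 1 + sin (u * x)).
  by apply: measurable_funD => //; exact: measurable_sinM.
move=> /(_ mc); have h2 x : 0 <= 1 + sin (u * x) <= 2.
  by have := sin_geN1 (u * x); have := sin_le1 (u * x); lra.
move=> /(_ h2); under [in X in _ = X -> _]eq_integral => y _ do rewrite inner.
have -> : (\int[mu]_x ((1 + sin (u * x)) * (x * f x))%:E)%E =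
   (\int[mu]_x (1 * (x * f x) + 1 * (sin (u * x) * (x * f x)) + 0 * f x)%:E)%E.
  by apply: eq_integral => x _; congr EFin; ring.
have -> : (\int[mu]_y (f y * (1 * I k + sin (u * y) * Ck + cos (u * y) * Sk))%:E)%E =
   (\int[mu]_y (I k * f y + Ck * (sin (u * y) * f y) + Sk * (cos (u * y) * f y))%:E)%E.
  by apply: eq_integral => x _; congr EFin; ring.
rewrite !EFin_Rintegral//; [|exact: integrable_lin3|exact: integrable_lin3].
rewrite !Rintegral_lin3// steutel_moment => -[]; lra.
Qed.
End steutel.

(** * Characteristic function of a solution *)

Lemma is_derive_under_integral {R : realType} (f df : R -> R -> R) (G : R -> R) :
  (forall u, lebesgue_measure.-integrable setT (EFin \o f u)) ->
  (forall u x : R, is_derive u (1 : R) (f ^~ x) (df u x)) ->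
  lebesgue_measure.-integrable setT (EFin \o G) ->
  (forall u x, `|df u x| <= G x) ->
  forall a : R, is_derive a (1 : R) (fun u => Rintegral lebesgue_measure setT (f u))
    (Rintegral lebesgue_measure setT (df a)).
Proof.
move=> fi fd Gi dfG a.
have G0 x : 0 <= G x := le_trans (normr_ge0 _) (dfG 0 x).
have dfE u x : partial1of2 f u x = df u x.
  by rewrite partial1of2E; case: (fd u x).
have Ia : `](a - 1), (a + 1)[%classic a by rewrite /= in_itv/=; lra.
have h1 x y : `](a - 1), (a + 1)[%classic x -> setT y -> derivable (f ^~ y) x 1.
  by move=> _ _; case: (fd x y).
have h2 x y : `](a - 1), (a + 1)[%classic x -> setT y -> `|partial1of2 f x y| <= G y.
  by move=> _ _; rewrite dfE.
apply: DeriveDef.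
  exact: (@derivable_under_integral R _ _ lebesgue_measure f setT measurableT a _ _ Ia
    (fun x _ => fi x) h1 G G0 Gi h2).
rewrite -derive1E (@differentiation_under_integral R _ _ lebesgue_measure f setT measurableT a _ _ Ia
    (fun x _ => fi x) h1 G G0 Gi h2).
by apply: eq_Rintegral => x _; rewrite dfE.
Qed.

Section trig.
Context {R : realType}.
Local Notation mu := (@lebesgue_measure R).
Local Notation I g := (Rintegral lebesgue_measure setT g).

Lemma is_derive_cosM (x u : R) : is_derive u (1 : R) (fun u => cos (u * x)) (- (sin (u * x) * x)).
Proof.
have dg : is_derive u (1 : R) (fun u => u * x) x.
  by apply: is_derive_eq; rewrite /GRing.scale/= mulr1 mulr0 add0r.
have := @is_derive1_comp _ cos (fun u => u * x) u _ _ (is_derive_cos _) dg.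
by rewrite mulNr.
Qed.

Lemma is_derive_sinM (x u : R) : is_derive u (1 : R) (fun u => sin (u * x)) (cos (u * x) * x).
Proof.
have dg : is_derive u (1 : R) (fun u => u * x) x.
  by apply: is_derive_eq; rewrite /GRing.scale/= mulr1 mulr0 add0r.
exact: (@is_derive1_comp _ sin (fun u => u * x) u _ _ (is_derive_sin _) dg).
Qed.

Lemma norm_lip (f df : R -> R) (t : R) : (forall u : R, is_derive u (1 : R) f (df u)) ->
  (forall u, `|df u| <= 1) -> 0 <= t -> `|f t - f 0| <= t.
Proof.
move=> dF df1 t0.
have [|c _ ->] := @MVT_segment _ f df 0 t t0 (fun x _ => dF x).
  apply: continuous_subspaceT => u; apply: differentiable_continuous.
  by apply/derivable1_diffP; case: (dF u).
by rewrite subr0 normrM (ger0_norm t0) ler_piMl.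
Qed.

Lemma norm_sin_le (t : R) : `|sin t| <= `|t|.
Proof.
have h (z : R) : 0 <= z -> `|sin z| <= z.
  move=> z0; rewrite -[sin z]subr0 -sin0.
  apply: (norm_lip sin cos) => // u; first by have := cosM_norm 1 u; rewrite mul1r.
have [t0|t0] := leP 0 t; first by rewrite (ger0_norm t0) h.
have n0 : 0 <= - t by rewrite oppr_ge0 ltW.
by rewrite -normrN -sinN -[`|t|]normrN (ger0_norm n0) h.
Qed.

Lemma norm_cosB1_le (t : R) : `|cos t - 1| <= `|t|.
Proof.
have h (z : R) : 0 <= z -> `|cos z - 1| <= z.
  move=> z0; rewrite -[X in _ - X]cos0.
  apply: (norm_lip cos (fun u => - sin u)) => // u.
  by rewrite normrN; have := sinM_norm 1 u; rewrite mul1r.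
have [t0|t0] := leP 0 t; first by rewrite (ger0_norm t0) h.
have n0 : 0 <= - t by rewrite oppr_ge0 ltW.
by rewrite -cosN -[`|t|]normrN (ger0_norm n0) h.
Qed.

(** The constant [d] serves two uses: [d = 1] for the Lévy exponent, whose density need not be
    integrable near 0, and [d = 0] for the Fourier transform of a probability density. *)
Lemma is_derive_cos_integral (v w : R -> R) (d : R) :
  (forall u, mu.-integrable setT (EFin \o (fun x => (cos (u * x) - d) * v x))) ->
  (forall x, x * v x = w x) -> mu.-integrable setT (EFin \o w) ->
  forall u, is_derive u (1 : R) (fun u => I (fun x => (cos (u * x) - d) * v x))
    (- I (fun x => sin (u * x) * w x)).
Proof.
move=> hi hw wi u.
have := @is_derive_under_integral _ (fun u x => (cos (u * x) - d) * v x)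
  (fun u x => -1 * (sin (u * x) * w x)) (fun x => `|w x|) hi _ (integrable_norm wi) _ u.
rewrite RintegralZl//; last exact: integrable_sinM.
rewrite mulN1r; apply.
- move=> {}u x; have dc := is_derive_cosM x u.
  apply: is_derive_eq; rewrite /GRing.scale/= -hw; ring.
- by move=> {}u x; rewrite mulN1r normrN normrM ler_piMl// ler_norml sin_geN1 sin_le1.
Qed.

Lemma is_derive_sin_integral (v w : R -> R) :
  (forall u, mu.-integrable setT (EFin \o (fun x => sin (u * x) * v x))) ->
  (forall x, x * v x = w x) -> mu.-integrable setT (EFin \o w) ->
  forall u, is_derive u (1 : R) (fun u => I (fun x => sin (u * x) * v x))
    (I (fun x => cos (u * x) * w x)).
Proof.
move=> hi hw wi u.
apply: (@is_derive_under_integral _ (fun u x => sin (u * x) * v x)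
  (fun u x => cos (u * x) * w x) (fun x => `|w x|) hi _ (integrable_norm wi) _ u).
- move=> {}u x; have dc := is_derive_sinM x u.
  apply: is_derive_eq; rewrite /GRing.scale/= -hw; ring.
- by move=> {}u x; rewrite normrM ler_piMl// ler_norml cos_geN1 cos_le1.
Qed.

(* Both [(c, s)] and [(expR a * cos b, expR a * sin b)] solve the same linear
   system of differential equations. *)
Lemma exp_ode (c s a b A B : R -> R) :
  (forall u, is_derive u (1 : R) a (- B u)) -> (forall u, is_derive u (1 : R) b (A u)) ->
  (forall u, is_derive u (1 : R) c (- (s u * A u + c u * B u))) ->
  (forall u, is_derive u (1 : R) s (c u * A u - s u * B u)) ->
  a 0 = 0 -> b 0 = 0 -> c 0 = 1 -> s 0 = 0 ->
  forall u, c u = expR (a u) * cos (b u) /\ s u = expR (a u) * sin (b u).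
Proof.
move=> da db dc ds a0 b0 c0 s0 u.
(* [F] and [H] are the real and imaginary parts of (c + i s) exp(- a - i b), which has derivative
   zero. *)
pose F u := expR (- a u) * (c u * cos (b u) + s u * sin (b u)).
pose H u := expR (- a u) * (s u * cos (b u) - c u * sin (b u)).
have de z : is_derive z (1 : R) (fun u => expR (- a u)) (expR (- a z) * B z).
  have dNa : is_derive z (1 : R) (fun u => - a u) (B z).
    by have := is_deriveN (da z); rewrite opprK.
  exact: (@is_derive1_comp _ expR (fun u => - a u) z _ _ (is_derive_expR _) dNa).
have dcb z : is_derive z (1 : R) (fun u => cos (b u)) (- (sin (b z) * A z)).
  have := @is_derive1_comp _ cos b z _ _ (is_derive_cos _) (db z).
  by rewrite mulNr.
have dsb z : is_derive z (1 : R) (fun u => sin (b u)) (cos (b z) * A z).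
  exact: (@is_derive1_comp _ sin b z _ _ (is_derive_sin _) (db z)).
have dF z : is_derive z (1 : R) F 0.
  rewrite /F; have h1 := de z; have h2 := dcb z; have h3 := dsb z; have h4 := dc z; have h5 := ds z.
  by apply: is_derive_eq; rewrite /GRing.scale/=; ring.
have dH z : is_derive z (1 : R) H 0.
  rewrite /H; have h1 := de z; have h2 := dcb z; have h3 := dsb z; have h4 := dc z; have h5 := ds z.
  by apply: is_derive_eq; rewrite /GRing.scale/=; ring.
have F1 : F u = 1.
  by rewrite (is_derive_0_is_cst u 0 dF) /F a0 b0 c0 s0 oppr0 expR0 cos0 sin0; ring.
have H0 : H u = 0.
  by rewrite (is_derive_0_is_cst u 0 dH) /H a0 b0 c0 s0 oppr0 expR0 cos0 sin0; ring.
have e0 : expR (a u) * expR (- a u) = 1 by rewrite -expRD subrr expR0.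
have cs := cos2Dsin2 (b u).
split.
  transitivity (expR (a u) * (F u * cos (b u) - H u * sin (b u))).
    rewrite /F /H.
    transitivity ((expR (a u) * expR (- a u)) * (c u * (cos (b u) ^+ 2 + sin (b u) ^+ 2))).
      by rewrite e0 cs !mul1r mulr1.
    ring.
  by rewrite F1 H0; ring.
transitivity (expR (a u) * (F u * sin (b u) + H u * cos (b u))).
  rewrite /F /H.
  transitivity ((expR (a u) * expR (- a u)) * (s u * (cos (b u) ^+ 2 + sin (b u) ^+ 2))).
    by rewrite e0 cs !mul1r mulr1.
  ring.
by rewrite F1 H0; ring.
Qed.

End trig.

(** * Probability measures with a density *)

Definition has_density {R : realType} (P : set R -> \bar R) (f : R -> R) : Prop :=
  [/\ measurable_fun setT f, forall x, 0 <= f x &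
      forall A, measurable A -> P A = (\int[lebesgue_measure]_(x in A) (f x)%:E)%E].

Section density_prob.
Context {R : realType} (f : R -> R) (mf : measurable_fun setT f)
  (f0 : forall x, 0 <= f x) (f1 : (\int[lebesgue_measure]_x (f x)%:E = 1)%E).

(** The three hypotheses are arguments of the set function, so that the measure and probability
    instances can be attached to the term itself. *)
Definition density_prob of measurable_fun setT f & (forall x, 0 <= f x) &
  (\int[lebesgue_measure]_x (f x)%:E = 1)%E : set R -> \bar R :=
  fun A => (\int[lebesgue_measure]_(x in A) (f x)%:E)%E.
Local Notation P := (density_prob mf f0 f1).

Let P0 : P set0 = 0%E. Proof. by rewrite /density_prob integral_set0. Qed.

Let P_ge0 A : (0 <= P A)%E.
Proof. by rewrite /density_prob integral_ge0// => x _; rewrite lee_fin. Qed.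

Let P_sigma_additive : semi_sigma_additive P.
Proof.
move=> /= F mF tF mUF; rewrite /density_prob; apply: cvg_toP.
  apply: ereal_nondecreasing_is_cvgn => m n mn.
  apply: lee_sum_nneg_natr => // k _ _; apply: integral_ge0 => /= x Fkx.
  by rewrite lee_fin.
rewrite ge0_integral_bigcup//=.
  by apply/measurable_funTS/measurableT_comp.
by move=> x _; rewrite lee_fin.
Qed.

HB.instance Definition _ := isMeasure.Build _ _ _ P P0 P_ge0 P_sigma_additive.

Let PT : P setT = 1%E. Proof. exact: f1. Qed.

HB.instance Definition _ := Measure_isProbability.Build _ _ R P PT.

Lemma density_prob_exists : exists Q : probability R R, has_density Q f.
Proof. by exists (density_prob mf f0 f1). Qed.

End density_prob.

Section integral_density.
Context {R : realType} {P : {measure set R -> \bar R}} {f : R -> R} (hP : has_density P f).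
Local Notation mu := lebesgue_measure.

Import HBNNSimple.

Let density_nnsfun (g : {nnsfun R >-> R}) :
  (\int[P]_x (g x)%:E = \int[mu]_x ((g x)%:E * (f x)%:E))%E.
Proof.
have [mf f0 PE] := hP.
have mA r : measurable (g @^-1` [set r]) by rewrite -[X in measurable X]setTI; exact: measurable_funP.
under [LHS]eq_integral do rewrite fimfunE -fsumEFin//.
rewrite [LHS]ge0_integral_fsum//; last 2 first.
{ by move=> r; exact/measurable_EFinP/measurableT_comp. }
{ by move=> n x _; rewrite EFinM nnfun_muleindic_ge0. }
under [RHS]eq_integral.
  move=> x xD; rewrite fimfunE -fsumEFin// ge0_mule_fsuml; last first.
    by move=> r; rewrite EFinM nnfun_muleindic_ge0.
  over.
rewrite [RHS]ge0_integral_fsum//; last 2 first.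
{ move=> r; apply: emeasurable_funM; last exact/measurable_EFinP.
  apply/measurable_EFinP; apply: measurable_funM => //.
  by apply: measurable_indic; exact: mA. }
{ move=> n x _; rewrite EFinM mule_ge0//; first by rewrite nnfun_muleindic_ge0.
  by rewrite lee_fin. }
apply: eq_fsbigr => r _.
rewrite integralZl_indic_nnsfun//= integral_indic// setIT PE//.
have [r0|r0] := leP 0 r.
{ rewrite -ge0_integralZl//.
  - rewrite [LHS]integral_mkcond; apply: eq_integral => x _.
    rewrite epatch_indic/= EFinM -!muleA; congr (_ * _)%E.
    by rewrite muleC.
  - exact: mA.
  - by apply/measurable_EFinP; exact: measurable_funTS.
  - by move=> x _; rewrite lee_fin. }
have -> : g @^-1` [set r] = set0.
  apply/seteqP; split => // x /= gx.
  by have : 0 <= g x by []; rewrite gx leNgt r0.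
rewrite integral_set0 mule0; symmetry; apply: integral0_eq => x _.
by rewrite indic0 mulr0 mul0e.
Qed.

Lemma ge0_integral_density (g : R -> \bar R) : measurable_fun setT g -> (forall x, 0 <= g x)%E ->
  (\int[P]_x g x = \int[mu]_x (g x * (f x)%:E))%E.
Proof.
have [mf f0 PE] := hP.
move=> mg g0; pose g_ := nnsfun_approx measurableT mg.
have nd x m n : (m <= n)%N -> g_ m x <= g_ n x by move=> mn; exact/lefP/nd_nnsfun_approx.
transitivity (lim (\int[P]_x (g_ n x)%:E @[n --> \oo])%E).
{ rewrite -monotone_convergence//=.
  - apply: eq_integral => x _; apply/esym/cvg_lim => //=.
    exact: cvg_nnsfun_approx.
  - by move=> n; exact/measurable_EFinP/measurable_funTS.
  - by move=> n x _; rewrite lee_fin.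
  - by move=> x _ m n mn; rewrite lee_fin; exact/lefP/nd_nnsfun_approx. }
rewrite [RHS](_ : _ = lim (\int[mu]_x ((g_ n x)%:E * (f x)%:E) @[n --> \oo])%E).
  by apply: congr_lim; apply/funext => n /=; exact: density_nnsfun.
rewrite -monotone_convergence//=.
- apply: eq_integral => x _; apply/esym/cvg_lim => //.
  by apply: cvgeZr => //; exact: cvg_nnsfun_approx.
- move=> n; apply: emeasurable_funM; last exact/measurable_EFinP.
  have h : measurable_fun setT (g_ n) by [].
  exact/measurable_EFinP.
- by move=> n x _; rewrite mule_ge0 ?lee_fin.
- by move=> x _ m n mn; apply: lee_wpmul2r; rewrite ?lee_fin//; exact: nd.
Qed.

End integral_density.

Lemma Rintegral_density {R : realType} (P : probability R R) (f g : R -> R) (M : R) :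
  has_density P f -> measurable_fun setT g -> (forall x, `|g x| <= M) ->
  Rintegral P setT g = Rintegral lebesgue_measure setT (fun x => g x * f x).
Proof.
move=> hP mg gM; have [mf f0 PE] := hP.
have fi : lebesgue_measure.-integrable setT (EFin \o f).
  apply/integrableP; split; first exact/measurable_EFinP.
  under eq_integral => x _ do rewrite gee0_abs ?lee_fin//.
  by rewrite -PE// probability_setT ltry.
have M0 : 0 <= M := le_trans (normr_ge0 _) (gM 0).
have gi : P.-integrable setT (EFin \o g) by exact: (@bounded_integrable _ _ _ P _ M).
have Mi : P.-integrable setT (EFin \o (fun=> M)) by exact: finite_measure_integrable_cst.
have gfi := integrable_boundedM f g M fi mg gM.
(* The shift by [M] makes the integrand nonnegative; it cancels at the end because [f] has mass
   1. *)
have := ge0_integral_density hP (fun x => (g x + M)%:E).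
have mgM : measurable_fun setT (fun x => (g x + M)%:E).
  by apply/measurable_EFinP; exact: measurable_funD.
have gM0 x : (0 <= (g x + M)%:E)%E.
  by rewrite lee_fin; have := gM x; rewrite ler_norml => /andP[]; lra.
move=> /(_ mgM gM0).
rewrite (EFin_Rintegral P setT (fun x => g x + M)) //; last exact: (integrableD measurableT gi Mi).
have -> : (\int[lebesgue_measure]_x ((g x + M)%:E * (f x)%:E) =
   \int[lebesgue_measure]_x (1 * (g x * f x) + M * f x + 0 * f x)%:E)%E.
  by apply: eq_integral => x _; rewrite -EFinM; congr EFin; ring.
rewrite EFin_Rintegral//; last exact: integrable_lin3.
rewrite Rintegral_lin3// RintegralD// Rintegral_cst//= probability_setT/=.
have -> : Rintegral lebesgue_measure setT f = 1.
  by rewrite /Rintegral -PE// probability_setT.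
by move=> -[]; rewrite ?mulr1; lra.
Qed.

(** * Identification of the Lévy law *)

Section steutel_levy.
Context {R : realType} {f k v : R -> R} (fk : steutel f k)
  (f1 : Rintegral lebesgue_measure setT f = 1)
  (vk : forall x, 0 < x -> x * v x = k x).
Local Notation mu := (@lebesgue_measure R).
Local Notation I g := (Rintegral lebesgue_measure setT g).

(** The Lévy density extended by 0 to the negative half-line, where nothing is assumed about [v]. *)
Let w x := x^-1 * k x.

Let xw x : x * w x = k x.
Proof.
rewrite /w; have [->|x0] := eqVneq x 0; first by rewrite mul0r (steutel_kneg _ _ fk).
by rewrite mulrA divff// mul1r.
Qed.

Let w0 x : x <= 0 -> w x = 0.
Proof. by move=> x0; rewrite /w (steutel_kneg _ _ fk)// mulr0. Qed.

Let wv x : 0 < x -> w x = v x.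
Proof. by move=> x0; rewrite /w -vk// mulrA mulVf ?mul1r// gt_eqF. Qed.

Let mw : measurable_fun setT w.
Proof. by apply: measurable_funM; [exact: measurable_inv|exact: steutel_mk fk]. Qed.

(** The function [w] may fail to be integrable near 0, but a factor of order x turns it into the
    integrable [k]. *)
Let wi (g : R -> R) (c : R) : measurable_fun setT g -> (forall x, `|g x| <= c * `|x|) ->
  mu.-integrable setT (EFin \o (fun x => g x * w x)).
Proof.
move=> mg gc; apply: (le_integrable measurableT _ _ (integrableZl measurableT c (steutel_ki _ _ fk))).
  by apply/measurable_EFinP; exact: measurable_funM.
move=> x _ /=; rewrite lee_fin normrM.
apply: (@le_trans _ _ (c * `|x| * `|w x|)); first by rewrite ler_wpM2r.
by rewrite -mulrA -normrM xw (ger0_norm (steutel_k0 _ _ fk x)) ler_norm.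
Qed.

Lemma int_posE (g : R -> R) : int_pos (fun x => g x * v x) = I (fun x => g x * w x).
Proof.
rewrite /int_pos [LHS]Rintegral_mkcond; apply: eq_Rintegral => x _.
rewrite patchE; case: ifPn => [|]; rewrite ?inE ?notin_setE/= in_itv/= andbT.
  by move=> x0; rewrite wv.
by move/negP; rewrite -leNgt => x0; rewrite w0// mulr0.
Qed.

Let cosi u : mu.-integrable setT (EFin \o (fun x => (cos (u * x) - 1) * w x)).
Proof.
apply: (wi _ `|u|); first by apply: measurable_funB => //; exact: measurable_cosM.
by move=> x; rewrite -normrM norm_cosB1_le.
Qed.

Let sini u : mu.-integrable setT (EFin \o (fun x => sin (u * x) * w x)).
Proof.
apply: (wi _ `|u|); first exact: measurable_sinM.
by move=> x; rewrite -normrM norm_sin_le.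
Qed.

(** The drift [levy_gamma] is exactly the integral of the truncated compensator, so the two cancel:
    the process has no drift. *)
Lemma lk_imE u : lk_im v u = I (fun x => sin (u * x) * w x).
Proof.
rewrite /lk_im int_posE /levy_gamma.
pose t (x : R) := if x < 1 then x else 0.
have ti : mu.-integrable setT (EFin \o (fun x => t x * w x)).
  apply: (wi _ 1).
    apply: measurable_fun_ifT => //; exact: measurable_fun_ltr.
  by move=> x; rewrite mul1r /t; case: ifP; rewrite ?normr0.
have -> : Rintegral mu `]0, 1[ (fun x => x * v x) = I (fun x => t x * w x).
  rewrite [LHS]Rintegral_mkcond; apply: eq_Rintegral => x _.
  rewrite patchE; case: ifPn => [|]; rewrite ?inE ?notin_setE/= in_itv/=.
    by move=> /andP[x0 x1]; rewrite /t x1 wv.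
  move/negP; rewrite negb_and -!leNgt => /orP[x0|x1]; first by rewrite w0// mulr0.
  by rewrite /t ltNge x1 mul0r.
have -> : I (fun x => (sin (u * x) - (if x < 1 then u * x else 0)) * w x) =
    I (fun x => 1 * (sin (u * x) * w x) + (- u) * (t x * w x) + 0 * (t x * w x)).
  by apply: eq_Rintegral => x _; rewrite /t; case: ifP => _; ring.
by rewrite Rintegral_lin3//; ring.
Qed.

(** By x f = f * k, the transform phi of f satisfies phi' = i phi k^, where k^ is the transform of
    k. The Lévy exponent psi satisfies psi' = i k^ because x w = k, and psi 0 = 0. Hence phi = exp
    psi. *)
Lemma steutel_levy u :
  I (fun x => cos (u * x) * f x) = expR (lk_re v u) * cos (lk_im v u) /\
  I (fun x => sin (u * x) * f x) = expR (lk_re v u) * sin (lk_im v u).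
Proof.
have fi := steutel_fi _ _ fk; have ki := steutel_ki _ _ fk.
have xfi := steutel_moment_integrable fk.
rewrite lk_imE /lk_re int_posE.
apply: (exp_ode (fun u => I (fun x => cos (u * x) * f x)) (fun u => I (fun x => sin (u * x) * f x))
  (fun u => I (fun x => (cos (u * x) - 1) * w x)) (fun u => I (fun x => sin (u * x) * w x))
  (fun u => I (fun x => cos (u * x) * k x)) (fun u => I (fun x => sin (u * x) * k x))).
- exact: is_derive_cos_integral.
- exact: is_derive_sin_integral.
- move=> z.
  have hi u' : mu.-integrable setT (EFin \o (fun x => (cos (u' * x) - 0) * f x)).
    have := integrable_cosM u' f fi; apply: eq_integrable => // x _ /=.
    by rewrite subr0.
  have := is_derive_cos_integral f (fun x => x * f x) 0 hi (fun=> erefl) xfi z.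
  rewrite (steutel_sin fk).
  by under [X in is_derive _ _ X _]eq_fun do under eq_Rintegral do rewrite subr0.
- move=> z; rewrite -(steutel_cos fk).
  exact: (is_derive_sin_integral f (fun x => x * f x) (fun u' => integrable_sinM u' f fi) (fun=> erefl) xfi z).
- rewrite /Rintegral integral0_eq// => x _.
  by rewrite mul0r cos0 subrr mul0r.
- rewrite /Rintegral integral0_eq// => x _.
  by rewrite mul0r sin0 mul0r.
- by rewrite -f1; apply: eq_Rintegral => x _; rewrite mul0r cos0 mul1r.
- rewrite /Rintegral integral0_eq// => x _.
  by rewrite mul0r sin0 mul0r.
Qed.

End steutel_levy.

(** The measure with density [f] has the characteristic function prescribed by [is_levy_law], so it
    coincides with [P]. *)
Lemma levy_has_density {R : realType} (P : probability R R) (f k v : R -> R) :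
  steutel f k -> Rintegral lebesgue_measure setT f = 1 ->
  (forall x, 0 < x -> x * v x = k x) -> is_levy_law v P -> has_density P f.
Proof.
move=> fk f1 vk hP.
have [mf f0 fi] : [/\ measurable_fun setT f, forall x, 0 <= f x &
    lebesgue_measure.-integrable setT (EFin \o f)] by split; case: fk.
have f1E : (\int[lebesgue_measure]_x (f x)%:E = 1)%E by rewrite EFin_Rintegral// f1.
have [P' hP'] := density_prob_exists f mf f0 f1E.
have PP' : forall A, measurable A -> P A = P' A.
{ apply: cf_unique => u.
  - rewrite (hP u).1 -(steutel_levy fk f1 vk u).1; symmetry.
    apply: (Rintegral_density _ _ _ 1) => //; first exact: measurable_cosM.
    by move=> x; exact: cosM_norm.
  - rewrite (hP u).2 -(steutel_levy fk f1 vk u).2; symmetry.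
    apply: (Rintegral_density _ _ _ 1) => //; first exact: measurable_sinM.
    by move=> x; exact: sinM_norm. }
by split=> // A mA; rewrite PP'//; have [_ _ ->] := hP'.
Qed.

(** * Exponential tilts of the renewal function and their normalisation *)

Section laplace.
Context {R : realType}.
Local Notation mu := (@lebesgue_measure R).
Local Notation I g := (Rintegral lebesgue_measure setT g).

Lemma integrable_expdecay (f : R -> R) (C beta : R) : 0 < beta ->
  measurable_fun setT f -> (forall x, 0 <= f x) -> (forall x, x <= 0 -> f x = 0) ->
  (forall x, 0 < x -> f x <= C * expR (- beta * x)) ->
  mu.-integrable setT (EFin \o f).
Proof.
move=> beta0 mf f0 fneg fC.
have C0 : 0 <= C.
  by have := le_trans (f0 1) (fC 1 ltr01); rewrite pmulr_lge0 ?expR_gt0.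
apply: (le_integrable measurableT _ _
  (integrableZl measurableT (C / beta) (integrable_exponential_pdf beta0))).
  exact/measurable_EFinP.
move=> x _ /=; rewrite lee_fin (ger0_norm (f0 x)).
apply: le_trans (ler_norm _).
have [x0|x0] := leP x 0.
  by rewrite fneg// mulr_ge0 ?divr_ge0 ?(ltW beta0)// exponential_pdf_ge0// ltW.
rewrite exponential_pdfE ?(ltW x0)//.
by rewrite (le_trans (fC _ x0))// mulrA divfK// gt_eqF.
Qed.

(** The term of degree p + 1 of the exponential series, taken at beta (1 + x), dominates the power;
    the factor [expR beta] comes from passing from 1 + x back to x. *)
Lemma poly_le_expR (p : nat) (beta : R) : 0 < beta ->
  exists C, forall x : R, 0 <= x -> (1 + x) ^+ p <= C * expR (beta * x).
Proof.
move=> b0; exists (p.+1`!%:R * beta ^- p.+1 * expR beta) => x x0.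
have x1 : 0 <= 1 + x by rewrite addr_ge0.
apply: (@le_trans _ _ ((1 + x) ^+ p.+1)).
  by rewrite exprS ler_peMl ?exprn_ge0// lerDl.
have h := @expR_ge1Dxn R (beta * (1 + x)) p (mulr_ge0 (ltW b0) x1).
have {}h : (beta * (1 + x)) ^+ p.+1 / p.+1`!%:R <= expR (beta * (1 + x)).
  by apply: le_trans h; rewrite lerDr.
move: h; rewrite ler_pdivrMr ?ltr0n ?fact_gt0// exprMn mulrDr mulr1 expRD.
rewrite mulrC -ler_pdivlMr ?exprn_gt0// => h; apply: (le_trans h).
by rewrite le_eqVlt; apply/orP; left; apply/eqP; ring.
Qed.

End laplace.

Section renewal_density.
Context {R : realType} {b K : R} (b0 : 0 < b).
Local Notation mu := (@lebesgue_measure R).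
Local Notation I g := (Rintegral lebesgue_measure setT g).
Implicit Types (k : R -> R) (a c : R).

Definition laplace k a : R := I (fun x => expR (- a * x) * renewal b k x).

Definition renewal_pdf k a (x : R) : R :=
  expR (- a * x) * renewal b k x / laplace k a.

Lemma measurable_expRM a : measurable_fun setT (fun x : R => expR (- a * x)).
Proof. by apply: (measurableT_comp (@measurable_expR R)); exact: measurable_funM. Qed.

Lemma integrable_tilt k a : renewal_kernel b K k -> 0 < a ->
  mu.-integrable setT (EFin \o (fun x => expR (- a * x) * renewal b k x)).
Proof.
move=> hk a0; have [p hp] := renewal_poly b K b0 k hk.
have [C hC] := poly_le_expR p (a / 2) ltac:(lra).
apply: (@integrable_expdecay _ _ C (a / 2)); first by lra.
- by apply: measurable_funM; [exact: measurable_expRM|exact: (measurable_renewal b K)].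
- by move=> x; rewrite mulr_ge0 ?expR_ge0// (renewal_ge0 b K).
- by move=> x x0; rewrite (renewal_le0 b K) ?mulr0.
- move=> x x0; rewrite mulrC.
  apply: (@le_trans _ _ (C * expR (a / 2 * x) * expR (- a * x))).
    by rewrite ler_wpM2r ?expR_ge0// (le_trans (hp _ (ltW x0)))// hC// ltW.
  rewrite -mulrA -expRD (_ : a / 2 * x + - a * x = - (a / 2) * x)//; lra.
Qed.

Lemma laplace_gt0 k a : renewal_kernel b K k -> 0 < a -> 0 < laplace k a.
Proof.
move=> hk a0; rewrite -lte_fin -EFin_Rintegral//; last exact: integrable_tilt.
have mg : measurable_fun setT (fun x => (expR (- a * x) * renewal b k x)%:E).
  by apply/measurable_EFinP; apply: measurable_funM;
    [exact: measurable_expRM|exact: (measurable_renewal b K)].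
apply: (@lt_le_trans _ _ (\int[mu]_(x in `]0%R, b[) (expR (- a * b))%:E)%E).
  rewrite integral_cst//= lebesgue_measure_itv/= lte_fin b0 -EFinB -EFinM lte_fin.
  by rewrite subr0 mulr_gt0// expR_gt0.
apply: (@le_trans _ _ (\int[mu]_(x in `]0%R, b[) (expR (- a * x) * renewal b k x)%:E)%E).
{ apply: (@ge0_le_integral _ _ R mu `]0%R, b[%classic (measurable_itv _)).
  - by move=> x _; rewrite lee_fin expR_ge0.
  - exact: measurable_cst.
  - exact: measurable_funTS.
  - move=> x; rewrite /= in_itv/= => xb; rewrite (renewal_gap b K)// mulr1 lee_fin ler_expR.
    by rewrite !mulNr lerN2 ler_wpM2l// ltW//; case/andP: xb. }
apply: ge0_subset_integral => //.
by move=> x _; rewrite lee_fin mulr_ge0 ?expR_ge0// (renewal_ge0 b K).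
Qed.

(** Multiplying x g = g * k by exp(- a x) tilts both the solution and the kernel, since the
    exponential splits along y and x - y; the normalisation is immaterial as the equation is linear
    in the solution. *)
Lemma renewal_pdf_steutel k a : renewal_kernel b K k -> 0 < a ->
  steutel (renewal_pdf k a) (fun x => expR (- a * x) * k x).
Proof.
move=> hk a0; have G0 := laplace_gt0 k a hk a0; have [mk kK kn k1] := hk.
have k0 z : 0 <= k z by have /andP[] := kK z.
have mt : measurable_fun setT (fun x => expR (- a * x) * renewal b k x).
  by apply: measurable_funM; [exact: measurable_expRM|exact: (measurable_renewal b K)].
have mek : measurable_fun setT (fun x => expR (- a * x) * k x).
  by apply: measurable_funM => //; exact: measurable_expRM.
have ek0 x : 0 <= expR (- a * x) * k x by rewrite mulr_ge0 ?expR_ge0.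
split => //.
- by apply: measurable_funM.
- by move=> x; rewrite divr_ge0 ?(ltW G0)// mulr_ge0 ?expR_ge0// (renewal_ge0 b K).
- exact: (integrableZr measurableT (laplace k a)^-1 (integrable_tilt k a hk a0)).
- by move=> x x0; rewrite /renewal_pdf (renewal_le0 b K)// mulr0 mul0r.
- apply: (@integrable_expdecay _ _ K a) => //.
  + by move=> x x0; rewrite kn// mulr0.
  + by move=> x x0; rewrite mulrC ler_wpM2r ?expR_ge0//; have /andP[] := kK x.
- by move=> x x0; rewrite kn// mulr0.
- move=> x; rewrite /renewal_pdf.
  rewrite (_ : x * _ = expR (- a * x) / laplace k a * (x * renewal b k x)); last by ring.
  rewrite EFinM (renewal_eq b K)// -ge0_integralZl//.
  + apply: eq_integral => y _ /=; rewrite -!EFinM; congr EFin.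
    rewrite (_ : - a * x = - a * y + - a * (x - y)); last by ring.
    by rewrite expRD; ring.
  + by apply: measurable_conv_integrand => //; apply/measurable_EFinP; exact: (measurable_renewal b K).
  + by move=> y _; rewrite mule_ge0//= lee_fin// (renewal_ge0 b K).
  + by rewrite lee_fin divr_ge0 ?expR_ge0// ltW.
Qed.

Lemma renewal_pdf_mass k a : renewal_kernel b K k -> 0 < a -> I (renewal_pdf k a) = 1.
Proof.
move=> hk a0; rewrite /renewal_pdf RintegralZr//; last exact: integrable_tilt.
by rewrite divff// gt_eqF// laplace_gt0.
Qed.

Lemma kernel_laplace_le k a : renewal_kernel b K k -> 0 < a ->
  I (fun x => expR (- a * x) * k x) <= K / a.
Proof.
move=> hk a0; have [mk kK kn k1] := hk.
have fk := renewal_pdf_steutel k a hk a0.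
have -> : K / a = I (fun x => K / a * exponential_pdf a x).
  rewrite RintegralZl//; last exact: integrable_exponential_pdf.
  by rewrite /Rintegral integral_exponential_pdf// mulr1.
apply: le_Rintegral => //; first exact: steutel_ki fk.
  exact: (integrableZl measurableT (K / a) (integrable_exponential_pdf a0)).
move=> x _; have [x0|x0] := leP x 0.
  rewrite kn// mulr0 mulr_ge0 ?divr_ge0 ?(ltW a0)// ?exponential_pdf_ge0 ?(ltW a0)//.
  by have /andP[k00 k01] := kK 0; exact: le_trans k00 k01.
rewrite exponential_pdfE ?(ltW x0)// mulrA divfK ?gt_eqF// mulrC.
by rewrite ler_wpM2r ?expR_ge0//; have /andP[] := kK x.
Qed.

(** The mean of [renewal_pdf k a] is the mass of its kernel, by [steutel_moment], hence at most K /
    a. Integrating exp(- c x) >= 1 - c x against the tilted function turns this into control of the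
    decay of the Laplace transform. *)
Lemma laplace_ratio k a c : renewal_kernel b K k -> 0 < a -> 0 <= c ->
  laplace k a * (1 - c * K / a) <= laplace k (a + c).
Proof.
move=> hk a0 c0; have fk := renewal_pdf_steutel k a hk a0.
have ac0 : 0 < a + c by rewrite ltr_wpDr.
have G0 := laplace_gt0 k a hk a0.
have h := steutel_moment fk; rewrite (renewal_pdf_mass k a hk a0) mul1r in h.
have hK := kernel_laplace_le k a hk a0.
have xgi : mu.-integrable setT (EFin \o (fun x => x * (expR (- a * x) * renewal b k x))).
  have := integrableZl measurableT (laplace k a) (steutel_moment_integrable fk).
  apply: eq_integrable => // x _ /=; rewrite -EFinM; congr EFin.
  by rewrite /renewal_pdf; field; rewrite gt_eqF.
have xgE : I (fun x => x * (expR (- a * x) * renewal b k x)) =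
    laplace k a * I (fun x => expR (- a * x) * k x).
  rewrite -h -RintegralZl//; last exact: steutel_moment_integrable fk.
  by apply: eq_Rintegral => x _; rewrite /renewal_pdf; field; rewrite gt_eqF.
have key : laplace k a <= laplace k (a + c) +
    c * I (fun x => x * (expR (- a * x) * renewal b k x)).
  rewrite -RintegralZl// -RintegralD//; [|exact: integrable_tilt|exact: (integrableZl measurableT c xgi)].
  apply: le_Rintegral => //; first exact: integrable_tilt.
    exact: (integrableD measurableT (integrable_tilt k (a + c) hk ac0) (integrableZl measurableT c xgi)).
  move=> x _; have [x0|x0] := leP x 0.
    by rewrite (renewal_le0 b K)// !mulr0 addr0.
  rewrite (_ : - (a + c) * x = - a * x + - (c * x)); last by ring.
  rewrite expRD mulrA mulrA -mulrDl ler_wpM2r ?(renewal_ge0 b K)//.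
  rewrite (_ : _ + _ = expR (- a * x) * (expR (- (c * x)) + c * x)); last by ring.
  rewrite ler_peMr ?expR_ge0//.
  by have := expR_ge1Dx (- (c * x)); lra.
have : c * I (fun x => x * (expR (- a * x) * renewal b k x)) <= c * (laplace k a * (K / a)).
  by rewrite xgE ler_wpM2l// ler_wpM2l// ltW.
rewrite (_ : c * (_ * _) = laplace k a * (c * K / a)); last by ring.
by move: key; rewrite mulrBr mulr1; lra.
Qed.

End renewal_density.

(** * Comparison of the densities of two Lévy laws *)

Definition tame {R : realType} (b M : R) (th : R -> R) : Prop :=
  [/\ measurable_fun `[(0 : R), +oo[ th, forall x, 0 <= x -> `|th x| <= M &
      forall x, 0 < x < b -> th x = 0].

(** The kernel x v(x) with its factor exp(- alpha x) removed; that factor is restored by the tilt in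
    [renewal_pdf]. *)
Definition expN_pos {R : realType} (th : R -> R) (x : R) : R :=
  if 0 < x then expR (- th x) else 0.

Lemma ler_div_upper {R : realFieldType} {X Y G G' r : R} : 0 < G -> 0 < G' -> 0 < r ->
  0 <= Y -> X <= Y -> G * r <= G' -> X / G' <= r^-1 * (Y / G).
Proof.
move=> G0 G0' r0 Y0 XY GG.
rewrite mulrCA; apply: (@le_trans _ _ (Y / G')); first by rewrite ler_wpM2r// invr_ge0 ltW.
by rewrite ler_wpM2l// -invfM lef_pV2 ?posrE ?mulr_gt0// mulrC.
Qed.

Lemma ler_div_lower {R : realFieldType} {X Z G G' r : R} : 0 < G -> 0 < G' ->
  0 <= Z -> Z <= X -> r * G' <= G -> r * Z / G <= X / G'.
Proof.
move=> G0 G0' Z0 ZX GG.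
apply: (@le_trans _ _ (Z / G')); last by rewrite ler_wpM2r// invr_ge0 ltW.
by rewrite ler_pdivrMr// mulrAC ler_pdivlMr// (mulrC r) -mulrA ler_wpM2l.
Qed.

Section comparison.
Context {R : realType} {b M : R} (b0 : 0 < b).
Local Notation mu := (@lebesgue_measure R).
Local Notation I g := (Rintegral lebesgue_measure setT g).
Local Notation K := (expR M).
Implicit Types (th : R -> R) (a d x : R).

Lemma tame_kernel th : tame b M th -> renewal_kernel b K (expN_pos th).
Proof.
move=> [mth thM thb]; split.
- rewrite (_ : expN_pos th = (fun x => expR (- th x)) \_ `]0, +oo[%classic).
    apply: (iffLR (measurable_restrictT _ (measurable_itv _))).
    apply: (measurableT_comp (@measurable_expR R)); apply: measurableT_comp => //.
    by apply: measurable_funS mth => //; apply: subset_itvr; rewrite bnd_simp.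
  by apply/funext => x; rewrite patchE /expN_pos; case: ifPn => [|/negP] x0; case: ifPn => //;
    rewrite ?inE ?notin_setE/= in_itv/= andbT.
- move=> z; rewrite /expN_pos; case: ifPn => z0; last by rewrite lexx expR_ge0.
  rewrite expR_ge0 ler_expR; have := thM z (ltW z0).
  by rewrite ler_norml; lra.
- by move=> z z0; rewrite /expN_pos ltNge z0.
- by move=> z zb; rewrite /expN_pos thb//; case/andP: zb => -> _; rewrite oppr0 expR0.
Qed.

Section two.
Context {th th' : R -> R} {a a' d : R} (hth : tame b M th) (hth' : tame b M th')
  (d0 : 0 <= d) (ad : 0 < a - 2 * d) (aa : `|a - a'| <= d)
  (tt : forall x, 0 < x -> `|th x - th' x| <= d * x).
Local Notation k := (expN_pos th).
Local Notation k' := (expN_pos th').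
Let hk := tame_kernel _ hth.
Let hk' := tame_kernel _ hth'.

(** Of the shift 2 d, one d pays for [|a - a'|] and the other for the factor exp(d x) between the
    two renewal functions. *)
Lemma renewal_close_le x : 0 < x ->
  expR (- a' * x) * renewal b k' x <= expR (- (a - 2 * d) * x) * renewal b k x.
Proof.
move=> x0.
have hg : renewal b k' x <= expR (d * x) * renewal b k x.
  apply: (renewal_tilt b K b0) => // z z0; rewrite /expN_pos z0 -expRD ler_expR.
  by have := tt z z0; rewrite ler_norml; lra.
apply: (le_trans (ler_wpM2l (expR_ge0 _) hg)); rewrite mulrA -expRD.
rewrite ler_wpM2r ?(renewal_ge0 b K)// ler_expR -mulrDl ler_wpM2r ?(ltW x0)//.
by move: aa d0; rewrite ler_norml; lra.
Qed.

Lemma renewal_close_ge x : 0 < x ->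
  expR (- (a + 2 * d) * x) * renewal b k x <= expR (- a' * x) * renewal b k' x.
Proof.
move=> x0.
have hg : renewal b k x <= expR (d * x) * renewal b k' x.
  apply: (renewal_tilt b K b0) => // z z0; rewrite /expN_pos z0 -expRD ler_expR.
  by have := tt z z0; rewrite ler_norml; lra.
apply: (le_trans (ler_wpM2l (expR_ge0 _) hg)); rewrite mulrA -expRD.
rewrite ler_wpM2r ?(renewal_ge0 b K)// ler_expR -mulrDl ler_wpM2r ?(ltW x0)//.
by move: aa d0; rewrite ler_norml; lra.
Qed.

Let a'0 : 0 < a'. Proof. move: aa ad d0; rewrite ler_norml => /andP[]; lra. Qed.

Lemma laplace_close : laplace (b := b) k (a + 2 * d) <= laplace (b := b) k' a' <=
  laplace (b := b) k (a - 2 * d).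
Proof.
have ad' : 0 < a + 2 * d by move: ad d0; lra.
apply/andP; split; apply: le_Rintegral => //; rewrite ?integrable_tilt//;
  try exact: (integrable_tilt (K := K)); move=> x _.
  have [x0|x0] := leP x 0; first by rewrite !(renewal_le0 b K)// !mulr0.
  exact: renewal_close_ge.
have [x0|x0] := leP x 0; first by rewrite !(renewal_le0 b K)// !mulr0.
exact: renewal_close_le.
Qed.

Context {rho : R} (rho0 : 0 < rho) (rhoE : rho <= 1 - 4 * d * K / (a - 2 * d)).

(** This is [laplace_ratio] from a - 2 d to a + 2 d, whence the shift 4 d in the condition on
    [rho]. *)
Let ratio : laplace (b := b) k (a - 2 * d) * rho <= laplace (b := b) k (a + 2 * d).
Proof.
have d4 : 0 <= 4 * d by rewrite mulr_ge0.
have := laplace_ratio b0 k (a - 2 * d) (4 * d) hk ad d4.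
rewrite (_ : a - 2 * d + 4 * d = a + 2 * d); last by ring.
apply: le_trans; apply: ler_wpM2l => //.
by apply: ltW; apply: (laplace_gt0 (K := K)).
Qed.

Let laplace_mono : laplace (b := b) k (a + 2 * d) <= laplace (b := b) k a.
Proof.
have ad' : 0 < a + 2 * d by move: ad d0; lra.
have a0 : 0 < a by move: ad d0; lra.
apply: le_Rintegral => //; try exact: (integrable_tilt (K := K)).
move=> z _; have [z0|z0] := leP z 0; first by rewrite !(renewal_le0 b K)// !mulr0.
rewrite ler_wpM2r ?(renewal_ge0 b K)// ler_expR ler_wpM2r ?(ltW z0)//; move: d0; lra.
Qed.

Lemma renewal_pdf_upper x :
  renewal_pdf (b := b) k' a' x <= rho^-1 * renewal_pdf (b := b) k (a - 2 * d) x.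
Proof.
rewrite /renewal_pdf; have [x0|x0] := leP x 0.
  by rewrite !(renewal_le0 b K)// !mulr0 [X in X <= _]mul0r [X in _ * X]mul0r mulr0.
have G0 : 0 < laplace (b := b) k (a - 2 * d) by apply: (laplace_gt0 (K := K)).
have G0' : 0 < laplace (b := b) k' a' by apply: (laplace_gt0 (K := K)).
have /andP[h1 h2] := laplace_close.
apply: (ler_div_upper G0 G0' rho0).
- by rewrite mulr_ge0 ?expR_ge0// (renewal_ge0 b K).
- exact: renewal_close_le.
- exact: le_trans ratio h1.
Qed.

(** Here exp(- 2 d x) is kept explicit instead of being absorbed into the parameter: the bound must
    be relative to the density at [a] itself, which is the denominator of the likelihood ratio. *)
Lemma renewal_pdf_lower x :
  rho * expR (- (2 * d * x)) * renewal_pdf (b := b) k a x <= renewal_pdf (b := b) k' a' x.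
Proof.
rewrite /renewal_pdf; have [x0|x0] := leP x 0.
  by rewrite !(renewal_le0 b K)// !mulr0 [X in _ <= X]mul0r [X in _ * X]mul0r mulr0.
have a0 : 0 < a by move: ad d0; lra.
have G0 : 0 < laplace (b := b) k (a - 2 * d) by apply: (laplace_gt0 (K := K)).
have G00 : 0 < laplace (b := b) k a by apply: (laplace_gt0 (K := K)).
have G0' : 0 < laplace (b := b) k' a' by apply: (laplace_gt0 (K := K)).
have /andP[h1 h2] := laplace_close.
have E : expR (- (2 * d * x)) * (expR (- a * x) * renewal b k x) =
    expR (- (a + 2 * d) * x) * renewal b k x.
  by rewrite mulrA -expRD; congr (expR _ * _); ring.
have -> : rho * expR (- (2 * d * x)) * (expR (- a * x) * renewal b k x / laplace (b := b) k a) =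
    rho * (expR (- (2 * d * x)) * (expR (- a * x) * renewal b k x)) / laplace (b := b) k a.
  by rewrite !mulrA.
rewrite E; apply: (ler_div_lower G00 G0').
- by rewrite mulr_ge0 ?expR_ge0// (renewal_ge0 b K).
- exact: renewal_close_ge.
- apply: (le_trans _ laplace_mono); apply: le_trans ratio.
  by rewrite mulrC; apply: ler_wpM2r => //; exact: ltW.
Qed.

End two.
End comparison.

(** * The canonical version of the density *)

Lemma limn_esup_leM {R : realType} (u v : (\bar R)^nat) (c : R) : 0 <= c ->
  (forall n, u n <= c%:E * v n)%E -> (limn_esup u <= c%:E * limn_esup v)%E.
Proof.
move=> c0 uv; rewrite !limn_esup_lim -limeMl//; last exact: is_cvg_esups.
apply: lee_lim; [exact: is_cvg_esups|apply: is_cvgeZl => //; exact: is_cvg_esups|].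
apply: nearW => n; apply: ge_ereal_sup => _ [m /= nm <-].
rewrite (le_trans (uv m))// lee_wpmul2l//.
by apply: ereal_sup_ubound; exists m.
Qed.

Section dens.
Context {R : realType}.
Implicit Types (P : probability R R).
Local Notation mu := (@lebesgue_measure R).

Definition window (x : R) (m : nat) : set R :=
  [set` `[(x - m.+1%:R^-1)%R, (x + m.+1%:R^-1)%R]%R].

Definition avg P (x : R) (m : nat) : \bar R :=
  (((m.+1)%:R / 2 : R)%:E * P (window x m))%E.

Lemma densE P x : dens P x = fine (limn_esup (avg P x)).
Proof. by []. Qed.

Lemma avg_ge0 P x m : (0 <= avg P x m)%E.
Proof. by rewrite mule_ge0// lee_fin divr_ge0. Qed.

Lemma limn_esup_avg_ge0 P x : (0 <= limn_esup (avg P x))%E.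
Proof.
rewrite limn_esup_lim; apply: lime_ge; first exact: is_cvg_esups.
apply: nearW => n; apply: (le_trans (avg_ge0 P x n)).
by apply: ereal_sup_ubound; exists n => /=.
Qed.

Lemma dens_ge0 P x : 0 <= dens P x.
Proof. by rewrite densE fine_ge0// limn_esup_avg_ge0. Qed.

Lemma lebesgue_window (x : R) m : mu (window x m) = (2 * m.+1%:R^-1)%:E.
Proof.
rewrite /window lebesgue_measure_itv/= lte_fin.
have m0 : 0 < m.+1%:R^-1 :> R by rewrite invr_gt0.
rewrite ifT; last by rewrite ltrD2l (@lt_trans _ _ 0)// oppr_lt0.
by rewrite -EFinB; congr EFin; ring.
Qed.

(** [dens] applies [fine], which sends +oo to 0; domination by a multiple of Lebesgue measure
    excludes the value +oo at every point. *)
Lemma limn_esup_avg_fin P (C : R) : (forall A, measurable A -> P A <= C%:E * mu A)%E ->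
  forall x, limn_esup (avg P x) \is a fin_num.
Proof.
move=> PC x; rewrite ge0_fin_numE ?limn_esup_avg_ge0//.
apply: (@le_lt_trans _ _ C%:E); last exact: ltry.
rewrite limn_esup_lim; apply: lime_le; first exact: is_cvg_esups.
apply: nearW => n; apply: ge_ereal_sup => _ [m _ <-].
rewrite /avg; apply: (@le_trans _ _ ((m.+1%:R / 2)%:E * (C%:E * mu (window x m)))%E).
  by rewrite lee_wpmul2l ?lee_fin ?divr_ge0// PC//; exact: measurable_itv.
rewrite lebesgue_window -!EFinM lee_fin le_eqVlt; apply/orP; left; apply/eqP.
have : m.+1%:R != 0 :> R by rewrite pnatr_eq0.
by set N := m.+1%:R => N0; field.
Qed.

(** Comparing the measures of all windows around x gives the inequality at x itself, not merely
    almost everywhere. This is needed because the likelihood evaluates [dens] at the sample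
    points. *)
Lemma le_dens P P' (C c : R) x : (forall A, measurable A -> P' A <= C%:E * mu A)%E ->
  0 <= c -> (forall m, P (window x m) <= c%:E * P' (window x m))%E ->
  dens P x <= c * dens P' x.
Proof.
move=> P'C c0 h; have f' := limn_esup_avg_fin P' C P'C x.
have le : (limn_esup (avg P x) <= c%:E * limn_esup (avg P' x))%E.
  apply: limn_esup_leM => // m; rewrite /avg muleCA.
  by rewrite lee_wpmul2l ?lee_fin ?divr_ge0.
rewrite !densE -lee_fin EFinM !fineK//.
rewrite ge0_fin_numE ?limn_esup_avg_ge0//; apply: (le_lt_trans le).
by rewrite -(fineK f') -EFinM ltry.
Qed.

Lemma measurable_dens P : measurable_fun setT (dens P).
Proof.
apply: (@measurableT_comp _ _ _ _ _ _ _ _ (fun x => limn_esup (avg P x)) (@fine_measurable R setT measurableT)).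
apply: measurable_fun_limn_esup => m; apply: emeasurable_funM => //.
(* Written as the integral over y of an indicator of y - x, the measure of the window is measurable
   in x by Tonelli. *)
rewrite (_ : (fun x => P (window x m)) = (fun x => (\int[P]_y
   (\1_(`[- m.+1%:R^-1, m.+1%:R^-1]) (y - x))%:E)%E)).
  apply: (@measurable_fun_fubini_tonelli_F _ _ R R R P
    (fun z => (\1_(`[- m.+1%:R^-1, m.+1%:R^-1]) (z.2 - z.1))%:E)) => //.
  apply/measurable_EFinP; apply: measurableT_comp; last exact: measurable_funB.
  exact: measurable_indic.
apply/funext => x; rewrite -[LHS]mul1e -[LHS]integral_cst//=; last exact: measurable_itv.
rewrite integral_mkcond; apply: eq_integral => y _.
rewrite epatch_indic/= mul1e !indicE; congr (_%:R%:E).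
apply: congr1; rewrite /window; move: (m.+1%:R^-1) => e.
by apply/idP/idP; rewrite !inE/= !in_itv/= => /andP[? ?]; apply/andP; split; lra.
Qed.

Lemma dens_ae P f : has_density P f -> {ae mu, forall x, dens P x = f x}.
Proof.
move=> [mf f0 PE].
have fi : mu.-integrable setT (EFin \o f).
  apply/integrableP; split; first exact/measurable_EFinP.
  under eq_integral => x _ do rewrite gee0_abs ?lee_fin//.
  by rewrite -PE// probability_setT ltry.
have lf := open_integrable_locally openT fi.
have sh x : nicely_shrinking x (window x).
{ split; first by move=> n; exact: measurable_itv.
  have r0 n : 0 < 2 * n.+1%:R^-1 :> R by rewrite mulr_gt0 ?invr_gt0.
  (* Balls are open and windows closed, so balls of twice the radius are taken; their measure is
     twice that of the windows, hence the constant 2. *)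
  exists (2, fun n => PosNum (r0 n)) => /=; split => //.
  - rewrite -[X in _ --> X](mulr0 2); apply: cvgM; first exact: cvg_cst.
    exact: cvg_harmonic.
  - move=> n y; rewrite /window /ball/= in_itv/= ltr_distlC.
    have : 0 < n.+1%:R^-1 :> R by rewrite invr_gt0.
    by move: (n.+1%:R^-1) => e e0 /andP[? ?]; apply/andP; split; lra.
  - move=> n; rewrite (lebesgue_measure_ball _ (ltW (r0 n))).
    rewrite lebesgue_window.
    have -> : (2 / n.+1%:R *+ 2 = 2 * (2 / n.+1%:R) :> R) by rewrite [RHS]mulr_natl.
    by rewrite EFinM. }
have := lebesgue_differentiation lf.
apply: (@filterS _ _ (ae_filter_ringOfSetsType mu)) => x fx; have h := nice_lebesgue_differentiation sh lf fx.
rewrite densE (_ : avg P x = fun n => ((mu (window x n))^-1 * \int[mu]_(y in window x n) (f y)%:E)%E).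
  by rewrite is_cvg_limn_esupE ?(cvg_lim _ h)//; apply/cvg_ex; eexists; exact: h.
apply/funext => n; rewrite /avg PE; last exact: measurable_itv.
rewrite lebesgue_window inver mulf_eq0 pnatr_eq0/= invr_eq0 pnatr_eq0/=.
by rewrite invfM invrK mulrC.
Qed.

Lemma dens_has_density P f : has_density P f -> has_density P (dens P).
Proof.
move=> h; have [mf f0 PE] := h; split; [exact: measurable_dens|exact: dens_ge0|].
move=> A mA; rewrite PE//; apply: ge0_ae_eq_integral => //.
- by apply/measurable_EFinP; exact: measurable_funTS.
- by apply/measurable_EFinP; apply: measurable_funTS; exact: measurable_dens.
- by move=> x _; rewrite lee_fin.
- by move=> x _; rewrite lee_fin dens_ge0.
- have := dens_ae P f h.
  by apply: (@filterS _ _ (ae_filter_ringOfSetsType mu)) => x -> _.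
Qed.

End dens.

(** * Sampling, affinity and prior integrals *)

(* Holds without measurability: the integral of a nonnegative function is a
   supremum over the simple functions below it. *)
Lemma ge0_le_integral_nomeas {d} {T : measurableType d} {R : realType}
    (mu : {measure set T -> \bar R}) (D : set T) (f g : T -> \bar R) :
  (forall x, D x -> 0 <= f x)%E -> (forall x, D x -> f x <= g x)%E ->
  (\int[mu]_(x in D) f x <= \int[mu]_(x in D) g x)%E.
Proof.
move=> f0 fg; have g0 x : D x -> (0 <= g x)%E by move=> Dx; exact: le_trans (f0 x Dx) (fg x Dx).
rewrite !ge0_integralE//; apply: le_ereal_sup => _ [h /= hf <-].
exists h => //= x; apply: (le_trans (hf x)).
by rewrite !patchE; case: ifPn => // xD; apply: fg; exact: set_mem.
Qed.

Section sample.
Context {R : realType} (P : probability R R).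
Local Notation It := (iter_int (fun _ g => (\int[P]_x g x)%E)).

Lemma iter_int_sample_ge0 n (F : (nat -> R) -> \bar R) :
  (forall z, 0 <= F z)%E -> (0 <= It n F)%E.
Proof.
elim: n F => [|n IH] F F0 /=; first exact: F0.
by apply: integral_ge0 => x _; apply: IH.
Qed.

(** [F] need not be measurable; only its majorant, a finite sum of products over the coordinates, is
    integrated. The outermost integral is over the last coordinate, whose factor is absorbed into
    the coefficients [c j] before the induction hypothesis is used. *)
Lemma iter_int_sample_le (J : Type) (js : seq J) (f : J -> R -> R) (e : J -> R) :
  (forall j x, 0 <= f j x) -> (forall j, measurable_fun setT (f j)) ->
  (forall j, \int[P]_x (f j x)%:E <= (e j)%:E)%E ->
  forall n (c : J -> R) (F : (nat -> R) -> \bar R), (forall j, 0 <= c j) ->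
  (forall z, 0 <= F z)%E ->
  (forall z, F z <= (\sum_(j <- js) c j * \prod_(i < n) f j (z i))%:E)%E ->
  (It n F <= (\sum_(j <- js) c j * e j ^+ n)%:E)%E.
Proof.
move=> f0 mf fe; elim=> [|n IH] c F c0 F0 hF /=.
  rewrite (eq_bigr c) => [|j _]; last by rewrite expr0 mulr1.
  apply: (le_trans (hF _)).
  by rewrite lee_fin; apply: ler_sum => j _; rewrite big_ord0 mulr1.
have e0 j : 0 <= e j by rewrite -lee_fin (le_trans _ (fe j))// integral_ge0// => x _; rewrite lee_fin.
apply: (@le_trans _ _ (\int[P]_x (\sum_(j <- js) (c j * f j x) * e j ^+ n)%:E)%E).
  apply: ge0_le_integral_nomeas => x _; first by apply: iter_int_sample_ge0.
  apply: (IH (fun j => c j * f j x)) => //; first by move=> j; rewrite mulr_ge0.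
  move=> z; apply: (le_trans (hF _)); rewrite lee_fin le_eqVlt; apply/orP; left; apply/eqP.
  apply: eq_bigr => j _; rewrite big_ord_recr /= eqxx mulrAC mulrA; congr (_ * _ * _).
  by apply: eq_bigr => i _; rewrite ltn_eqF //= ltn_ord.
under eq_integral do rewrite -sumEFin.
rewrite ge0_integral_sum//; last 2 first.
{ move=> j; apply/measurable_EFinP; apply: measurable_funM => //.
  by apply: measurable_funM. }
{ by move=> j x _; rewrite lee_fin !mulr_ge0 ?exprn_ge0. }
rewrite -sumEFin; apply: lee_sum => j _.
under eq_integral do rewrite mulrAC EFinM.
rewrite ge0_integralZl//; last 3 first.
{ exact/measurable_EFinP. }
{ by move=> x _; rewrite lee_fin. }
{ by rewrite lee_fin mulr_ge0 ?exprn_ge0. }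
rewrite (_ : c j * e j ^+ n.+1 = (c j * e j ^+ n) * e j); last by rewrite exprSr mulrA.
by rewrite [leRHS]EFinM lee_wpmul2l ?lee_fin ?mulr_ge0 ?exprn_ge0.
Qed.

Lemma sample_prob_le (n : nat) (E : (nat -> R) -> Prop) (J : Type) (js : seq J)
    (c e : J -> R) (f : J -> R -> R) :
  (forall j x, 0 <= f j x) -> (forall j, measurable_fun setT (f j)) ->
  (forall j, \int[P]_x (f j x)%:E <= (e j)%:E)%E -> (forall j, 0 <= c j) ->
  (forall z, E z -> 1 <= \sum_(j <- js) c j * \prod_(i < n) f j (z i)) ->
  (sample_prob P n E <= (\sum_(j <- js) c j * e j ^+ n)%:E)%E.
Proof.
move=> f0 mf fe c0 hE; apply: (iter_int_sample_le _ js f e f0 mf fe _ c) => //.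
  by move=> z; rewrite lee_fin; case: ifP.
move=> z; rewrite lee_fin; case: ifPn => [/asboolP|_]; first exact: hE.
by apply: sumr_ge0 => j _; rewrite mulr_ge0// prodr_ge0.
Qed.

Lemma sample_prob_ge0 n E : (0 <= sample_prob P n E)%E.
Proof. by apply: iter_int_sample_ge0 => z; rewrite lee_fin; case: ifP. Qed.

End sample.

Section affinity.
Context {R : realType} (P0 P P1 : probability R R) (t : R) (t0 : 0 < t)
  (h0 : has_density P0 (dens P0)) (h : has_density P (dens P))
  (h1 : has_density P1 (dens P1)).
Local Notation mu := (@lebesgue_measure R).
Local Notation I g := (Rintegral lebesgue_measure setT g).

Lemma density_integrable (P' : probability R R) f : has_density P' f ->
  mu.-integrable setT (EFin \o f) /\ I f = 1.
Proof.
move=> [mf f0 PE]; have f1 : (\int[mu]_x (f x)%:E = 1)%E by rewrite -PE// probability_setT.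
split; last by rewrite /Rintegral f1.
apply/integrableP; split; first exact/measurable_EFinP.
by under eq_integral => x _ do rewrite gee0_abs ?lee_fin//; rewrite f1 ltry.
Qed.

Lemma measurable_sqrt_comp (f : R -> R) : measurable_fun setT f ->
  measurable_fun setT (fun x => Num.sqrt (f x)).
Proof.
move=> mf; apply: (measurableT_comp _ mf).
by apply: continuous_measurable_fun; exact: sqrt_continuous.
Qed.

(** Square root of the likelihood ratio of the bracket; its mean under [P0] is the Hellinger
    affinity of bracket and truth. *)
Definition affinity_fun (x : R) : R :=
  Num.sqrt ((1 + t ^+ 2) * dens P1 x / dens P0 x).

Lemma measurable_affinity_fun : measurable_fun setT affinity_fun.
Proof.
apply: measurable_sqrt_comp; apply: measurable_funM.
  by apply: measurable_funM => //; exact: measurable_dens.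
by apply: ge0_measurable_funV; [exact: dens_ge0|exact: measurable_dens].
Qed.

(** Bound sqrt u by sqrt p + sqrt(u - p). The first term gives the squared difference of the roots;
    the second is split by the inequality of arithmetic and geometric means with weight t. If u has
    mass 1 + t^2, the total cost after integration is t^2 / (2 t) + t / 2 = t, which explains the
    excess t^2 of the brackets. *)
Lemma affinity_pointwise (u p p0 : R) : 0 <= p0 -> 0 <= p <= u ->
  Num.sqrt (u / p0) * p0 <= (2^-1 - (2 * t)^-1) * p + (2^-1 + t / 2) * p0 +
     - 2^-1 * (Num.sqrt p0 - Num.sqrt p) ^+ 2 + (2 * t)^-1 * u.
Proof.
move=> p00 /andP[p00' pu].
have u0 : 0 <= u := le_trans p00' pu.
set a := Num.sqrt p; set b := Num.sqrt p0.
have a0 : 0 <= a by exact: sqrtr_ge0.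
have b0 : 0 <= b by exact: sqrtr_ge0.
have aE : p = a ^+ 2 by rewrite /a sqr_sqrtr.
have bE : p0 = b ^+ 2 by rewrite /b sqr_sqrtr.
pose w := Num.sqrt (u - p).
have w0 : 0 <= w by exact: sqrtr_ge0.
have wE : u = a ^+ 2 + w ^+ 2 by rewrite /w sqr_sqrtr ?subr_ge0// -aE; ring.
have lhs : Num.sqrt (u / p0) * p0 <= (a + w) * b.
  rewrite sqrtrM// sqrtrV// -/b.
  have [b00|b00] := eqVneq b 0; first by rewrite bE b00 expr0n /= !mulr0.
  rewrite [X in _ * X]bE expr2 !mulrA mulfVK// ler_wpM2r//.
  rewrite -(ler_pXn2r (n := 2))// ?nnegrE ?addr_ge0 ?sqrtr_ge0//.
  rewrite sqr_sqrtr// wE; have : 0 <= a * w by rewrite mulr_ge0.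
  by nra.
apply: (le_trans lhs); rewrite wE aE bE.
have : 0 <= (w - t * b) ^+ 2 / (2 * t) by rewrite divr_ge0 ?sqr_ge0// mulr_ge0// ltW.
rewrite (_ : (w - t * b) ^+ 2 / (2 * t) = (2 * t)^-1 * w ^+ 2 - w * b + t / 2 * b ^+ 2); last first.
  by field; rewrite gt_eqF.
rewrite -/a -/b; lra.
Qed.

Lemma affinity_le (eps : R) : 0 < eps -> eps < hellinger P0 P ->
  (forall x, dens P x <= (1 + t ^+ 2) * dens P1 x) ->
  (\int[P0]_x (affinity_fun x)%:E <= (1 - eps ^+ 2 + t)%:E)%E.
Proof.
move=> e0 eh pu.
have [i0 I0] := density_integrable _ _ h0.
have [i I1] := density_integrable _ _ h.
have [i1 I11] := density_integrable _ _ h1.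
pose D x := (Num.sqrt (dens P0 x) - Num.sqrt (dens P x)) ^+ 2.
have mD : measurable_fun setT D.
  by apply: measurable_funX; apply: measurable_funB; apply: measurable_sqrt_comp; exact: measurable_dens.
have Di : mu.-integrable setT (EFin \o D).
  apply: (le_integrable measurableT _ _ (integrableD measurableT i0 i)).
    exact/measurable_EFinP.
  move=> x _ /=; rewrite lee_fin !ger0_norm ?sqr_ge0 ?addr_ge0 ?dens_ge0//.
  rewrite /D -{2}[dens P0 x]sqr_sqrtr ?dens_ge0// -{2}[dens P x]sqr_sqrtr ?dens_ge0//.
  have : 0 <= Num.sqrt (dens P0 x) * Num.sqrt (dens P x) by rewrite mulr_ge0 ?sqrtr_ge0.
  by nra.
have HD : eps ^+ 2 < 2^-1 * I D.
  move: eh; rewrite /hellinger EFin_Rintegral// -EFinM /=.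
  have ID0 : 0 <= I D by apply: Rintegral_ge0 => x _; exact: sqr_ge0.
  rewrite -(ltr_pXn2r (n := 2))// ?nnegrE ?sqrtr_ge0 ?ltW// sqr_sqrtr// mulr_ge0//.
rewrite (ge0_integral_density h0); last 2 first.
{ by apply/measurable_EFinP; exact: measurable_affinity_fun. }
{ by move=> x; rewrite lee_fin sqrtr_ge0. }
pose r x := (2^-1 - (2 * t)^-1) * dens P x + (2^-1 + t / 2) * dens P0 x + (- 2^-1) * D x.
have ri : mu.-integrable setT (EFin \o r) by exact: integrable_lin3.
have ui := integrableZl measurableT ((2 * t)^-1 * (1 + t ^+ 2)) i1.
apply: (@le_trans _ _ (\int[mu]_x (r x + (2 * t)^-1 * (1 + t ^+ 2) * dens P1 x)%:E)%E).
{ apply: ge0_le_integral => //.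
  - by move=> x _; rewrite mule_ge0 ?lee_fin ?sqrtr_ge0 ?dens_ge0.
  - apply: emeasurable_funM; apply/measurable_EFinP;
      [exact: measurable_affinity_fun|exact: measurable_dens].
  - exact: measurable_int (integrableD measurableT ri ui).
  - move=> x _; rewrite -EFinM lee_fin -mulrA.
    by apply: affinity_pointwise; rewrite ?dens_ge0//= pu. }
rewrite EFin_Rintegral//; last exact: (integrableD measurableT ri ui).
rewrite RintegralD// Rintegral_lin3// RintegralZl// I0 I1 I11 lee_fin.
rewrite (_ : (2 * t)^-1 * (1 + t ^+ 2) * 1 = (2 * t)^-1 + t / 2); last by field; rewrite gt_eqF.
by move: HD; lra.
Qed.

End affinity.

Section prior.
Context {R : realType} (al ah thb : R) (ha : al < ah) (hthb : 0 < thb).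
Local Notation mu := (@lebesgue_measure R).

Definition prior_lo (i : nat) : R := if i == 0%N then al else - thb.
Definition prior_hi (i : nat) : R := if i == 0%N then ah else thb.

Lemma prior_lt i : prior_lo i < prior_hi i.
Proof. by rewrite /prior_lo /prior_hi; case: eqP => // _; rewrite gtrN. Qed.

Lemma prior_intE i g : prior_int al ah thb i g = unif_int (prior_lo i) (prior_hi i) g.
Proof. by rewrite /prior_int /prior_lo /prior_hi; case: eqP. Qed.

Lemma unif_int_ge0 (a b : R) (g : R -> \bar R) : a < b ->
  (forall x, (a <= x <= b)%R -> 0 <= g x)%E -> (0 <= unif_int a b g)%E.
Proof.
move=> ab g0; apply: mule_ge0; first by rewrite lee_fin invr_ge0 subr_ge0 ltW.
by apply: integral_ge0 => x; rewrite /= in_itv/=; exact: g0.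
Qed.

Lemma unif_int_le (a b c : R) (g : R -> \bar R) : a < b ->
  (forall x, (a <= x <= b)%R -> 0 <= g x <= c%:E)%E -> (unif_int a b g <= c%:E)%E.
Proof.
move=> ab gc; rewrite /unif_int muleC lee_pdivrMr ?subr_gt0//.
rewrite (@le_trans _ _ (\int[mu]_(x in `[a, b]) c%:E)%E)//.
  apply: ge0_le_integral_nomeas => x; rewrite /= in_itv/= => /gc /andP[]//.
by rewrite integral_cst//= lebesgue_measure_itv/= lte_fin ab -EFinB.
Qed.

Lemma unif_int_ge (a b l r v eta : R) (g : R -> \bar R) : a < b -> 0 <= v ->
  a <= l -> l < r -> r <= b -> eta * (b - a) <= r - l ->
  (forall x, (a <= x <= b)%R -> 0 <= g x)%E ->
  (forall x, (l <= x <= r)%R -> v%:E <= g x)%E -> ((v * eta)%:E <= unif_int a b g)%E.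
Proof.
move=> ab v0 al' lr rb he g0 gv; rewrite /unif_int muleC lee_pdivlMr ?subr_gt0//.
apply: (@le_trans _ _ (\int[mu]_(x in `[a, b]) (v * \1_(`[l, r]) x)%:E)%E).
  rewrite [leRHS](_ : _ = (v * (r - l))%:E); first by rewrite -EFinM lee_fin -mulrA ler_wpM2l.
  rewrite integral_mkcond (_ : _ \_ _ = (fun x => v%:E * (\1_(`[l, r]) x)%:E)%E).
    rewrite ge0_integralZl//=; last exact/measurable_EFinP.
    rewrite integral_indic// setIT [X in (_ * X)%E](_ : _ = (r - l)%:E) ?EFinM//.
    by rewrite [LHS]lebesgue_measure_itv/= lte_fin lr -EFinB.
  apply/funext => x; rewrite patchE indicE; case: ifPn => [_|]; first by rewrite EFinM.
  rewrite notin_setE/= in_itv/= => xab; rewrite memNset ?mule0//= in_itv/= => /andP[lx xr].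
  by apply: xab; rewrite (le_trans al')// (le_trans xr).
apply: ge0_le_integral_nomeas => x; rewrite /= in_itv/= => xab.
  by rewrite lee_fin mulr_ge0// indicE.
rewrite indicE; have [|_] := boolP (x \in _); last by rewrite mulr0 g0.
by rewrite inE/= in_itv/= mulr1; exact: gv.
Qed.

Definition in_box (lo hi : nat -> R) (k : nat) (s : nat -> R) :=
  forall i, (i < k)%N -> lo i <= s i <= hi i.

Let upd (s : nat -> R) (k : nat) (x : R) := fun i => if i == k then x else s i.

Let in_box_upd lo hi k s x : in_box lo hi k s -> lo k <= x <= hi k ->
  in_box lo hi k.+1 (upd s k x).
Proof.
move=> hs hx i; rewrite ltnS leq_eqVlt /upd; case: eqP => [->//|_] /=; exact: hs.
Qed.

Lemma prior_iter_bounds k F (c : R) :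
  (forall s, in_box prior_lo prior_hi k s -> 0 <= F s <= c%:E)%E ->
  (0 <= iter_int (prior_int al ah thb) k F <= c%:E)%E.
Proof.
elim: k F => [|k IH] F hF /=; first exact: hF.
have h x : prior_lo k <= x <= prior_hi k ->
    (0 <= iter_int (prior_int al ah thb) k (fun s => F (upd s k x)) <= c%:E)%E.
  by move=> hx; apply: IH => s hs; apply: hF; exact: in_box_upd.
rewrite prior_intE; apply/andP; split.
  by apply: unif_int_ge0 => [|x /h /andP[]//]; exact: prior_lt.
by apply: unif_int_le => //; exact: prior_lt.
Qed.

Lemma prior_iter_ge0 k F :
  (forall s, 0 <= F s)%E -> (0 <= iter_int (prior_int al ah thb) k F)%E.
Proof.
elim: k F => [|k IH] F hF /=; first exact: hF.
by rewrite prior_intE; apply: unif_int_ge0 => [|x _]; [exact: prior_lt|exact: IH].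
Qed.

(** The factor [eta ^+ k] is the prior mass guaranteed to a sub-box that keeps at least a fraction
    [eta] of each of the k sides. *)
Lemma prior_iter_ge k F (l r : nat -> R) (v eta : R) : 0 <= v -> 0 <= eta ->
  (forall i, (i < k)%N -> [/\ prior_lo i <= l i, l i < r i, r i <= prior_hi i &
     eta * (prior_hi i - prior_lo i) <= r i - l i]) ->
  (forall s, 0 <= F s)%E ->
  (forall s, in_box l r k s -> v%:E <= F s)%E ->
  ((v * eta ^+ k)%:E <= iter_int (prior_int al ah thb) k F)%E.
Proof.
move=> v0 eta0; elim: k F => [|k IH] F hlr F0 Fv /=; first by rewrite mulr1; exact: Fv.
have [h1 h2 h3 h4] := hlr k (ltnSn k).
rewrite prior_intE exprSr mulrA; apply: (@unif_int_ge _ _ (l k) (r k)) => //.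
- exact: prior_lt.
- by rewrite mulr_ge0// exprn_ge0.
- by move=> x _; apply: prior_iter_ge0.
- move=> x hx; apply: IH => //; first by move=> i ik; apply: hlr; rewrite ltnS ltnW.
  by move=> s hs; apply: Fv; exact: in_box_upd.
Qed.

End prior.

(** * Bins and meshes *)

Section grid.
Context {R : realType} (bl bh : R) (hb : 0 < bl < bh).
Implicit Types (N : nat) (s : nat -> R) (x : R).

Let bl0 : 0 < bl. Proof. by case/andP: hb. Qed.
Let blh : bl < bh. Proof. by case/andP: hb. Qed.

Lemma grid_le N i j : (i <= j)%N -> grid bl bh N i <= grid bl bh N j.
Proof.
move=> ij; rewrite /grid lerD2l -!mulrA ler_wpM2r//.
  by rewrite divr_ge0// subr_ge0 ltW.
by rewrite ler_nat leq_sub2r.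
Qed.

Lemma grid1 N : grid bl bh N 1 = bl.
Proof. by rewrite /grid subnn !mul0r addr0. Qed.

Lemma gridN N : (1 < N)%N -> grid bl bh N N = bh.
Proof.
move=> N1; rewrite /grid mulrAC divff ?mul1r ?subrKC//.
by rewrite pnatr_eq0 subn_eq0 -ltnNge.
Qed.

Lemma gridS N k : (0 < k)%N ->
  grid bl bh N k.+1 = grid bl bh N k + (bh - bl) / (N - 1)%:R.
Proof.
case: k => // k _; rewrite /grid !subn1 /= -natr1 mulrDl mul1r mulrDl addrA//.
Qed.

Lemma theta_of_out N s x : ~~ (bl < x <= bh) -> theta_of bl bh N s x = 0.
Proof.
move=> hx; rewrite /theta_of big_nat_cond big1// => k; rewrite andbT => /andP[k1 kN].
case: ifPn => // /andP[xk xk1]; exfalso; move/negP: hx; apply; apply/andP; split.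
  by apply: le_lt_trans xk; rewrite -[leLHS](grid1 N) grid_le.
apply: (le_trans xk1); rewrite -[leRHS](gridN N) ?grid_le//.
exact: (leq_ltn_trans k1 kN).
Qed.

Lemma theta_of_bin N x : (1 < N)%N -> bl < x <= bh -> exists k : nat,
  [/\ (0 < k < N)%N, grid bl bh N k < x <= grid bl bh N k.+1 &
      forall s, theta_of bl bh N s x = s (N - 1 + k)%N + s k * x].
Proof.
move=> N1 /andP[blx xbh].
pose Pr k := (0 < k)%N && (x <= grid bl bh N k.+1).
have exP : exists k, Pr k.
  by exists N.-1; rewrite /Pr prednK ?(ltn_trans _ N1)// gridN// xbh andbT -ltnS prednK// ltnW.
case: (ex_minnP exP) => k /andP[k0 xk] kmin; exists k.
have kN : (k < N)%N.
  have : Pr N.-1 by rewrite /Pr prednK ?(ltn_trans _ N1)// gridN// xbh andbT -ltnS prednK// ltnW.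
  by move=> /kmin; rewrite -ltnS prednK// ltnW.
have gk : grid bl bh N k < x.
  case: k k0 xk kmin kN => // -[|k] _ xk kmin kN; first by rewrite grid1.
  rewrite ltNge; apply/negP => h.
  by have := kmin k.+1; rewrite /Pr/= h => /(_ isT); rewrite ltnn.
split; [by rewrite k0|by rewrite gk xk|move=> s].
rewrite /theta_of (bigD1_seq k) ?iota_uniq ?mem_index_iota ?k0//= gk xk/= big1_seq ?addr0//.
move=> j /andP[jk _]; case: ifPn => // /andP[jx xj]; exfalso.
case: (ltngtP j k) jk => // [jk|kj] _.
  by have := lt_le_trans gk xj; rewrite ltNge grid_le.
by have := lt_le_trans jx xk; rewrite ltNge grid_le.
Qed.

Lemma measurable_theta_of N s : measurable_fun setT (theta_of bl bh N s).
Proof.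
apply: measurable_sum => k; apply: measurable_fun_ifT => //.
  by apply: measurable_and; [exact: measurable_fun_ltr|exact: measurable_fun_ler].
by apply: measurable_funD => //; exact: measurable_funM.
Qed.

Lemma theta_of_le1 N s : (N <= 1)%N -> theta_of bl bh N s = fun=> 0.
Proof. by move=> N1; apply/funext => x; rewrite /theta_of big_geq. Qed.

(** Within a bin the difference is at most h (1 + bh). As both functions vanish for x <= bl,
    dividing by bl gives the bound proportional to x required by the comparison of densities, with a
    constant independent of N. *)
Lemma theta_of_diff N s s' h x : (forall i, (i < prior_dim N)%N -> `|s i - s' i| <= h) ->
  0 < x -> `|theta_of bl bh N s x - theta_of bl bh N s' x| <= h * (1 + bh) / bl * x.
Proof.
move=> hs x0.
have h0 : 0 <= h.
  by apply: le_trans (normr_ge0 _) (hs 0%N _); rewrite /prior_dim.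
have bh0 : 0 < bh by apply: lt_trans blh.
have [/andP[blx xbh]|hx] := boolP (bl < x <= bh); last first.
  by rewrite !theta_of_out// subrr normr0 mulr_ge0 ?(ltW x0)// divr_ge0 ?(ltW bl0)// mulr_ge0// addr_ge0// ltW.
apply: (@le_trans _ _ (h * (1 + bh))); last first.
  by rewrite -mulrA ler_peMr ?mulr_ge0 ?addr_ge0 ?(ltW bh0)// ler_pdivlMl// mulr1 ltW.
have [N1|N1] := leqP N 1.
  by rewrite !theta_of_le1// subrr normr0 mulr_ge0 ?addr_ge0 ?(ltW bh0).
have [|k [/andP[k0 kN] _ hk]] := theta_of_bin N x N1; first by rewrite blx.
(* For N >= 1, [prior_dim N] equals N - 1 + N, so this is k < N. *)
rewrite !hk; have i1 : (N - 1 + k < prior_dim N)%N.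
  by rewrite /prior_dim mul2n -addnn addnA [(1 + _)%N]addnC subnK ?(ltnW N1)// addnC ltn_add2r.
have i2 : (k < prior_dim N)%N by apply: leq_ltn_trans i1; rewrite leq_addl.
rewrite (_ : _ - _ = (s (N - 1 + k)%N - s' (N - 1 + k)%N) + (s k - s' k) * x); last by ring.
rewrite mulrDr mulr1 (le_trans (ler_normD _ _))// lerD ?hs// normrM (gtr0_norm x0).
by rewrite ler_pM ?hs// ltW.
Qed.

Lemma theta_of_tame N s h : 0 <= h -> (forall i, (0 < i < prior_dim N)%N -> `|s i| <= h) ->
  tame bl (h * (1 + bh)) (theta_of bl bh N s).
Proof.
move=> h0 hs; have bh0 : 0 < bh by apply: lt_trans blh.
split.
- by apply: measurable_funTS; exact: measurable_theta_of.
- move=> x x0; have [/andP[blx xbh]|hx] := boolP (bl < x <= bh); last first.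
    by rewrite theta_of_out// normr0 mulr_ge0// addr_ge0// ltW.
  have [N1|N1] := leqP N 1.
    by rewrite theta_of_le1// normr0 mulr_ge0 ?addr_ge0 ?(ltW bh0).
  have [|k [/andP[k0 kN] _ hk]] := theta_of_bin N x N1; first by rewrite blx.
  have i1 : (N - 1 + k < prior_dim N)%N.
    by rewrite /prior_dim mul2n -addnn addnA [(1 + _)%N]addnC subnK ?(ltnW N1)// addnC ltn_add2r.
  have i2 : (k < prior_dim N)%N by apply: leq_ltn_trans i1; rewrite leq_addl.
  rewrite hk mulrDr mulr1 (le_trans (ler_normD _ _))// lerD//.
    by rewrite hs// i1 andbT addn_gt0 k0 orbT.
  by rewrite normrM (ger0_norm x0) ler_pM// hs// k0.
- by move=> x /andP[x0 xb]; rewrite theta_of_out// negb_and -leNgt (ltW xb).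
Qed.

End grid.

Section mesh.
Context {R : realType} (lo hi : nat -> R) (lohi : forall i, lo i < hi i) (k m : nat) (m0 : (0 < m)%N).

(** The indices 0 and m give the two ends of a side, so every mesh point lies in the box and is
    itself an admissible parameter. *)
Definition mesh_point (j : {ffun 'I_k -> 'I_m.+1}) (i : nat) : R :=
  if insub i is Some o then lo i + (j o)%:R / m%:R * (hi i - lo i) else 0.

Lemma mesh_point_box j : in_box lo hi k (mesh_point j).
Proof.
move=> i ik; rewrite /mesh_point insubT/=.
have c0 : 0 <= hi i - lo i by rewrite subr_ge0 ltW.
set q := _ / _; have q0 : 0 <= q by rewrite divr_ge0.
have q1 : q <= 1 by rewrite /q ler_pdivrMr ?ltr0n// mul1r ler_nat -ltnS.
by rewrite lerDl mulr_ge0//= -lerBrDl ler_piMl.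
Qed.

Lemma mesh_cover s : in_box lo hi k s ->
  exists j, forall i, (i < k)%N -> `|s i - mesh_point j i| <= (hi i - lo i) / m%:R.
Proof.
move=> hs; have mR : 0 < m%:R :> R by rewrite ltr0n.
have /fin_all_exists[j hj] : forall o : 'I_k, exists q : 'I_m.+1,
    `|s o - (lo o + q%:R / m%:R * (hi o - lo o))| <= (hi o - lo o) / m%:R.
  move=> o; have /andP[h1 h2] := hs o (ltn_ord o); have c0 := lohi o.
  pose y := (s o - lo o) / (hi o - lo o) * m%:R.
  have y0 : 0 <= y by rewrite mulr_ge0// divr_ge0 ?subr_ge0// ltW.
  have ym : y <= m%:R by rewrite ler_piMl// ler_pdivrMr ?subr_gt0// mul1r lerD2r.
  have /andP[t1 t2] := Num.Theory.truncn_itv y0.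
  have tm : (Num.truncn y < m.+1)%N by rewrite ltnS -(ler_nat R) (le_trans t1).
  exists (Ordinal tm) => /=.
  have -> : s o - (lo o + (Num.truncn y)%:R / m%:R * (hi o - lo o)) =
     (y - (Num.truncn y)%:R) * ((hi o - lo o) / m%:R).
    by rewrite /y; field; rewrite subr_eq0 !gt_eqF.
  rewrite normrM [X in _ * X]ger0_norm ?divr_ge0 ?subr_ge0 ?(ltW c0)//.
  rewrite ler_piMl ?divr_ge0 ?subr_ge0 ?(ltW c0)//.
  rewrite ger0_norm ?subr_ge0// lerBlDl natr1 ltW//.
exists [ffun o => j o] => i ik; rewrite /mesh_point insubT/= ffunE.
exact: (hj (Ordinal ik)).
Qed.

End mesh.

(** * Densities of the laws of the family *)

Lemma density_le_measure {R : realType} {P P' : {measure set R -> \bar R}} {f f' : R -> R}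
    (c : R) (A : set R) : has_density P f -> has_density P' f' -> measurable A -> 0 <= c ->
  (forall x, A x -> f x <= c * f' x) -> (P A <= c%:E * P' A)%E.
Proof.
move=> [mf f0 PE] [mf' f0' PE'] mA c0 h; rewrite PE// PE'//.
rewrite -ge0_integralZl//.
- apply: ge0_le_integral_nomeas => x Ax; first by rewrite lee_fin.
  by rewrite -EFinM lee_fin h.
- by apply: measurable_funTS; exact/measurable_EFinP.
- by move=> x _; rewrite lee_fin.
Qed.

Section levy_family.
Context {R : realType} (Q : R -> (R -> R) -> probability R R)
  (hQ : forall (a : R) (th : R -> R), 0 < a ->
     measurable_fun `[(0 : R), +oo[ th ->
     (exists M : R, forall x, 0 <= x -> `|th x| <= M) ->
     is_levy_law (vfun a th) (Q a th))
  {b M : R} (b0 : 0 < b).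
Local Notation mu := (@lebesgue_measure R).
Local Notation I g := (Rintegral lebesgue_measure setT g).
Local Notation K := (expR M).

Lemma levy_density a th : 0 < a -> tame b M th ->
  has_density (Q a th) (renewal_pdf (b := b) (expN_pos th) a).
Proof.
move=> a0 hth; have hk := tame_kernel _ hth; have [mth thM _] := hth.
apply: (levy_has_density _ _ (fun x => expR (- a * x) * expN_pos th x) (vfun a th)).
- exact: (renewal_pdf_steutel b0 (K := K)).
- exact: (renewal_pdf_mass b0 (K := K)).
- move=> x x0; rewrite /vfun /expN_pos x0 mulrA divff ?mul1r ?gt_eqF//.
  by rewrite -expRD; congr expR; ring.
- by apply: hQ => //; exists M.
Qed.

(** The renewal function grows polynomially and is beaten by exp(a x), so the density is bounded;
    this supplies the domination required by [le_dens]. *)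
Lemma levy_leb_bound a th : 0 < a -> tame b M th ->
  exists C : R, forall A, measurable A -> (Q a th A <= C%:E * mu A)%E.
Proof.
move=> a0 hth; have hk := tame_kernel _ hth; have [mf f0 PE] := levy_density a th a0 hth.
have G0 := laplace_gt0 b0 (expN_pos th) a hk a0.
have [p hp] := renewal_poly b K b0 _ hk; have [C hC] := poly_le_expR p a a0.
have C0 : 0 <= C.
  have := hC 0 (lexx 0); rewrite addr0 expr1n mulr0 expR0 mulr1; exact: le_trans.
exists (C / laplace (b := b) (expN_pos th) a) => A mA; rewrite PE//.
rewrite -integral_cst//; apply: ge0_le_integral_nomeas => x _; rewrite lee_fin//=.
rewrite /renewal_pdf ler_wpM2r ?invr_ge0 ?(ltW G0)//.
have [x0|x0] := leP x 0; first by rewrite (renewal_le0 b K)// mulr0.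
rewrite mulrC (le_trans (ler_wpM2r (expR_ge0 _) (le_trans (hp _ (ltW x0)) (hC _ (ltW x0)))))//.
by rewrite -mulrA -expRD -mulrDl subrr mul0r expR0 mulr1.
Qed.

Lemma levy_dens_density a th : 0 < a -> tame b M th -> has_density (Q a th) (dens (Q a th)).
Proof. by move=> a0 hth; exact: dens_has_density (levy_density a th a0 hth). Qed.

(** The factor exp(t x) changes the tilt from a to a - t, still positive, so the moment is a
    quotient of two Laplace transforms. *)
Lemma levy_expmoment a th t : 0 < t < a -> tame b M th ->
  exists m : R, (\int[Q a th]_x (expR (t * x))%:E = m%:E)%E.
Proof.
move=> /andP[t0 ta] hth; have hk := tame_kernel _ hth.
have a0 : 0 < a := lt_trans t0 ta.
have at0 : 0 < a - t by rewrite subr_gt0.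
have hd := levy_density a th a0 hth.
rewrite (ge0_integral_density hd); last 2 first.
{ apply/measurable_EFinP; apply: (measurableT_comp (@measurable_expR R)).
  exact: measurable_funM. }
{ by move=> x; rewrite lee_fin expR_ge0. }
have hi := integrableZr measurableT (laplace (b := b) (expN_pos th) a)^-1
  (integrable_tilt b0 (expN_pos th) (a - t) hk at0).
exists (I (fun x => expR (- (a - t) * x) * renewal b (expN_pos th) x *
  (laplace (b := b) (expN_pos th) a)^-1)).
rewrite -[RHS](EFin_Rintegral _ _ _ measurableT hi).
apply: eq_integral => x _; rewrite -EFinM /renewal_pdf mulrA mulrA -expRD.
by congr ((expR _ * _ * _)%:E); ring.
Qed.

Section close.
Context {th th' : R -> R} {a a' d : R} (hth : tame b M th) (hth' : tame b M th')
  (d0 : 0 <= d) (ad : 0 < a - 2 * d) (aa : `|a - a'| <= d)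
  (tt : forall x, 0 < x -> `|th x - th' x| <= d * x)
  {rho : R} (rho0 : 0 < rho) (rhoE : rho <= 1 - 4 * d * K / (a - 2 * d)).

Let a'0 : 0 < a'. Proof. move: aa ad d0; rewrite ler_norml => /andP[]; lra. Qed.
Let a0 : 0 < a. Proof. move: ad d0; lra. Qed.

Lemma levy_dens_upper x : dens (Q a' th') x <= rho^-1 * dens (Q (a - 2 * d) th) x.
Proof.
have [C hC] := levy_leb_bound (a - 2 * d) th ad hth.
apply: (le_dens _ _ C) => //; first by rewrite invr_ge0 ltW.
move=> m; apply: (density_le_measure _ _ (levy_density a' th' a'0 hth') (levy_density _ th ad hth)).
- exact: measurable_itv.
- by rewrite invr_ge0 ltW.
- move=> y _; exact: (renewal_pdf_upper b0 hth hth' d0 ad aa tt rho0 rhoE).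
Qed.

(** The exponent contains x + 1 instead of x because the windows around x reach up to x + 1, and the
    bound has to hold throughout each of them. *)
Lemma levy_dens_lower x :
  rho * expR (- (2 * d * (x + 1))) * dens (Q a th) x <= dens (Q a' th') x.
Proof.
have [C hC] := levy_leb_bound a' th' a'0 hth'.
pose w := rho * expR (- (2 * d * (x + 1))).
have w0 : 0 < w by rewrite mulr_gt0// expR_gt0.
rewrite -/w mulrC -ler_pdivlMr// mulrC.
apply: (le_dens _ _ C) => //; first by rewrite invr_ge0 ltW.
move=> m; apply: (density_le_measure _ _ (levy_density a th a0 hth) (levy_density a' th' a'0 hth')).
- exact: measurable_itv.
- by rewrite invr_ge0 ltW.
- move=> y; rewrite /window /= in_itv/= => /andP[_ yx].
  rewrite ler_pdivlMl//.
  apply: le_trans (renewal_pdf_lower b0 hth hth' d0 ad aa tt rho0 rhoE y).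
  apply: ler_wpM2r.
    by have [_ f0 _] := levy_density a th a0 hth; exact: f0.
  rewrite /w; apply: ler_wpM2l; first exact: ltW.
  rewrite ler_expR lerN2; apply: ler_wpM2l; first by rewrite mulr_ge0.
  by rewrite (le_trans yx)// lerD2l invf_le1 ?ltr0n// ler1n.
Qed.

End close.
End levy_family.

Lemma le0_fine_ratio {R : realType} (num den : \bar R) (tau low : R) : 0 < low ->
  (0 <= num <= tau%:E)%E -> (low%:E <= den)%E -> fine num / fine den <= tau / low.
Proof.
move=> low0 /andP[n0 nt] ld.
have t0 : 0 <= tau by rewrite -lee_fin (le_trans n0).
have fnum : num \is a fin_num.
  by rewrite ge0_fin_numE// (le_lt_trans nt)// ltry.
(* For an infinite denominator [fine] gives 0, and the quotient is then 0 by convention. *)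
case: den ld => [r||] //= ld; last by rewrite invr0 mulr0 divr_ge0// ltW.
have rl : low <= r by rewrite -lee_fin.
have r0 : 0 < r by apply: lt_le_trans rl.
apply: ler_pM; rewrite ?fine_ge0 ?invr_ge0 ?(ltW r0)//.
  by rewrite -lee_fin fineK.
by rewrite lef_pV2.
Qed.

(** * The posterior *)

Lemma sqrtr_prod {R : rcfType} n (y : 'I_n -> R) : (forall i, 0 <= y i) ->
  Num.sqrt (\prod_(i < n) y i) = \prod_(i < n) Num.sqrt (y i).
Proof.
move=> y0; have -> : \prod_(i < n) y i = (\prod_(i < n) Num.sqrt (y i)) ^+ 2.
  by rewrite -prodrXl; apply: eq_bigr => i _; rewrite sqr_sqrtr.
by rewrite sqrtr_sqr ger0_norm// prodr_ge0// => i _; exact: sqrtr_ge0.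
Qed.

Section posterior_bound.
Context {R : realType} (Q : R -> (R -> R) -> probability R R)
  (a0 : R) (th0 : R -> R) (al ah thb bl bh : R) (ha : al < ah) (hthb : 0 < thb)
  (N n : nat) (eps vareps t : R) (heps : 0 < eps) (hv : 0 < vareps) (t0 : 0 < t).
Local Notation P0 := (Q a0 th0).
Local Notation Qs s := (Q (s 0%N) (theta_of bl bh N s)).
Local Notation k := (prior_dim N).
Local Notation box := (in_box (prior_lo al thb) (prior_hi ah thb) k).
Context (J : finType) (P1 : J -> probability R R)
  (hd0 : has_density P0 (dens P0)) (hd1 : forall j, has_density (P1 j) (dens (P1 j)))
  (hds : forall s, box s -> has_density (Qs s) (dens (Qs s)))
  (cover : forall s, box s -> exists j, forall x,
     dens (Qs s) x <= (1 + t ^+ 2) * dens (P1 j) x).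
Context (l r : nat -> R) (eta w D : R) (eta0 : 0 < eta) (w0 : 0 < w) (D0 : 0 <= D)
  (hlr : forall i, (i < k)%N -> [/\ prior_lo al thb i <= l i, l i < r i,
     r i <= prior_hi ah thb i &
     eta * (prior_hi ah thb i - prior_lo al thb i) <= r i - l i])
  (hlow : forall s, in_box l r k s -> forall x,
     w * expR (- (D * (x + 1))) * dens P0 x <= dens (Qs s) x).
Context (tau m B : R) (htau : 0 < tau)
  (hm : (\int[P0]_x (expR (tau * x))%:E <= m%:E)%E).

Let lik (z s : nat -> R) : R := \prod_(i < n) (dens (Qs s) (z i) / dens P0 (z i)).

Let lik_ge0 z s : 0 <= lik z s.
Proof. by apply: prodr_ge0 => i _; rewrite divr_ge0// dens_ge0. Qed.

(** Only a bracket containing a law at distance more than [eps] from the truth has a small affinity;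
    the others never occur in the numerator of the posterior. *)
Let bad j := exists2 s, box s & eps < hellinger P0 (Qs s) /\
  forall x, dens (Qs s) x <= (1 + t ^+ 2) * dens (P1 j) x.

Let X (z : nat -> R) j := \prod_(i < n) ((1 + t ^+ 2) * dens (P1 j) (z i) / dens P0 (z i)).

(** The likelihood guaranteed on the sub-box when the truth has positive density at the sample and
    the sample mean is at most [B]; [low] weights it by the prior mass of the sub-box. *)
Let v := (w * expR (- (D * (B + 1)))) ^+ n.
Let low := v * eta ^+ k.

Let low_gt0 : 0 < low.
Proof. by rewrite mulr_gt0// exprn_gt0// mulr_gt0// expR_gt0. Qed.

Let num_le z (c : R) : 0 <= c -> (forall s, box s -> eps < hellinger P0 (Qs s) -> lik z s <= c) ->
  (0 <= iter_int (prior_int al ah thb) k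
      (fun s => ((if eps < hellinger P0 (Qs s) then 1 else 0) * lik z s)%:E) <= c%:E)%E.
Proof.
move=> c0 h; apply: prior_iter_bounds => // s hs; rewrite !lee_fin.
case: ifPn => [e|_]; last by rewrite mul0r lexx.
by rewrite mul1r lik_ge0 h.
Qed.

Let den_ge (z : nat -> R) : (forall i : 'I_n, 0 < dens P0 (z i)) -> \sum_(i < n) z i <= B * n%:R ->
  (low%:E <= iter_int (prior_int al ah thb) k (fun s => (lik z s)%:E))%E.
Proof.
move=> z0 zB; apply: (prior_iter_ge al ah thb ha hthb k _ l r).
- by rewrite exprn_ge0// mulr_ge0 ?expR_ge0// ltW.
- exact: ltW.
- exact: hlr.
- by move=> s; rewrite lee_fin.
- move=> s hs; rewrite lee_fin.
  apply: (@le_trans _ _ (\prod_(i < n) (w * expR (- (D * (z i + 1)))))).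
    rewrite big_split/= prodr_const card_ord /v exprMn.
    apply: ler_wpM2l; first by rewrite exprn_ge0// ltW.
    rewrite -expR_sum -expRM_natl ler_expR sumrN -mulr_sumr big_split/= sumr_const card_ord.
    rewrite mulrN lerN2 mulrCA; apply: ler_wpM2l => //.
    by rewrite mulrDr mulr1 lerD// mulrC.
  apply: ler_prod => i _; rewrite mulr_ge0 ?expR_ge0 ?(ltW w0)//=.
  by rewrite ler_pdivlMr// hlow.
Qed.

(** If every bad bracket had ratio at most vareps * low, so would every likelihood in the numerator;
    as the denominator is at least [low], the posterior could not exceed [vareps]. *)
Let bad_witness (z : nat -> R) : vareps < posterior Q a0 th0 al ah thb bl bh N n eps z ->
  \sum_(i < n) z i <= B * n%:R -> exists2 j, bad j & vareps * low < X z j.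
Proof.
move=> hpost zB; apply: contrapT => hno.
have XL j : bad j -> X z j <= vareps * low.
  by move=> bj; rewrite leNgt; apply/negP => hX; apply: hno; exists j.
have hvl : 0 <= vareps * low := ltW (mulr_gt0 hv low_gt0).
have likle s : box s -> eps < hellinger P0 (Qs s) -> lik z s <= vareps * low.
  move=> hs he; have [j hj] := cover s hs.
  apply: (@le_trans _ _ (X z j)); last by apply: XL; exists s.
  apply: ler_prod => i _; rewrite divr_ge0 ?dens_ge0//=.
  by rewrite ler_wpM2r ?invr_ge0 ?dens_ge0.
have hnum := num_le z _ hvl likle.
move: hpost; apply/negP; rewrite -leNgt.
(* Where [dens P0] vanishes, the likelihood ratio is [_ / 0 = 0]. *)
have [[i zi]|zpos] := pselect (exists i : 'I_n, dens P0 (z i) = 0).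
  have lik0 s : lik z s = 0 by rewrite /lik (bigD1 i)//= zi invr0 mulr0 mul0r.
  have /andP[n0 n1] := num_le z 0 (lexx 0) (fun s _ _ => eq_ind_r (fun y => y <= 0) (lexx 0) (lik0 s)).
  rewrite /posterior.
  set num := iter_int _ _ _; have -> : num = 0%E by apply/eqP; rewrite eq_le n0 n1.
  by rewrite mul0r ltW.
have zgt0 (i : 'I_n) : 0 < dens P0 (z i).
  by rewrite lt_neqAle dens_ge0 andbT eq_sym; apply/eqP => zi; apply: zpos; exists i.
have := le0_fine_ratio _ _ _ _ low_gt0 hnum (den_ge z zgt0 zB).
by rewrite mulfK// gt_eqF.
Qed.

(* [Some j] accounts for the bracket [j], and [None] for the samples of mean above [B]. *)
Let f (o : option J) (x : R) : R :=
  if o is Some j then (if `[< bad j >] then affinity_fun P0 (P1 j) t x else 0)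
  else expR (tau * x - tau * B).

Let e (o : option J) : R :=
  if o is Some j then expR (t - eps ^+ 2) else m * expR (- (tau * B)).

Let c (o : option J) : R := if o is Some j then (Num.sqrt (vareps * low))^-1 else 1.

(** Markov's inequality, term by term. For a bad bracket it is applied to the square root of the
    ratio: the ratio itself has mean at most 1 + t^2 per observation, which gives no decay, while
    the root has the affinity as mean. For a large sample mean it is applied to the exponential of
    tau times the sum of the z i - B. *)
Lemma posterior_sample_bound :
  (sample_prob P0 n (fun z => (vareps < posterior Q a0 th0 al ah thb bl bh N n eps z)%R) <=
   ((m * expR (- (tau * B))) ^+ n +
     #|J|%:R * ((Num.sqrt (vareps * low))^-1 * expR (t - eps ^+ 2) ^+ n))%:E)%E.
Proof.
have hvl : 0 < vareps * low by rewrite mulr_gt0.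
pose js := None :: [seq Some j | j <- enum J].
have f0 o x : 0 <= f o x.
  by case: o => [j|] /=; [case: ifP => // _; exact: sqrtr_ge0|exact: expR_ge0].
have mf o : measurable_fun setT (f o).
  case: o => [j|] /=; last first.
    have h : measurable_fun setT (fun x : R => tau * x - tau * B).
      by apply: measurable_funB => //; exact: measurable_funM.
    exact: (measurableT_comp (@measurable_expR R) h).
  by rewrite /f; case: `[< bad j >] => //; exact: measurable_affinity_fun.
have fe o : (\int[P0]_x (f o x)%:E <= (e o)%:E)%E.
  case: o => [j|] /=.
    have [[s hs [he hj]]|_] := asboolP (bad j); last by rewrite integral0 lee_fin expR_ge0.
    apply: (le_trans (affinity_le P0 (Qs s) (P1 j) t t0 hd0 (hds s hs) (hd1 j) eps heps he hj)).
    by rewrite lee_fin; have := expR_ge1Dx (t - eps ^+ 2); lra.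
  under eq_integral do rewrite expRD EFinM.
{ rewrite ge0_integralZr//.
  - by rewrite EFinM lee_wpmul2r// lee_fin expR_ge0.
  - apply/measurable_EFinP; apply: (measurableT_comp (@measurable_expR R)).
    exact: measurable_funM. }
have c0 o : 0 <= c o by case: o => [j|] //=; rewrite invr_ge0 sqrtr_ge0.
have := sample_prob_le P0 n (fun z => vareps < posterior Q a0 th0 al ah thb bl bh N n eps z)
  _ js c e f f0 mf fe c0.
rewrite /js big_cons big_map /= mul1r => h.
have -> : #|J|%:R * ((Num.sqrt (vareps * low))^-1 * expR (t - eps ^+ 2) ^+ n) =
    \sum_(j <- enum J) (Num.sqrt (vareps * low))^-1 * expR (t - eps ^+ 2) ^+ n.
  by rewrite big_enum/= sumr_const mulr_natl.
apply: h => z hz; rewrite big_cons big_map /= mul1r.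
have p0 j : 0 <= (Num.sqrt (vareps * low))^-1 * \prod_(i < n) f (Some j) (z i).
  by rewrite mulr_ge0 ?invr_ge0 ?sqrtr_ge0// prodr_ge0.
have [zB|Bz] := leP (\sum_(i < n) z i) (B * n%:R).
  have [j bj hj] := bad_witness z hz zB.
  rewrite ler_wpDl//; first by apply: prodr_ge0 => i _; exact: expR_ge0.
  rewrite (bigD1_seq j) ?enum_uniq ?mem_enum//=.
  rewrite ler_wpDr//; first by apply: sumr_ge0 => i _; exact: p0.
  rewrite asboolT// mulrC ler_pdivlMr ?sqrtr_gt0// mul1r.
  rewrite -sqrtr_prod; first by rewrite ler_wsqrtr// ltW.
  by move=> i; rewrite !mulr_ge0 ?invr_ge0 ?dens_ge0// addr_ge0// sqr_ge0.
rewrite ler_wpDr//; first by apply: sumr_ge0 => i _; exact: p0.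
rewrite -expR_sum -expR0 ler_expR sumrB -mulr_sumr sumr_const card_ord -mulr_natl.
by rewrite subr_ge0 mulrCA ler_wpM2l ?ltW// mulrC.
Qed.

End posterior_bound.

(** * Hölder moduli and the balance of exponents *)

Section holder.
Context {R : realType} (L lam : R) (hL : 0 < L) (hlam : 0 < lam).

Lemma holder_small (e : R) : 0 < e ->
  exists2 del : R, 0 < del & forall r, 0 <= r <= del -> L * r `^ lam <= e.
Proof.
move=> e0; exists ((e / L) `^ lam^-1); first by rewrite powR_gt0 ?divr_gt0.
move=> r /andP[r0 rd]; rewrite mulrC -ler_pdivlMr//.
rewrite (_ : e / L = ((e / L) `^ lam^-1) `^ lam).
  by apply: ge0_ler_powR => //; rewrite ?nnegrE ?powR_ge0// ltW.
by rewrite -powRrM mulVf ?gt_eqF// powRr1// divr_ge0// ltW.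
Qed.

Lemma holder_measurable (f : R -> R) :
  (forall x y, 0 <= x -> 0 <= y -> `|f x - f y| <= L * `|x - y| `^ lam) ->
  measurable_fun `[(0 : R), +oo[ f.
Proof.
(* The Hölder bound is assumed on the half-line only; composing with the maximum with 0 gives a
   function continuous on the whole line that agrees with [f] there. *)
move=> hf; pose g x := f (Num.max x 0).
have cg : continuous g.
  move=> x; apply/cvgrPdist_le => e e0.
  have [del del0 hdel] := holder_small e e0.
  exists del => //= y xy; rewrite /g.
  apply: (le_trans (hf _ _ _ _)); rewrite ?le_max ?lexx ?orbT//.
  apply: hdel; rewrite normr_ge0/=; apply: le_trans (ltW xy).
  rewrite /Num.max; case: ltP => x0; case: ltP => y0; rewrite ?subrr ?normr0//;
    [rewrite sub0r normrN (ger0_norm y0) distrC ger0_norm; lra|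
     rewrite subr0 (ger0_norm x0) ger0_norm; lra].
have mg : measurable_fun setT g by exact: continuous_measurable_fun.
apply: (eq_measurable_fun g); last exact: measurable_funTS.
by move=> x; rewrite inE/= in_itv/= andbT /g => x0; rewrite max_l.
Qed.

End holder.

Lemma sqrtr_ge_id {R : rcfType} (y : R) : 0 <= y <= 1 -> y <= Num.sqrt y.
Proof.
move=> /andP[y0 y1]; rewrite -{1}(sqr_sqrtr y0) expr2 ler_piMl ?sqrtr_ge0//.
by rewrite -sqrtr1 ler_wsqrtr.
Qed.

(** Balance of exponents, in units of n eps^2: the affinity yields 1/2, the square root of [V] costs
    1/4, and the number of brackets together with the prior mass costs 1/8, leaving 1/8. The root of
    [eta ^+ k] is bounded below by [eta ^+ k] itself, as eta <= 1. *)
Lemma posterior_rate {R : realType} (vareps eta V eps : R) (mm n k N : nat) :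
  0 < vareps -> 0 < eta <= 1 -> (0 < mm)%N -> expR (- (n%:R * (eps ^+ 2 / 2))) <= V ->
  (k <= 2 * N)%N -> 2 * N%:R * ln (mm%:R / eta) <= n%:R * (eps ^+ 2 / 8) ->
  (mm ^ k)%:R * ((Num.sqrt (vareps * (V * eta ^+ k)))^-1 * expR (- (eps ^+ 2 / 2)) ^+ n)
   <= (Num.sqrt vareps)^-1 * expR (- (n%:R * (eps ^+ 2 / 8))).
Proof.
move=> v0 /andP[eta0 eta1] mm0 hV kN hN.
have sv0 : 0 < Num.sqrt vareps by rewrite sqrtr_gt0.
have ek0 : 0 < eta ^+ k by rewrite exprn_gt0.
pose W := expR (- (n%:R * (eps ^+ 2 / 4))).
have W0 : 0 < W by exact: expR_gt0.
have V0 : 0 < V by apply: lt_le_trans hV; exact: expR_gt0.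
have sV : W <= Num.sqrt V.
  rewrite -(ler_pXn2r (n := 2))// ?nnegrE ?sqrtr_ge0 ?(ltW W0)//.
  rewrite sqr_sqrtr ?(ltW V0)// -expRM_natl; apply: le_trans hV.
  by rewrite ler_expR; lra.
have low : Num.sqrt vareps * (W * eta ^+ k) <= Num.sqrt (vareps * (V * eta ^+ k)).
  rewrite sqrtrM ?(ltW v0)// ler_wpM2l ?sqrtr_ge0//.
  rewrite sqrtrM ?(ltW V0)// ler_pM ?(ltW W0) ?(ltW ek0)//.
  by apply: sqrtr_ge_id; rewrite (ltW ek0) exprn_ile1// ltW.
have low0 : 0 < Num.sqrt vareps * (W * eta ^+ k) by rewrite !mulr_gt0.
have h1 : (Num.sqrt (vareps * (V * eta ^+ k)))^-1 <= (Num.sqrt vareps * (W * eta ^+ k))^-1.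
  by rewrite lef_pV2 ?posrE// (lt_le_trans low0).
have h2 : (mm ^ k)%:R * (eta ^+ k)^-1 <= expR (n%:R * (eps ^+ 2 / 8)).
  have q0 : 0 < mm%:R / eta by rewrite divr_gt0// ltr0n.
  have q1 : 0 <= ln (mm%:R / eta).
    apply: ln_ge0; rewrite ler_pdivlMr// mul1r (le_trans eta1)//.
    by rewrite ler1n.
  rewrite natrX -exprVn -exprMn -[X in X ^+ k](lnK q0) -expRM_natl ler_expR.
  apply: le_trans hN; rewrite ler_wpM2r//.
  by rewrite -natrM ler_nat.
apply: (@le_trans _ _ ((mm ^ k)%:R * ((Num.sqrt vareps * (W * eta ^+ k))^-1 * expR (- (eps ^+ 2 / 2)) ^+ n))).
  by rewrite ler_wpM2l// ler_wpM2r// exprn_ge0// expR_ge0.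
rewrite !invfM [leLHS](_ : _ = (Num.sqrt vareps)^-1 * (((mm ^ k)%:R * (eta ^+ k)^-1) *
   (W^-1 * expR (- (eps ^+ 2 / 2)) ^+ n))); last by ring.
rewrite ler_wpM2l ?invr_ge0 ?(ltW sv0)//.
rewrite -expRM_natl /W -expRN opprK -expRD.
apply: (le_trans (ler_wpM2r (expR_ge0 _) h2)).
by rewrite -expRD ler_expR; lra.
Qed.

Lemma exists_small3 {R : realFieldType} (a b c : R) : 0 < a -> 0 < b -> 0 < c ->
  exists2 e, 0 < e <= 1 & [/\ e <= a, e <= b & e <= c].
Proof.
move=> a0 b0 c0; exists (Num.min (Num.min 1 a) (Num.min b c)).
  by rewrite !lt_min ltr01 a0 b0 c0/= !ge_min lexx.
by rewrite !ge_min !lexx !orbT.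
Qed.

Lemma cvg_expRN_nat {R : realType} (c : R) : 0 < c ->
  expR (- (n%:R * c)) @[n --> \oo] --> (0 : R).
Proof.
move=> c0; apply: (cvg_comp (fun n : nat => n%:R * c) (fun u => expR (- u)) _ (@cvgr_expR R)).
apply/cvgryPge => A; near=> n; rewrite -ler_pdivrMr//.
by near: n; exact: nbhs_infty_ger.
Unshelve. all: by end_near. Qed.

(** * Brackets over the prior box, and prior mass near the truth *)

Section prior_box.
Context {R : realType} {al ah thb bl bh : R} (hb : 0 < bl < bh) (ha : 0 < al < ah)
  (hthb : 0 < thb).
Local Notation M := (thb * (1 + bh)).
Local Notation box N := (in_box (prior_lo al thb) (prior_hi ah thb) (prior_dim N)).

Lemma box_alpha N s : box N s -> al <= s 0%N <= ah.
Proof. by move=> /(_ 0%N); apply. Qed.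

Lemma box_tame N s : box N s -> tame bl M (theta_of bl bh N s).
Proof.
move=> hs; apply: theta_of_tame => // [|i /andP[i0 ik]]; first exact: ltW.
by have := hs i ik; rewrite /prior_lo /prior_hi gtn_eqF// ler_norml.
Qed.

Lemma box_width i (h : R) (m : nat) : 0 < h -> (0 < m)%N ->
  (ah - al) + 2 * thb <= h * m%:R ->
  (prior_hi ah thb i - prior_lo al thb i) / m%:R <= h.
Proof.
move=> h0 m0 hw; rewrite ler_pdivrMr ?ltr0n//; apply: le_trans hw.
by rewrite /prior_hi /prior_lo; have h1 := hthb; case/andP: ha => _ h2; case: eqP => _; lra.
Qed.

(* A uniform mesh of the parameter box, of a size independent of [N] in each
   coordinate, provides finitely many upper brackets. *)
Lemma exists_brackets (Q : R -> (R -> R) -> probability R R)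
  (hQ : forall (a : R) (th : R -> R), 0 < a ->
     measurable_fun `[(0 : R), +oo[ th ->
     (exists M : R, forall x, 0 <= x -> `|th x| <= M) ->
     is_levy_law (vfun a th) (Q a th)) (t : R) : 0 < t ->
  exists2 m, (0 < m)%N & forall N, exists P1 : {ffun 'I_(prior_dim N) -> 'I_m.+1} -> probability R R,
    (forall j, has_density (P1 j) (dens (P1 j))) /\
    forall s, box N s -> exists j, forall x,
      dens (Q (s 0%N) (theta_of bl bh N s)) x <= (1 + t ^+ 2) * dens (P1 j) x.
Proof.
move=> t0; have [bl0 blh] := andP hb; have [al0 alh] := andP ha.
have bh0 : 0 < bh := lt_trans bl0 blh.
pose K := expR M; have K0 : 0 < K by exact: expR_gt0.
have K1 : 1 <= K.
  by rewrite /K -expR0 ler_expR mulr_ge0 ?(ltW hthb)// addr_ge0// ltW.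
have t20 : 0 < t ^+ 2 by rewrite exprn_gt0.
pose q := t ^+ 2 / (1 + t ^+ 2).
have q0 : 0 < q by rewrite divr_gt0// addr_gt0.
have q1 : q < 1 by rewrite /q ltr_pdivrMr ?addr_gt0// mul1r ltrDr.
have rhoE : (1 + t ^+ 2)^-1 = 1 - q by rewrite /q; field; rewrite lt0r_neq0// addr_gt0.
(* Since 4 d <= al, the shifted parameter is at least al / 2, so 4 d K divided by it is at most 8 d
   K / al = q; this gives [rho = 1 - q = (1 + t^2)^-1]. *)
pose d := al * q / (8 * K).
have d0 : 0 < d by rewrite divr_gt0// mulr_gt0.
have d4 : 4 * d <= al.
  rewrite /d mulrA ler_pdivrMr ?mulr_gt0//.
  have : al * q <= al by rewrite ler_piMr// ltW.
  have : al <= al * K by rewrite ler_peMr// ltW.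
  lra.
have d8 : 8 * d * K = al * q by rewrite /d; field; rewrite gt_eqF.
(* Mesh width for which [theta_of_diff] has slope exactly d; as h <= d, it also suits the coordinate
   alpha. *)
pose h := d * (bl / (1 + bh)).
have bb0 : 0 < bl / (1 + bh) by rewrite divr_gt0 ?addr_gt0.
have h0 : 0 < h by rewrite mulr_gt0.
have bb1 : bl / (1 + bh) <= 1.
  by rewrite ler_pdivrMr ?addr_gt0// mul1r (le_trans (ltW blh))// lerDr.
have hd : h <= d by rewrite ler_piMr ?(ltW d0).
have hd' : h * (1 + bh) / bl = d by rewrite /h; field; rewrite !gt_eqF// addr_gt0.
pose W := (ah - al) + 2 * thb.
have W0 : 0 <= W / h by rewrite divr_ge0 ?(ltW h0)// addr_ge0 ?mulr_ge0 ?(ltW hthb)// subr_ge0 ltW.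
(* [W] is the sum of the two possible side lengths, so one m serves every coordinate, whatever N
   is. *)
pose m := (Num.bound (W / h)).+1.
have mW : W <= h * m%:R.
  rewrite mulrC -ler_pdivrMr//; apply: (le_trans (ltW (archi_boundP W0))).
  by rewrite ler_nat.
have m0 : (0 < m)%N by [].
clearbody h m.
exists m => // N.
pose rep := mesh_point (prior_lo al thb) (prior_hi ah thb) (prior_dim N) m.
have lohi i : prior_lo al thb i < prior_hi ah thb i by exact: prior_lt.
have hrep j : box N (rep j) by exact: mesh_point_box.
have a2d j : 0 < rep j 0%N - 2 * d.
  by have /andP[h1 _] := box_alpha N _ (hrep j); lra.
exists (fun j => Q (rep j 0%N - 2 * d) (theta_of bl bh N (rep j))); split => [j|s hs].
  exact: (levy_dens_density Q hQ bl0 _ _ (a2d j) (box_tame N _ (hrep j))).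
have [j hj] := mesh_cover (prior_lo al thb) (prior_hi ah thb) lohi (prior_dim N) m m0 s hs.
exists j => x.
have hj' i : (i < prior_dim N)%N -> `|rep j i - s i| <= h.
  by move=> ik; rewrite distrC (le_trans (hj i ik))// box_width.
have rho0 : 0 < (1 + t ^+ 2)^-1 by rewrite invr_gt0 addr_gt0.
rewrite -[X in X * _]invrK.
apply: (levy_dens_upper Q hQ bl0 (box_tame N _ (hrep j)) (box_tame N _ hs) (ltW d0) (a2d j) _ _ rho0).
- by apply: (le_trans (hj' 0%N _)).
- move=> y y0; rewrite -hd'; exact: theta_of_diff.
- rewrite rhoE lerD2l lerN2 ler_pdivrMr//.
  have /andP[h1 _] := box_alpha N _ (hrep j).
  have : al * q <= q * (2 * (rep j 0%N - 2 * d)).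
    by rewrite mulrC ler_wpM2l ?(ltW q0)//; lra.
  rewrite -[expR _]/K -d8; move: (rep j 0%N) => r.
  clearbody K q d; lra.
Qed.

End prior_box.

(* A box of parameters close to the truth: its sides are the fraction [eta] of
   those of the prior box; slopes are near [0], intercepts near the values of
   [th0] at the left ends of the bins. *)
Definition sub_lo {R : realType} (al ah thb bl bh a0 : R) (th0 : R -> R) (eta : R)
    (N i : nat) : R :=
  if i == 0%N then Num.min a0 (ah - eta * (ah - al))
  else if (i < N)%N then - (eta * thb) else th0 (grid bl bh N (i - (N - 1))) - eta * thb.

Definition sub_hi {R : realType} (al ah thb bl bh a0 : R) (th0 : R -> R) (eta : R)
    (N i : nat) : R :=
  sub_lo al ah thb bl bh a0 th0 eta N i + eta * (prior_hi ah thb i - prior_lo al thb i).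

Section prior_mass.
Context {R : realType} {al ah thb bl bh : R} (hb : 0 < bl < bh) (ha : 0 < al < ah)
  (hthb : 0 < thb) (Q : R -> (R -> R) -> probability R R)
  (hQ : forall (a : R) (th : R -> R), 0 < a ->
     measurable_fun `[(0 : R), +oo[ th ->
     (exists M : R, forall x, 0 <= x -> `|th x| <= M) ->
     is_levy_law (vfun a th) (Q a th))
  (L lam a0 : R) (th0 : R -> R) (hL : 0 < L) (hlam : 0 < lam) (ha0 : al <= a0 <= ah)
  (hsupp : forall x, 0 <= x -> (x < bl \/ bh < x) -> th0 x = 0)
  (c : R) (cthb : c < thb) (hc : forall x, 0 <= x -> `|th0 x| <= c)
  (hhold : forall x y, 0 <= x -> 0 <= y -> `|th0 x - th0 y| <= L * `|x - y| `^ lam).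
Local Notation M := (thb * (1 + bh)).
Local Notation lo := (sub_lo al ah thb bl bh a0 th0).
Local Notation hi := (sub_hi al ah thb bl bh a0 th0).

Let bl0 : 0 < bl. Proof. by case/andP: hb. Qed.
Let blh : bl < bh. Proof. by case/andP: hb. Qed.
Let bh0 : 0 < bh. Proof. exact: lt_trans blh. Qed.

Lemma true_tame : tame bl M th0.
Proof.
split; first exact: (holder_measurable L lam).
- move=> x x0; apply: (le_trans (hc x x0)); apply: (le_trans (ltW cthb)).
  by rewrite ler_peMr ?(ltW hthb)// lerDl ltW.
- by move=> x /andP[x0 xb]; apply: hsupp; [exact: ltW|left].
Qed.

Let grid_ge0 N k : (0 < k)%N -> 0 <= grid bl bh N k.
Proof.
by move=> k0; apply: (le_trans (ltW bl0)); rewrite -[leLHS](grid1 bl bh N) grid_le.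
Qed.

(** The strict inequality between the supremum of [|th0|] and [thb] leaves the margin thb - c, into
    which the intervals for the intercepts fit. *)
Lemma sub_box_in eta N i : 0 < eta <= 1 -> eta * thb <= thb - c ->
  [/\ prior_lo al thb i <= lo eta N i, lo eta N i < hi eta N i,
   hi eta N i <= prior_hi ah thb i &
   eta * (prior_hi ah thb i - prior_lo al thb i) <= hi eta N i - lo eta N i].
Proof.
move=> /andP[eta0 eta1] ec; have [al0 alh] := andP ha; have [ala aah] := andP ha0.
have ht := hthb.
have wid : 0 < eta * (prior_hi ah thb i - prior_lo al thb i).
  by rewrite mulr_gt0// subr_gt0 prior_lt.
split; last by rewrite /sub_hi [leRHS]addrAC subrr add0r.
- rewrite /prior_lo /sub_lo; case: eqP => [_|i0].
    rewrite le_min ala/= lerBrDr -lerBrDl.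
    by rewrite ler_piMl// subr_ge0 ltW.
  case: ifPn => iN; first by rewrite lerN2 ler_piMl// ltW.
  have : `|th0 (grid bl bh N (i - (N - 1)))| <= c.
    apply: hc; apply: grid_ge0; rewrite subn_gt0.
    (* The claim is N - 1 < i; with truncated subtraction the case N = 0 relies on i being
       nonzero. *)
    by move: iN i0; rewrite -leqNgt; case: (N) => [|[|N']] //=; case: (i).
  rewrite ler_norml => /andP[h1 h2]; lra.
- by rewrite /sub_hi ltrDl.
- rewrite /sub_hi /prior_lo /prior_hi /sub_lo; case: eqP => [_|i0].
    by rewrite -lerBrDr ge_min lexx orbT.
  case: ifPn => iN.
    have : eta * thb <= thb by rewrite ler_piMl// ltW.
    lra.
  have : `|th0 (grid bl bh N (i - (N - 1)))| <= c.
    apply: hc; apply: grid_ge0; rewrite subn_gt0.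
    by move: iN i0; rewrite -leqNgt; case: (N) => [|[|N']] //=; case: (i).
  rewrite ler_norml => /andP[h1 h2]; lra.
Qed.

(** On a bin the error is at most the oscillation of [th0] over the bin, the error of the intercept
    at its left end, and the slope term. The first is at most d bl / 2, the other two together at
    most eta thb (1 + bh) <= d bl / 2, and bl < x. *)
Lemma sub_box_close eta N s d : 0 < eta <= 1 -> 0 < d -> (1 < N)%N ->
  eta * thb * (1 + bh) <= d * bl / 2 -> eta * (ah - al) <= d ->
  (bh - bl) / (N - 1)%:R <= bl ->
  (forall r, 0 <= r <= (bh - bl) / (N - 1)%:R -> L * r `^ lam <= d * bl / 2) ->
  in_box (lo eta N) (hi eta N) (prior_dim N) s ->
  `|a0 - s 0%N| <= d /\ forall x, 0 < x -> `|th0 x - theta_of bl bh N s x| <= d * x.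
Proof.
move=> /andP[eta0 eta1] d0 N1 he ha1 hN hr hs; have [al0 alh] := andP ha.
have [ala aah] := andP ha0; have ht := hthb.
set gap := (bh - bl) / (N - 1)%:R in hN hr *.
have gap0 : 0 <= gap by rewrite divr_ge0// subr_ge0 ltW.
have dbl0 : 0 <= d * bl / 2 by rewrite divr_ge0// mulr_ge0// ltW.
split.
  (* The interval for alpha contains [a0]: it starts there unless it would then pass [ah], in which
     case it ends at [ah]. Its length is at most d. *)
  have /andP[] := hs 0%N isT.
  rewrite /sub_hi /sub_lo /prior_lo /prior_hi /= => h1 h2; rewrite ler_norml.
  apply/andP; split; move: h1 h2; rewrite /Num.min; case: ltP; lra.
move=> x x0; have dx y : bl <= y -> d * bl <= d * y by move=> ?; rewrite ler_wpM2l// ltW.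
have [/andP[blx xbh]|hx] := boolP (bl < x <= bh); last first.
  rewrite theta_of_out// subr0.
  have [xbl|xbl] := eqVneq x bl; last first.
    rewrite hsupp ?(ltW x0)// ?normr0 ?mulr_ge0 ?(ltW d0) ?(ltW x0)//.
    move: hx; rewrite negb_and -leNgt -ltNge => /orP[xb|]; last by right.
    by left; rewrite lt_neqAle xbl xb.
  (* At the point bl, where [hsupp] is silent, [th0] is compared with its value at bl - gap, which
     vanishes; this is why the gap is required to be at most bl. *)
  rewrite xbl; apply: (@le_trans _ _ (d * bl / 2)); last first.
    by rewrite ler_pdivrMr// ler_peMr ?mulr_ge0 ?(ltW d0) ?(ltW bl0)// ler1n.
  have gap1 : 0 < gap by rewrite divr_gt0 ?subr_gt0// ltr0n subn_gt0.
  have e0 : th0 (bl - gap) = 0.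
    by apply: hsupp; [rewrite subr_ge0|left; rewrite gtrBl].
  rewrite -[th0 bl]subr0 -e0; apply: (le_trans (hhold _ _ (ltW bl0) _)); first by rewrite subr_ge0.
  by rewrite subKr; apply: hr; rewrite normr_ge0 ger0_norm/=.
apply: le_trans (dx _ (ltW blx)).
have [|k [/andP[k0 kN] /andP[gk xk] hk]] := theta_of_bin bl bh hb N x N1; first by rewrite blx.
rewrite hk.
have i1 : (N - 1 + k < prior_dim N)%N.
  by rewrite /prior_dim mul2n -addnn addnA [(1 + _)%N]addnC subnK ?(ltnW N1)// addnC ltn_add2r.
have i2 : (k < prior_dim N)%N by apply: leq_ltn_trans i1; rewrite leq_addl.
have h1 : `|s (N - 1 + k)%N - th0 (grid bl bh N k)| <= eta * thb.
  have := hs _ i1; rewrite /sub_hi /sub_lo /prior_lo /prior_hi addn_eq0 [k == 0%N]gtn_eqF// andbF.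
  rewrite ltnNge (_ : (N <= N - 1 + k)%N); last first.
    by rewrite -[X in (X <= _)%N](subnK (ltnW N1)) leq_add2l.
  rewrite addnC addnK/= => /andP[? ?]; rewrite ler_norml; apply/andP; split; lra.
have h2 : `|s k| <= eta * thb.
  have := hs _ i2; rewrite /sub_hi /sub_lo /prior_lo /prior_hi gtn_eqF// kN => /andP[? ?].
  by rewrite ler_norml; apply/andP; split; lra.
have h3 : `|th0 x - th0 (grid bl bh N k)| <= d * bl / 2.
  apply: (le_trans (hhold _ _ (ltW x0) (grid_ge0 N k k0))); apply: hr.
  rewrite normr_ge0 ger0_norm ?subr_ge0 ?(ltW gk)//=.
  by rewrite lerBlDl -gridS.
have h4 : `|s k * x| <= eta * thb * bh.
  by rewrite normrM (gtr0_norm x0) ler_pM// ltW.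
rewrite (_ : th0 x - _ = (th0 x - th0 (grid bl bh N k)) -
   (s (N - 1 + k)%N - th0 (grid bl bh N k)) - s k * x); last by ring.
apply: (le_trans (ler_normB _ _)); apply: (le_trans (lerD (ler_normB _ _) (lexx _))).
move: h1 h3 h4 he; move: `|s (N - 1 + k)%N - _| `|th0 x - _| `|s k * x| => u1 u2 u3; lra.
Qed.

End prior_mass.

(** * Choice of the constants and conclusion *)

Theorem theorem4p1 (R : realType)
    (Q : R -> (R -> R) -> probability R R)
    (hQ : forall (a : R) (th : R -> R), 0 < a ->
       measurable_fun `[(0 : R), +oo[ th ->
       (exists M : R, forall x, 0 <= x -> `|th x| <= M) ->
       is_levy_law (vfun a th) (Q a th))
    (bl bh al ah thb L lam : R)
    (hb : 0 < bl < bh) (ha : 0 < al < ah) (hthb : 0 < thb) (hL : 0 < L)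
    (hlam : 0 < lam <= 1)
    (a0 : R) (th0 : R -> R)
    (ha0 : al <= a0 <= ah)
    (hsupp : forall x, 0 <= x -> (x < bl \/ bh < x) -> th0 x = 0)
    (hsup : exists c : R, c < thb /\ forall x, 0 <= x -> `|th0 x| <= c)
    (hhold : forall x y, 0 <= x -> 0 <= y ->
       `|th0 x - th0 y| <= L * `|x - y| `^ lam)
    (N : nat -> nat)
    (hN1 : (fun n => (N n)%:R : R) @ \oo --> +oo)
    (hN2 : (fun n => (N n)%:R / n%:R : R) @ \oo --> 0)
    (eps vareps : R) (heps : 0 < eps) (hvareps : 0 < vareps) :
  (fun n => sample_prob (Q a0 th0) n
     (fun z => posterior Q a0 th0 al ah thb bl bh (N n) n eps z > vareps))
    @ \oo --> 0%E.
Proof.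
have [c [cthb hc]] := hsup; have [lam0 _] := andP hlam.
have [bl0 blh] := andP hb; have [al0 alh] := andP ha; have [ala aah] := andP ha0.
have a00 : 0 < a0 by exact: lt_le_trans ala.
have bh0 : 0 < bh by exact: lt_trans blh.
have e20 : 0 < eps ^+ 2 by rewrite exprn_gt0.
have htame := true_tame hb hthb L lam th0 hL lam0 hsupp c cthb hc hhold.
set M := thb * (1 + bh) in htame.
pose K := expR M; have K0 : 0 < K by exact: expR_gt0.
(* With this t, the affinity bound 1 - eps^2 + t is 1 - eps^2 / 2, hence at most exp(- eps^2 /
   2). *)
pose t := eps ^+ 2 / 2; have t0 : 0 < t by rewrite divr_gt0.
have [m m0 brackets] := exists_brackets hb ha hthb Q hQ t t0.
pose tau := a0 / 2; have tau0 : 0 < tau by rewrite divr_gt0.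
have tau1 : 0 < tau < a0 by rewrite tau0/= /tau ltr_pdivrMr// ltr_pMr// ltr1n.
have [mt hmt] := levy_expmoment Q hQ bl0 a0 th0 tau tau1 htame.
(* Then mt exp(- tau B) = mt exp(- mt) exp(- 1) <= exp(- 1), so the sample mean exceeds B with
   probability at most exp(- n). *)
pose B := (1 + `|mt|) / tau; have B0 : 0 < B by rewrite divr_gt0// ltr_pwDl.
have hmB : 0 <= mt * expR (- (tau * B)) <= expR (-1).
  have mt0 : 0 <= mt by rewrite -lee_fin -hmt; apply: integral_ge0 => x _; rewrite lee_fin expR_ge0.
  rewrite mulr_ge0 ?expR_ge0//= /B (mulrC tau) divfK ?gt_eqF// ger0_norm// opprD expRD.
  rewrite mulrCA ler_piMr ?expR_ge0// expRN ler_pdivrMr ?expR_gt0// mul1r.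
  by apply: le_trans (expR_ge1Dx mt); rewrite lerDr.
(* The exponent eps^2 / 2 allowed for the likelihood per observation is shared equally between [w]
   and the factor exp(- 2 d (B + 1)). *)
pose w := expR (- (eps ^+ 2 / 4)); have w0 : 0 < w by exact: expR_gt0.
have w1 : 0 < 1 - w by rewrite subr_gt0 /w -expR0 ltr_expR oppr_lt0 divr_gt0.
(* The third bound gives a0 - 2 d >= a0 / 2; the first then allows [w] as the ratio [rho] of the
   comparison, and the second keeps 2 d (B + 1) below eps^2 / 4. *)
have [d /andP[d0 _] [dK dB d4]] := exists_small3 (a0 * (1 - w) / (8 * K))
  (eps ^+ 2 / (8 * (B + 1))) (a0 / 4) ltac:(by rewrite divr_gt0 ?mulr_gt0)
  ltac:(by rewrite divr_gt0 ?mulr_gt0 ?addr_gt0) ltac:(by rewrite divr_gt0).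
have ad : 0 < a0 - 2 * d by lra.
have rhoE : w <= 1 - 4 * d * K / (a0 - 2 * d).
  rewrite lerBrDr -lerBrDl ler_pdivrMr//.
  move: dK; rewrite ler_pdivlMr ?mulr_gt0// => dK.
  have : (1 - w) * (2 * d) <= (1 - w) * (a0 / 2) by rewrite ler_wpM2l ?(ltW w1)//; lra.
  clearbody w K; lra.
have DB : 2 * d * (B + 1) <= eps ^+ 2 / 4.
  by move: dB; rewrite ler_pdivlMr ?mulr_gt0 ?addr_gt0// => dB; clearbody B; lra.
have ahl : 0 < ah - al by rewrite subr_gt0.
(* The three bounds keep the interval for alpha shorter than d, the slope and intercept errors below
   d bl / 2, and the sub-box inside the prior box. *)
have [eta eta01 [eta_al eta_thb eta_c]] := exists_small3 (d / (ah - al))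
  (d * bl / 2 / M) ((thb - c) / thb) ltac:(by rewrite divr_gt0)
  ltac:(by rewrite !divr_gt0 ?mulr_gt0 ?addr_gt0) ltac:(by rewrite divr_gt0 ?subr_gt0).
have eta0 : 0 < eta by case/andP: eta01.
have M0 : 0 < M by rewrite mulr_gt0 ?addr_gt0.
rewrite ler_pdivlMr// in eta_al; rewrite ler_pdivlMr// in eta_thb.
rewrite ler_pdivlMr// in eta_c.
have dbl0 : 0 < d * bl / 2 by rewrite !divr_gt0 ?mulr_gt0.
have [del del0 hdel] := holder_small L lam hL lam0 (d * bl / 2) dbl0.
(* Bins shorter than [del] control the oscillation of [th0]; bins shorter than bl are needed at the
   left end of the support. *)
pose g := Num.min bl del; have g0 : 0 < g by rewrite lt_min bl0.
pose lo := sub_lo al ah thb bl bh a0 th0 eta; pose hi := sub_hi al ah thb bl bh a0 th0 eta.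
have boxN n i : [/\ prior_lo al thb i <= lo (N n) i, lo (N n) i < hi (N n) i,
    hi (N n) i <= prior_hi ah thb i &
    eta * (prior_hi ah thb i - prior_lo al thb i) <= hi (N n) i - lo (N n) i].
  exact: (sub_box_in hb ha hthb a0 th0 ha0 c hc).
have in_prior n s : in_box (lo (N n)) (hi (N n)) (prior_dim (N n)) s ->
    in_box (prior_lo al thb) (prior_hi ah thb) (prior_dim (N n)) s.
  move=> hs i ik; have [h1 _ h2 _] := boxN n i; have /andP[h3 h4] := hs i ik.
  by rewrite (le_trans h1 h3) (le_trans h4 h2).
have lowN n : (1 < N n)%N -> (bh - bl) / (N n - 1)%:R <= g ->
  forall s, in_box (lo (N n)) (hi (N n)) (prior_dim (N n)) s ->
  forall x, w * expR (- (2 * d * (x + 1))) * dens (Q a0 th0) x <=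
     dens (Q (s 0%N) (theta_of bl bh (N n) s)) x.
  move=> N1 gapN s hs x; move: gapN; rewrite le_min => /andP[gap_bl gap_del].
  have [aa tt] : `|a0 - s 0%N| <= d /\
      forall x, 0 < x -> `|th0 x - theta_of bl bh (N n) s x| <= d * x.
    apply: (sub_box_close hb ha hthb L lam a0 th0 ha0 hsupp hhold eta (N n) s d) => //.
      by rewrite -mulrA.
    by move=> r /andP[r0 rg]; apply: hdel; rewrite r0 (le_trans rg).
  have hs' := box_tame hb hthb (N n) s (in_prior n s hs).
  exact: (levy_dens_lower Q hQ bl0 htame hs' (ltW d0) ad aa tt w0 rhoE).
have wB : expR (- (eps ^+ 2 / 2)) <= w * expR (- (2 * d * (B + 1))).
  rewrite /w -expRD ler_expR.
  by move: DB; move: (2 * d * (B + 1)) => u; clear; lra.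
have bound n : (0 < n)%N -> (1 < N n)%N -> (bh - bl) / (N n - 1)%:R <= g ->
  2 * (N n)%:R * ln (m.+1%:R / eta) <= n%:R * (eps ^+ 2 / 8) ->
  (sample_prob (Q a0 th0) n
     (fun z => (posterior Q a0 th0 al ah thb bl bh (N n) n eps z > vareps)%R) <=
   (expR (- (n%:R * 1)) + (Num.sqrt vareps)^-1 * expR (- (n%:R * (eps ^+ 2 / 8))))%:E)%E.
  move=> n0 N1 gapN rateN; have [P1 [hP1 cover]] := brackets (N n).
  have hd0 := levy_dens_density Q hQ bl0 a0 th0 a00 htame.
  have hds s : in_box (prior_lo al thb) (prior_hi ah thb) (prior_dim (N n)) s ->
      has_density (Q (s 0%N) (theta_of bl bh (N n) s)) (dens (Q (s 0%N) (theta_of bl bh (N n) s))).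
    move=> hs; apply: (levy_dens_density Q hQ bl0 _ _ _ (box_tame hb hthb (N n) s hs)).
    by have /andP[h _] := box_alpha (N n) s hs; exact: lt_le_trans h.
  have D0 : 0 <= 2 * d by rewrite mulr_ge0 ?(ltW d0).
  have hmt' : (\int[Q a0 th0]_x (expR (tau * x))%:E <= mt%:E)%E by rewrite hmt.
  apply: le_trans (posterior_sample_bound Q a0 th0 al ah thb bl bh alh hthb (N n) n eps
    vareps t heps hvareps t0 _ P1 hd0 hP1 hds cover (lo (N n)) (hi (N n)) eta w (2 * d) eta0 w0
    D0 (fun i _ => boxN n i) (lowN n N1 gapN) tau mt B tau0 hmt') _.
  rewrite lee_fin; apply: lerD.
    have /andP[h1 h2] := hmB.
    by rewrite -(mulrN n%:R) expRM_natl lerXn2r// nnegrE ?expR_ge0.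
  rewrite card_ffun !card_ord (_ : t - eps ^+ 2 = - (eps ^+ 2 / 2)); last first.
    by rewrite /t; clear; lra.
  apply: (posterior_rate _ _ _ _ _ _ _ (N n)) => //.
    rewrite -(mulrN n%:R) expRM_natl; apply: lerXn2r; last exact: wB.
      by rewrite nnegrE expR_ge0.
    by rewrite nnegrE; apply: mulr_ge0; [exact: ltW|exact: expR_ge0].
  by move: (ltnW N1); rewrite /prior_dim; clear; lia.
pose l := ln (m.+1%:R / eta).
apply: (@squeeze_cvge _ _ _ _ (cst 0%E) _ (fun n : nat => 
   (expR (- (n%:R * 1)) + (Num.sqrt vareps)^-1 * expR (- (n%:R * (eps ^+ 2 / 8))))%:E)).
- near=> n; rewrite sample_prob_ge0/=; apply: bound.
  + by near: n; exact: nbhs_infty_gt.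
  + by rewrite -(ltr_nat R); near: n; move/cvgryPgt : hN1; apply.
  + have hq : (bh - bl) / g + 1 < (N n)%:R.
      by near: n; move/cvgryPgt : hN1; apply.
    have N1 : (1 < N n)%N.
      by rewrite -(ltr_nat R) (le_lt_trans _ hq)// lerDr divr_ge0 ?(ltW g0)// subr_ge0 ltW.
    rewrite natrB ?(ltnW N1)// ler_pdivrMr ?subr_gt0 ?ltr1n// mulrC -ler_pdivrMr//.
    by rewrite lerBrDr ltW.
  + have n0 : (0 < n)%N by near: n; exact: nbhs_infty_gt.
    (* The only use of N / n --> 0: the logarithm of the number of brackets over the prior mass, at
       most 2 N l, is eventually below n eps^2 / 8. *)
    have hq : (N n)%:R / n%:R * (2 * l) <= eps ^+ 2 / 8.
      apply: ltW; near: n; apply: (cvgr_lt (0 * (2 * l))); last by rewrite mul0r divr_gt0.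
      exact: cvgMl.
    have := ler_wpM2l (ler0n R n) hq.
    rewrite [leLHS](_ : _ = 2 * (N n)%:R * l)//.
    have nz : n%:R != 0 :> R by rewrite pnatr_eq0 -lt0n.
    by field.
- exact: cvg_cst.
- apply: cvg_EFin; first by near=> n.
  rewrite [X in _ --> X](_ : 0 = 0 + (Num.sqrt vareps)^-1 * 0); last by rewrite mulr0 addr0.
  apply: cvgD; first exact: cvg_expRN_nat.
  by apply: cvgMr; apply: cvg_expRN_nat; rewrite divr_gt0.
Unshelve. all: by end_near.
Qed.
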